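(* Let $G$ be one of $\mathrm{Sp}_{2m}$, $\mathrm{SO}_{2m+1}$, $\mathrm{SO}_{2m}$, $G_2$, let $F=k((\varpi))$, $\mathcal O=k[[\varpi]]$, and let $a\in\mathfrak c(\mathcal O)\cap\mathfrak c^{rs}(F)$. Then the set of $k$-points of the affine Springer fiber $\mathcal M_a$ is the set of $\mathcal O$-lattices $\mathcal L$ in the $F$-vector space $V_a$ such that 1. $\mathcal L$ is a $B_a$-module (i.e. is stable under multiplication by $x$); 2. the restriction of $\omega_a$ to $\mathcal L$ takes values in $\mathcal O$; 3. $\deg(\mathcal L:B_a)=0$ if $G=\mathrm{Sp}_{2m},\mathrm{SO}_{2m+1},G_2$, and $\deg(\mathcal L:\widetilde B_a)=0$ if $G=\mathrm{SO}_{2m}$.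
   Context: $k$ is a field with $\mathrm{char}(k)\neq2$ for symplectic and orthogonal groups and $\mathrm{char}(k)\neq 2,3$ for $G_2$. $\mathfrak c=\mathfrak g/\!\!/G=\mathrm{Spec}\,A$, and $\mathfrak c^{rs}\subset\mathfrak c$ is the regular semisimple locus. **Spectral covers.** The finite flat cover $\mathrm{Spec}\,B\to\mathrm{Spec}\,A$, $B=A[x]/(f)$, is given by: - $\mathrm{Sp}_{2m}$ ($d=2m$): $A=k[a_2,a_4,\dots,a_{2m}]$, $f=x^{2m}+a_2x^{2m-2}+\dots+a_{2m}$. - $\mathrm{SO}_{2m+1}$ ($d=2m+1$): same $A$, $f=x(x^{2m}+a_2x^{2m-2}+\dots+a_{2m})$. - $G_2$ ($d=7$): $A=k[e,q]$, $f=xf_0$, $f_0=x^6-ex^4+\frac{e^2}4x^2+q$. - $\mathrm{SO}_{2m}$ ($d=2m$): $A=k[a_2,\dots,a_{2m-2},p_m]$ ($p_m$ the Pfaffian), $f=x^{2m}+a_2x^{2m-2}+\dots+a_{2m-2}x^2+p_m^2$; one also uses the normalization $\widetilde B=A[x,p_{m-1}]/(xp_{m-1}-p_m,\ x^{2m-2}+a_2x^{2m-4}+\dots+a_{2m-2}+p_{m-1}^2)$ of $B$, free of rank $2m$ over $A$. **Forms.** Let $\tau$ be the $A$-algebra involution with $\tau(x)=-x$ (and $\tau(p_{m-1})=-p_{m-1}$). - $\mathrm{Sp}_{2m}$, $\mathrm{SO}_{2m+1}$: $\omega(b_1,b_2)$ is the coefficient of $x^{d-1}$ in $b_1\tau(b_2)$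 with respect to the basis $1,x,\dots,x^{d-1}$ of $B$ (equal to $\mathrm{tr}_{B/A}(f'^{-1}b_1\tau(b_2))$ after localization); a non-degenerate alternating, resp. symmetric, $A$-bilinear form on $B$. - $\mathrm{SO}_{2m}$: $\omega(b_1,b_2)=\mathrm{tr}_{\widetilde B/A}(D^{-1}b_1\tau(b_2))$ (computed after localization, $A$-valued on $\widetilde B$), $D=(m-1)x^{2m-2}+(m-2)a_2x^{2m-4}+\dots+a_{2m-4}x^2-p_{m-1}^2$; a non-degenerate symmetric form on $\widetilde B$. - $G_2$: let $z=x(x^2-\frac e2)$, let $\epsilon,\delta_1,\delta_2,\delta_3,\eta_1,\eta_2,\eta_3$ be the basis dual to the $A[q^{-1}]$-basis $f_0,x,x^2,x^3,xz,x^2z,x^3z$ of $B[q^{-1}]$, and $\mathrm{tr}_z(g,h)=\mathrm{Tr}_{\mathrm{Frac}(B)/\mathrm{Frac}(A)}(g(x)h(-x)z/f'(x))$ with $\mathrm{Frac}(B)=B\otimes_A\mathrm{Frac}(A)$. Then $\omega=\delta_1\wedge\delta_2\wedge\eta_3+\delta_1\wedge\eta_2\wedge\delta_3+\eta_1\wedge\delta_2\wedge\delta_3-q\,\eta_1\wedge\eta_2\wedge\eta_3+\epsilon\wedge\mathrm{tr}_z$, a non-degenerate alternating $A$-trilinear form on $B$ with values in $A$. In the $\mathrm{SO}$ and $G_2$ cases one also fixes a trivialization of $\wedge^d_AB$ (resp. $\wedge^d_A\widetilde B$). In all cases multiplication by $x$ is in the infinitesimal stabilizer of $\omega$. **Base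 change to $a$.** $B_a=B\otimes_{A,a}\mathcal O$ and $\widetilde B_a=\widetilde B\otimes_{A,a}\mathcal O$. Put $V_a=B_a\otimes_{\mathcal O}F$ (for $\mathrm{SO}_{2m}$: $V_a=\widetilde B_a\otimes_{\mathcal O}F$), a $d$-dimensional $F$-vector space. $\omega_a$ is the form on $V_a$ induced by $\omega$. **Affine Springer fiber.** For $\gamma\in\mathfrak g(F)$ regular semisimple, $\mathcal M_\gamma(k)=\{g\in G(F)/G(\mathcal O): \mathrm{ad}(g)^{-1}\gamma\in\mathfrak g(\mathcal O)\}$. $G$ is regarded as the stabilizer in $\mathrm{GL}_d$ of a non-degenerate form on $k^d$, namely an alternating bilinear form for $\mathrm{Sp}_{2m}$, a symmetric bilinear form for $\mathrm{SO}_{2m+1}$ and $\mathrm{SO}_{2m}$, and an alternating trilinear form (lying in the open $\mathrm{GL}_7$-orbit) for $G_2$ (together with a trivialization of the determinant in the $\mathrm{SO}$ and $G_2$ cases), the specific choice of which is immaterial. Identify $B_a$ (resp. $\widetilde B_a$ for $\mathrm{SO}_{2m}$), with its form $\omega_a$ and determinant trivialization, with the standard $\mathcal O^d$, and let $\gamma_a\in\mathfrak g(\mathcal O)$ be the element corresponding to multiplication by $x$; its image in $\mathfrak c$ is $a$. Then $\mathcal M_a=\mathcal M_{\gamma_a}$, and the identification of $\mathcal M_a(k)$ with a set of lattices is $g\mapsto g\,\mathcal O^d\subset F^d= V_a$. **Degree.** For lattices $\mathcal L,\mathcal L'$ in the same $F$-vector space, $\deg(\mathcal L:\mathcal L')=\mathrm{length}_{\mathcal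 O}(\mathcal L/\mathcal L\cap\mathcal L')-\mathrm{length}_{\mathcal O}(\mathcal L'/\mathcal L\cap\mathcal L')$. *)

(* Defs.v *)
From HB Require Import structures.
From mathcomp Require Import all_boot all_order all_algebra perm.
From mathcomp Require Import generic_quotient ring_quotient fraction.
From mathcomp Require Import boolp classical_sets functions.

Set Implicit Arguments.
Unset Strict Implicit.
Unset Printing Implicit Defensive.

Import GRing.Theory.
Local Open Scope ring_scope.
Local Open Scope classical_set_scope.
Local Open Scope quotient_scope.

(* k[[w]]; its fraction field, laurent k below, is k((w)) *)
Record fps (k : fieldType) := Fps { fps_coef : nat -> k }.

HB.instance Definition _ (k : fieldType) := gen_eqMixin (fps k).
HB.instance Definition _ (k : fieldType) := gen_choiceMixin (fps k).

Section PowerSeries.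
Variable k : fieldType.
Implicit Types a b c : fps k.

Lemma fpsP a b : (forall n, fps_coef a n = fps_coef b n) -> a = b.
Proof. by case: a b => [a] [b] /= /funext ->. Qed.

Definition fps_const (c : k) : fps k := Fps (fun n => if n == 0%N then c else 0).
Definition fps_add a b : fps k := Fps (fun n => fps_coef a n + fps_coef b n).
Definition fps_opp a : fps k := Fps (fun n => - fps_coef a n).
Definition fps_mul a b : fps k :=
  Fps (fun n => \sum_(i < n.+1) fps_coef a i * fps_coef b (n - i)).

Let addA : associative fps_add.
Proof. by move=> a b c; apply: fpsP => n /=; rewrite addrA. Qed.
Let addC : commutative fps_add.
Proof. by move=> a b; apply: fpsP => n /=; rewrite addrC. Qed.
Let add0 : left_id (fps_const 0) fps_add.
Proof. by move=> a; apply: fpsP => n /=; rewrite if_same add0r. Qed.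
Let addN : left_inverse (fps_const 0) fps_opp fps_add.
Proof. by move=> a; apply: fpsP => n /=; rewrite if_same addNr. Qed.

HB.instance Definition _ := GRing.isZmodule.Build (fps k) addA addC add0 addN.

Let trunc n a : {poly k} := \poly_(i < n) fps_coef a i.

Let coef_mul N n a b :
  (n < N)%N -> fps_coef (fps_mul a b) n = (trunc N a * trunc N b)`_n.
Proof.
move=> nN; rewrite coefM /=; apply: eq_bigr => -[i /= lt_in] _.
rewrite !coef_poly (leq_trans _ nN) ?(leq_ltn_trans _ nN) //.
exact: leq_subr.
Qed.

Let mulC : commutative fps_mul.
Proof.
by move=> a b; apply: fpsP => n; rewrite !(@coef_mul n.+1) // mulrC.
Qed.

Let coef_mul3 n a b c :
  fps_coef (fps_mul a (fps_mul b c)) n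
    = (trunc n.+1 a * (trunc n.+1 b * trunc n.+1 c))`_n.
Proof.
rewrite (@coef_mul n.+1) // !coefM; apply: eq_bigr => -[i /= lt_in] _.
congr (_ * _); rewrite coef_poly ltnS leq_subr.
by rewrite (@coef_mul n.+1) // ltnS leq_subr.
Qed.

Let mulA : associative fps_mul.
Proof.
move=> a b c; apply: fpsP => n.
by rewrite (mulC (fps_mul a b)) !coef_mul3 mulrCA mulrC -mulrA mulrCA mulrC.
Qed.

Let mul1 : left_id (fps_const 1) fps_mul.
Proof.
move=> a; apply: fpsP => n /=; rewrite big_ord_recl /= mul1r subn0.
by rewrite big1 ?addr0 // => i _; rewrite mul0r.
Qed.

Let mulDl : left_distributive fps_mul +%R.
Proof.
move=> a b c; apply: fpsP => n /=; rewrite -big_split /=.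
by apply: eq_bigr => i _; rewrite mulrDl.
Qed.

Let oner_neq0 : fps_const 1 != 0.
Proof.
by apply/eqP => /(congr1 (fun a => fps_coef a 0%N)) /= /eqP; rewrite oner_eq0.
Qed.

HB.instance Definition _ :=
  GRing.Zmodule_isComNzRing.Build (fps k) mulA mulC mul1 mulDl oner_neq0.

Definition fps_unit : {pred fps k} := fun a => `[< exists b, b * a = 1 >].
Definition fps_inv a : fps k := xget a [set b | b * a = 1].

Let mulV : {in fps_unit, left_inverse 1 fps_inv *%R}.
Proof.
move=> a /asboolP[b ba1]; rewrite /fps_inv.
by case: xgetP => [c _ //|/(_ b)].
Qed.
Let unitP a b : b * a = 1 -> fps_unit a.
Proof. by move=> ba1; apply/asboolP; exists b. Qed.
Let inv_out : {in [predC fps_unit], fps_inv =1 id}.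
Proof.
move=> a /negP na; rewrite /fps_inv; case: xgetP => // b _ ba1.
by case: na; apply: unitP ba1.
Qed.

HB.instance Definition _ :=
  GRing.ComNzRing_hasMulInverse.Build (fps k) mulV unitP inv_out.

Let ord_ex a : a != 0 -> exists n, fps_coef a n != 0.
Proof.
move=> a0; apply: contrapT => H; move/eqP: a0; apply; apply: fpsP => n /=.
by rewrite if_same; apply: contrapT => an0; apply: H; exists n; apply/eqP.
Qed.

Let integral : GRing.integral_domain_axiom (fps k).
Proof.
move=> a b ab0; apply: contrapT => /negP.
rewrite negb_or => /andP[/ord_ex exa /ord_ex exb].
case: (ex_minnP exa) => m am0 minm; case: (ex_minnP exb) => n bn0 minn.
have lowa i : (i < m)%N -> fps_coef a i = 0.
  by move=> im; case: (eqVneq (fps_coef a i) 0) => // /minm; rewrite leqNgt im.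
have lowb i : (i < n)%N -> fps_coef b i = 0.
  by move=> im; case: (eqVneq (fps_coef b i) 0) => // /minn; rewrite leqNgt im.
have := congr1 (fun c => fps_coef c (m + n)%N) ab0.
rewrite /GRing.mul /= if_same => /eqP; apply/negP.
have lt_m : (m < (m + n).+1)%N by rewrite ltnS leq_addr.
rewrite (bigD1 (Ordinal lt_m)) //= addKn big1 ?addr0 ?mulf_neq0 //.
move=> [i /= lti]; rewrite -val_eqE /= neq_ltn => /orP[im|mi].
  by rewrite lowa // mul0r.
rewrite [X in _ * X]lowb ?mulr0 // ltn_subLR //.
by rewrite ltn_add2r.
Qed.

HB.instance Definition _ := GRing.ComUnitRing_isIntegral.Build (fps k) integral.

Let const_zmod : zmod_morphism fps_const.
Proof. by move=> x y; apply: fpsP => -[|n] //=; rewrite subr0. Qed.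
Let const_monoid : monoid_morphism fps_const.
Proof.
split=> // x y; apply: fpsP => -[|n] /=; first by rewrite big_ord1.
by rewrite big_ord_recl big1 ?mulr0 ?addr0 // => i _; rewrite mul0r.
Qed.
HB.instance Definition _ := GRing.isZmodMorphism.Build k (fps k) fps_const const_zmod.
HB.instance Definition _ := GRing.isMonoidMorphism.Build k (fps k) fps_const const_monoid.

End PowerSeries.

Definition laurent (k : fieldType) : fieldType := {fraction (fps k)}.
Definition OtoF (k : fieldType) : {rmorphism fps k -> laurent k} :=
  @tofrac (fps k).
Definition ktoO (k : fieldType) : {rmorphism k -> fps k} := @fps_const k.
Definition ktoF (k : fieldType) : {rmorphism k -> laurent k} :=
  OtoF k \o ktoO k.

Section Presented.
Variables (R S : comNzRingType) (c : {rmorphism R -> S}) (rels : seq S).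

Definition gen_ideal : {pred S} := fun s =>
  `[< exists u : nat -> S, s = \sum_(i < size rels) u i * rels`_i >].

Let gen_ideal_zmod : zmod_closed gen_ideal.
Proof.
split=> [|s t].
  by apply/asboolP; exists (fun=> 0); rewrite big1 // => i _; rewrite mul0r.
move=> /asboolP[u ->] /asboolP[v ->]; apply/asboolP; exists (fun i => u i - v i).
by rewrite -sumrB; apply: eq_bigr => i _; rewrite mulrBl.
Qed.
HB.instance Definition _ := GRing.isZmodClosed.Build S gen_ideal gen_ideal_zmod.

Let idealM s t : t \in gen_ideal -> s * t \in gen_ideal.
Proof.
move=> /asboolP[u ->]; apply/asboolP; exists (fun i => s * u i).
by rewrite mulr_sumr; apply: eq_bigr => i _; rewrite mulrA.
Qed.

(* S/(rels) as an R-algebra via c; it may be the zero ring, whence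
   comPzRingType. *)
Definition presented : Type := (fun _ : R -> S => @Quotient.quot S gen_ideal) c.
HB.instance Definition _ := GRing.Zmodule.on presented.

Definition cls (s : S) : presented := \pi_(@Quotient.quot S gen_ideal) s.
Definition rep (v : presented) : S := repr (v : @Quotient.quot S gen_ideal).

Lemma repK v : cls (rep v) = v.
Proof. exact: reprK. Qed.

Lemma clsP s t : cls s = cls t <-> s - t \in gen_ideal.
Proof. by rewrite Quotient.idealrBE; split=> [/eqP|/eqP]. Qed.

Lemma clsD s t : cls (s + t) = cls s + cls t.
Proof. exact: Quotient.pi_add. Qed.

Definition pmul (u v : presented) : presented := cls (rep u * rep v).

Lemma clsM s t : cls (s * t) = pmul (cls s) (cls t).
Proof.
apply/clsP; set s' := rep _; set t' := rep _.
have -> : s * t - s' * t' = t * (s - s') + s' * (t - t').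
  by rewrite !mulrBr [t * s]mulrC [t * s']mulrC addrA subrK.
by apply: rpredD; apply: idealM; apply/clsP; rewrite repK.
Qed.

Let pmulA : associative pmul.
Proof. by move=> u v w; rewrite -[u]repK -[v]repK -[w]repK -!clsM mulrA. Qed.
Let pmulC : commutative pmul.
Proof. by move=> u v; rewrite -[u]repK -[v]repK -!clsM mulrC. Qed.
Let pmul1 : left_id (cls 1) pmul.
Proof. by move=> u; rewrite -[u]repK -clsM mul1r. Qed.
Let pmulDl : left_distributive pmul +%R.
Proof.
by move=> u v w; rewrite -[u]repK -[v]repK -[w]repK -!clsM -!clsD -clsM mulrDl.
Qed.
HB.instance Definition _ :=
  GRing.Zmodule_isComPzRing.Build presented pmulA pmulC pmul1 pmulDl.

Definition pscale (r : R) (v : presented) : presented := cls (c r) * v.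

Let pscaleA r s v : pscale r (pscale s v) = pscale (r * s) v.
Proof. by rewrite /pscale mulrA rmorphM clsM. Qed.
Let pscale1 : left_id 1 pscale.
Proof. by move=> v; rewrite /pscale rmorph1 mul1r. Qed.
Let pscaleDr : right_distributive pscale +%R.
Proof. by move=> r u v; rewrite /pscale mulrDr. Qed.
Let pscaleDl v : {morph pscale^~ v : r s / r + s}.
Proof. by move=> r s; rewrite /pscale rmorphD clsD mulrDl. Qed.
HB.instance Definition _ :=
  GRing.Zmodule_isLmodule.Build R presented pscaleA pscale1 pscaleDr pscaleDl.

End Presented.

Section Coordinates.
Variables (F : fieldType) (V : lmodType F) (n : nat) (b : nat -> V).

(* b 0, ..., b n.-1 is meant to be a basis of V; the coordinates of index >= n
   are set to 0. *)
Definition coord (v : V) : nat -> F :=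
  xget (fun=> 0)
    [set c | (forall i, (n <= i)%N -> c i = 0) /\ v = \sum_(i < n) c i *: b i].

Definition trace_endo (u : V -> V) : F := \sum_(i < n) coord (u (b i)) i.

End Coordinates.

Inductive grp := Sp of nat | SOodd of nat | SOeven of nat | G2.

(* Sp m, SOodd m, SOeven m are Sp_2m, SO_(2m+1), SO_2m *)
Definition admissible (G : grp) (k : fieldType) : Prop :=
  match G with
  | Sp m | SOodd m | SOeven m => (0 < m)%N /\ 2%N \notin [pchar k]
  | G2 => 2%N \notin [pchar k] /\ 3%N \notin [pchar k]
  end.

Definition gdim (G : grp) : nat :=
  match G with
  | Sp m => m.*2 | SOodd m => m.*2.+1 | SOeven m => m.*2 | G2 => 7
  end.

(* 'X^(2n) + a_2 'X^(2n-2) + ... + a_2n, where a i stands for a_(2(i+1)) *)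
Definition monic_even_poly (R : comNzRingType) n (a : 'I_n -> R) : {poly R} :=
  'X^(n.*2) + \sum_(i < n) a i *: 'X^((n - i.+1).*2).

(* R-points of c = Spec A: (a_2, ..., a_2m); ((a_2, ..., a_(2m-2)), p_m) for
   SO_2m; (e, q) for G_2. *)
Definition cpoint (G : grp) (R : Type) : Type :=
  match G with
  | Sp m | SOodd m => 'I_m -> R
  | SOeven m => (('I_m.-1 -> R) * R)%type
  | G2 => (R * R)%type
  end.

Definition cpoint_map (G : grp) (R R' : Type) (h : R -> R') :
    cpoint G R -> cpoint G R' :=
  match G with
  | Sp m | SOodd m => fun a => h \o a
  | SOeven m => fun a => (h \o a.1, h a.2)
  | G2 => fun a => (h a.1, h a.2)
  end.

Definition G2_poly (R : comUnitRingType) (e q : R) : {poly R} :=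
  'X^6 - e *: 'X^4 + (e ^+ 2 / 4%:R) *: 'X^2 + q%:P.

Definition spectral_poly (G : grp) (R : comUnitRingType) :
    cpoint G R -> {poly R} :=
  match G with
  | Sp m => fun a => monic_even_poly a
  | SOodd m => fun a => 'X * monic_even_poly a
  | SOeven m => fun a => monic_even_poly a.1 * 'X^2 + (a.2 ^+ 2)%:P
  | G2 => fun a => 'X * G2_poly a.1 a.2
  end.

(* R[x], resp. R[x][p_(m-1)] for SO_2m *)
Definition poly_ring (G : grp) (R : comNzRingType) : comNzRingType :=
  match G with
  | SOeven m => {poly {poly R}}
  | _ => {poly R}
  end.

Definition poly_const (G : grp) (R : comNzRingType) :
    {rmorphism R -> poly_ring G R} :=
  match G with
  | SOeven m => polyC \o polyC
  | _ => @polyC R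
  end.

Definition poly_x (G : grp) (R : comNzRingType) : poly_ring G R :=
  match G with
  | SOeven m => 'X%:P
  | _ => 'X
  end.

Definition poly_base_change (G : grp) (R R' : comNzRingType)
    (h : {rmorphism R -> R'}) : poly_ring G R -> poly_ring G R' :=
  match G with
  | SOeven m => map_poly (map_poly h)
  | _ => map_poly h
  end.

(* the substitution x |-> - x, p_(m-1) |-> - p_(m-1) *)
Definition poly_tau (G : grp) (R : comNzRingType) :
    poly_ring G R -> poly_ring G R :=
  match G with
  | SOeven m => fun h => map_poly (fun c : {poly R} => c \Po - 'X) h \Po - 'X
  | _ => fun h => h \Po - 'X
  end.

Definition relations (G : grp) (R : comUnitRingType) :
    cpoint G R -> seq (poly_ring G R) :=
  match G with
  | SOeven m => fun a =>
      [:: ('X)%:P * 'X - a.2%:P%:P; (monic_even_poly a.1)%:P + 'X^2]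
  | Sp m => fun a => [:: @spectral_poly (Sp m) R a]
  | SOodd m => fun a => [:: @spectral_poly (SOodd m) R a]
  | G2 => fun a => [:: @spectral_poly G2 R a]
  end.

(* The base change along a point a of B, resp. of its normalization for
   SO_2m. Presentations commute with base change, so that the algebra over F
   at a point coming from O is the generic fibre V_a of the one over O. *)
Definition spectral_alg (G : grp) (R : comUnitRingType) (a : cpoint G R) :=
  presented (poly_const G R) (relations a).

Section SpectralAlgebra.
Variables (G : grp) (F : fieldType) (a : cpoint G F).
Local Notation V := (spectral_alg a).

Definition alg_cls (h : poly_ring G F) : V :=
  cls (poly_const G F) (relations a) h.
Definition alg_x : V := alg_cls (poly_x G F).
Definition alg_tau (v : V) : V :=
  alg_cls (poly_tau (rep (v : presented (poly_const G F) (relations a)))).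

(* 1, x, ..., x^(d-1), resp. 1, x, ..., x^(2m-2), p_(m-1) for SO_2m *)
Definition std_basis (i : nat) : V :=
  alg_cls
    (match G return poly_ring G F with
     | SOeven m => if (i < m.*2.-1)%N then ('X^i)%:P else 'X
     | _ => 'X^i
     end).

Definition alg_tr (v : V) : F := trace_endo (gdim G) std_basis ( *%R v).

(* u / v when v is invertible *)
Definition alg_div (u v : V) : V := xget 0 [set w | v * w = u].

End SpectralAlgebra.

Definition arity (G : grp) : nat := if G is G2 then 3 else 2.

Definition top_form (G : grp) (F : fieldType) (a : cpoint G F)
    (v0 v1 : spectral_alg a) : F :=
  coord (gdim G) (std_basis a) (v0 * alg_tau v1) (gdim G).-1.

Section SOevenForm.
Variables (m : nat) (F : fieldType) (a : cpoint (SOeven m) F).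

(* with n = m - 1: n x^(2n) + (n-1) a_2 x^(2n-2) + ... + a_(2n-2) x^2 - p_n^2 *)
Definition SOeven_D : spectral_alg a :=
  alg_cls a
    ((m.-1%:R *: 'X^(m.-1.*2)
      + \sum_(i < m.-1) ((m.-1 - i.+1)%:R * a.1 i) *: 'X^((m.-1 - i.+1).*2))%:P
     - 'X^2 : {poly {poly F}}).

Definition SOeven_form (v0 v1 : spectral_alg a) : F :=
  alg_tr (alg_div (v0 * alg_tau v1) SOeven_D).

End SOevenForm.

Section G2Form.
Variables (F : fieldType) (a : cpoint G2 F).
Local Notation V := (spectral_alg a).
Local Notation e := a.1.
Local Notation q := a.2.
Implicit Type v : 'I_3 -> V.

Definition G2_z : {poly F} := 'X * ('X^2 - (e / 2%:R)%:P).

(* f_0, x, x^2, x^3, x z, x^2 z, x^3 z *)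
Definition G2_basis (i : nat) : V :=
  alg_cls a
    (if i == 0%N then G2_poly e q
     else if (i <= 3)%N then 'X^i
     else 'X^(i - 3) * G2_z : {poly F}).

(* the dual basis, as functions on V *)
Definition G2_eps (v : V) : F := coord 7 G2_basis v 0%N.
Definition G2_delta (i : nat) (v : V) : F := coord 7 G2_basis v i.
Definition G2_eta (i : nat) (v : V) : F := coord 7 G2_basis v (3 + i)%N.

Definition G2_tr (g h : V) : F :=
  alg_tr (alg_div (g * alg_tau h * alg_cls a G2_z)
                  (alg_cls a ((spectral_poly a)^`() : {poly F}))).

Definition wedge111 (l0 l1 l2 : V -> F) v : F :=
  \det (\matrix_(i < 3, j < 3) nth l0 [:: l0; l1; l2] i (v j)).

Definition wedge12 (l : V -> F) (b : V -> V -> F) v : F :=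
  let v0 := v (inord 0) in let v1 := v (inord 1) in let v2 := v (inord 2) in
  l v0 * b v1 v2 - l v1 * b v0 v2 + l v2 * b v0 v1.

Definition G2_form v : F :=
  wedge111 (G2_delta 1) (G2_delta 2) (G2_eta 3) v
  + wedge111 (G2_delta 1) (G2_eta 2) (G2_delta 3) v
  + wedge111 (G2_eta 1) (G2_delta 2) (G2_delta 3) v
  - q * wedge111 (G2_eta 1) (G2_eta 2) (G2_eta 3) v + wedge12 G2_eps G2_tr v.

End G2Form.

(* The form induced by omega on the fibre at a. For SO_2m and G_2 it is computed
   by the trace formulas in the fibre itself, which is legitimate when a is
   regular semisimple: there D, resp. f' and q, are invertible. *)
Definition omega (G : grp) (F : fieldType) :
    forall a : cpoint G F, ('I_(arity G) -> spectral_alg a) -> F :=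
  match G with
  | Sp m => fun a v => top_form (v ord0) (v ord_max)
  | SOodd m => fun a v => top_form (v ord0) (v ord_max)
  | SOeven m => fun a v => SOeven_form (v ord0) (v ord_max)
  | G2 => fun a v => G2_form v
  end.

(* number of coordinates t_i on the standard Cartan subalgebra t *)
Definition ntorus (G : grp) : nat :=
  match G with Sp m | SOodd m | SOeven m => m | G2 => 3 end.

(* t acts on the standard representation with eigenvalues t_i, - t_i, and also 0
   if the dimension is odd; for G_2 the t_i sum to 0. *)
Definition in_torus (G : grp) (E : fieldType) (t : 'I_(ntorus G) -> E) : Prop :=
  if G is G2 then \sum_i t i = 0 else True.

Definition torus_poly (G : grp) (E : fieldType) (t : 'I_(ntorus G) -> E) :
    {poly E} :=
  (if G is (SOodd _ | G2) then 'X else 1) * \prod_i ('X^2 - (t i ^+ 2)%:P).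

(* no root of G vanishes at t *)
Definition roots_neq0 (G : grp) (E : fieldType) (t : 'I_(ntorus G) -> E) : Prop :=
  match G with
  | Sp _ => (forall i, t i *+ 2 != 0) /\
            (forall i j, i != j -> t i - t j != 0 /\ t i + t j != 0)
  | SOodd _ => (forall i, t i != 0) /\
            (forall i j, i != j -> t i - t j != 0 /\ t i + t j != 0)
  | SOeven _ => forall i j, i != j -> t i - t j != 0 /\ t i + t j != 0
  | G2 => (forall i, t i != 0) /\ (forall i j, i != j -> t i - t j != 0)
  end.

(* c^rs is the image of t^rs = {t | no root vanishes at t} under t -> t/W = c.
   For SO_2m the polynomial determines p_m only up to sign, but
   t |-> (- t_0, t_1, ...) changes that sign and preserves t^rs. *)
Definition regular_semisimple (G : grp) (F : fieldType) (a : cpoint G F) : Prop :=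
  exists (E : fieldType) (iota : {rmorphism F -> E}) (t : 'I_(ntorus G) -> E),
    [/\ in_torus t, map_poly iota (spectral_poly a) = torus_poly t
      & roots_neq0 t].

Definition multi_index (G : grp) : finType := {ffun 'I_(arity G) -> 'I_(gdim G)}.

(* coefficients of a multilinear form on the standard module of rank d *)
Definition tensor (G : grp) (k : Type) : Type := multi_index G -> k.

Definition std_form (G : grp) (k R : comNzRingType) (iota : {rmorphism k -> R})
    (T : tensor G k) (v : 'I_(arity G) -> 'cV[R]_(gdim G)) : R :=
  \sum_(s : multi_index G) iota (T s) * \prod_i v i (s i) 0.

Definition tensor_perm (G : grp) (p : {perm 'I_(arity G)})
    (s : multi_index G) : multi_index G :=
  [ffun i => s (p i)].

Definition symmetric_tensor (G : grp) (k : comNzRingType) (T : tensor G k) : Prop :=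
  forall p s, T (tensor_perm p s) = T s.

Definition alternating_tensor (G : grp) (k : comNzRingType) (T : tensor G k) : Prop :=
  (forall s : multi_index G, ~ injective s -> T s = 0) /\
  (forall p s, T (tensor_perm p s) = (-1) ^+ p * T s).

Definition nondegenerate (G : grp) (k : comNzRingType) (T : tensor G k) : Prop :=
  forall u, (forall v, (exists i, v i = u) -> std_form idfun T v = 0) -> u = 0.

Inductive polyfun (I : Type) (E : comNzRingType) : ((I -> E) -> E) -> Prop :=
  | polyfun_const c : polyfun (fun=> c)
  | polyfun_coord i : polyfun (fun T => T i)
  | polyfun_add P Q : polyfun P -> polyfun Q -> polyfun (fun T => P T + Q T)
  | polyfun_mul P Q : polyfun P -> polyfun Q -> polyfun (fun T => P T * Q T).

(* the GL_d-orbit of T is Zariski open in the space of alternating forms,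
   geometrically *)
Definition in_open_orbit (G : grp) (k : fieldType) (T : tensor G k) : Prop :=
  forall (E : closedFieldType) (iota : {rmorphism k -> E}),
  let orbit : set (tensor G E) :=
    [set T' | exists2 g : 'M[E]_(gdim G), g \in unitmx &
       forall v, std_form idfun T' v = std_form iota T (fun i => g *m v i)] in
  forall T', orbit T' -> exists P, [/\ polyfun P, P T' != 0
    & forall T'', alternating_tensor T'' -> P T'' != 0 -> orbit T''].

Definition standard_tensor (G : grp) (k : fieldType) (T : tensor G k) : Prop :=
  match G with
  | Sp _ => alternating_tensor T /\ nondegenerate T
  | SOodd _ | SOeven _ => symmetric_tensor T /\ nondegenerate T
  | G2 => alternating_tensor T /\ in_open_orbit T
  end.

Definition special (G : grp) : Prop := if G is Sp _ then False else True.

Section Group.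
Variables (G : grp) (k : fieldType) (T : tensor G k).
Variables (R : comUnitRingType) (iota : {rmorphism k -> R}).

Definition Gpoints : set 'M[R]_(gdim G) :=
  [set g | [/\ g \in unitmx,
      forall v, std_form iota T (fun i => g *m v i) = std_form iota T v
    & special G -> \det g = 1]].

Definition Lie_points : set 'M[R]_(gdim G) :=
  [set X | (forall v, \sum_i std_form iota T
                        (fun j => if j == i then X *m v j else v j) = 0)
    /\ (special G -> \tr X = 0)].

End Group.

Section Lattices.
Variables (k : fieldType) (V : lmodType (laurent k)).
Implicit Types L N : set V.

Definition Osubmodule L : Prop :=
  [/\ L 0, forall u v, L u -> L v -> L (u + v)
    & forall (o : fps k) v, L v -> L (OtoF k o *: v)].

Definition lattice L : Prop :=
  exists n (b : 'I_n -> V),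
    L = [set v | exists o : 'I_n -> fps k, v = \sum_i OtoF k (o i) *: b i] /\
    forall v, exists c : 'I_n -> laurent k, v = \sum_i c i *: b i.

Definition Ochain L N n : Prop :=
  exists M : nat -> set V,
    [/\ M 0%N = N, M n = L, forall i, (i <= n)%N -> Osubmodule (M i)
      & forall i, (i < n)%N -> M i `<` M i.+1].

(* the length of L/N, for N contained in L and L/N of finite length *)
Definition Olength L N : nat :=
  xget 0%N [set n | Ochain L N n /\ forall n', Ochain L N n' -> (n' <= n)%N].

Definition degree L L' : int :=
  (Olength L (L `&` L'))%:Z - (Olength L' (L `&` L'))%:Z.

End Lattices.

Section AffineSpringer.
Variables (G : grp) (k : fieldType).
Local Notation F := (laurent k).
Local Notation O := (fps k).
Local Notation d := (gdim G).

Definition to_generic (a : cpoint G O) : cpoint G F := cpoint_map (OtoF k) a.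

Definition Va (a : cpoint G O) : Type := spectral_alg (to_generic a).

(* the image in V_a of B_a, resp. of its normalization for SO_2m *)
Definition Ba (a : cpoint G O) : set (Va a) :=
  [set v | exists h : poly_ring G O,
     v = alg_cls (to_generic a) (poly_base_change (OtoF k) h)].
Arguments Ba : clear implicits.

Definition Od : set 'cV[F]_d := range (map_mx (OtoF k)).

(* Phi identifies O^d, with the form T, with B_a, with the form omega_a, and, for
   SO and G_2, the trivialization of the top exterior power of B given by cB
   (an element of A^* = k^*, relative to std_basis) with that of k^d given by
   c0. *)
Definition identification (a : cpoint G O) (T : tensor G k) (cB c0 : k)
    (Phi : {linear 'cV[F]_d -> Va a}) : Prop :=
  [/\ bijective Phi,
      Phi @` Od = Ba a,
      forall v : 'I_(arity G) -> 'cV[F]_d,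
        omega (fun i => Phi (v i)) = std_form (ktoF k) T v
    & special G -> forall v : 'I_d -> 'cV[F]_d,
        ktoF k cB * \det (\matrix_(i, j)
            coord d (std_basis (to_generic a)) (Phi (v j)) i)
        = ktoF k c0 * \det (\matrix_(i, j) v j i 0)].

Definition GOcoset (T : tensor G k) (g : 'M[F]_d) : set 'M[F]_d :=
  [set g *m map_mx (OtoF k) h | h in Gpoints T (ktoO k)].

(* a coset in G(F)/G(O) is represented by the corresponding subset of G(F) *)
Definition springer_fiber (T : tensor G k) (gamma : 'M[F]_d) : set (set 'M[F]_d) :=
  [set C | exists2 g, Gpoints T (ktoF k) g /\
      [set map_mx (OtoF k) X | X in Lie_points T (ktoO k)]
        (invmx g *m gamma *m g)
    & C = GOcoset T g].

(* C O^d; it is g O^d when C = g G(O) *)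
Definition coset_lattice (C : set 'M[F]_d) : set 'cV[F]_d :=
  [set v | exists g w, [/\ C g, Od w & v = g *m w]].

Definition spectral_lattice (a : cpoint G O) (L : set (Va a)) : Prop :=
  [/\ lattice L,
      forall v, L v -> L (alg_x (to_generic a) * v),
      forall v : 'I_(arity G) -> Va a, (forall i, L (v i)) ->
        range (OtoF k) (omega v)
    & degree L (Ba a) = 0].

End AffineSpringer.

Arguments Ba {G k} a _.
Arguments spectral_lattice {G k} a _.

(* Main.v *)
(* A lattice [L = g O^d] has degree 0 relative to [B_a] iff [\det g] is a unit
   of [O]. If moreover the form is integral on [L], it is unimodular there, and
   then [L] is isometric over [O] to [O^d], so that [g] can be chosen in [G(F)];
   stability under [x] then says that [g^-1 gamma g] is integral, and the Lie
   algebra condition holds because multiplication by [x] is skew.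

   For a bilinear form, the Smith normal form reduces the isometry to the case
   of a diagonal [g], where hyperbolic planes of coordinates are split off one by
   one (solving a quadratic equation by completeness); a reflection over [k]
   corrects the determinant for SO.

   For G_2, an explicit frame of [B_a] over [O] identifies [omega] with a split
   form [phi] on [O^7]. Contracting three copies of [phi] with the alternating
   7-tensor gives 144 times the invariant quadratic form [ip], so that [ip] is
   integral and unimodular on [L]. Then [L] contains [c] with [ip c c = -1]; the
   cross product by [c] splits the orthogonal complement of [c] into two
   isotropic eigenspaces in duality, from which a split frame of [L] is
   extracted. *)
Require Import Defs.
From HB Require Import structures.
From mathcomp Require Import all_boot all_order all_algebra perm.
From mathcomp Require Import separable fraction generic_quotient ring_quotient.
From mathcomp Require Import boolp classical_sets functions.
From mathcomp Require Import ring zify.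

Set Implicit Arguments.
Unset Strict Implicit.
Unset Printing Implicit Defensive.

Import GRing.Theory Num.Theory Order.TTheory.
Local Open Scope ring_scope.
Local Open Scope classical_set_scope.

(** * Laurent series *)

Section Valuation.
Variable k : fieldType.
Local Notation O := (fps k).
Local Notation F := (laurent k).

Lemma OtoF_inj : injective (OtoF k).
Proof. by move=> a b /eqP; rewrite tofrac_eq => /eqP. Qed.

Definition fpsX : O := Fps (fun n => (n == 1%N)%:R).

Lemma coef_fpsXM (a : O) n :
  fps_coef (fpsX * a) n = if n is m.+1 then fps_coef a m else 0.
Proof.
rewrite /GRing.mul /=; case: n => [|n]; first by rewrite big_ord1 mul0r.
rewrite big_ord_recl mul0r add0r big_ord_recl big1 ?addr0 /= ?mul1r ?subSS ?subn0 //.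
by move=> i _; rewrite mul0r.
Qed.

Lemma coef_ktoOM c (a : O) n : fps_coef (ktoO k c * a) n = c * fps_coef a n.
Proof.
have -> : fps_coef (ktoO k c * a) n =
    \sum_(i < n.+1) (if i == 0%N :> nat then c else 0) * fps_coef a (n - i).
  by [].
rewrite big_ord_recl subn0 big1 ?addr0 // => i _; exact: mul0r.
Qed.

Lemma fps_shift (a : O) : fps_coef a 0 = 0 -> exists b, a = fpsX * b.
Proof.
move=> a0; exists (Fps (fun n => fps_coef a n.+1)).
by apply: fpsP => -[|n]; rewrite coef_fpsXM.
Qed.

Lemma coefB_fps (a b : O) n : fps_coef (a - b) n = fps_coef a n - fps_coef b n.
Proof. by []. Qed.

Lemma coef_fpsXnM (a : O) m n : (n < m)%N -> fps_coef (fpsX ^+ m * a) n = 0.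
Proof.
elim: m n => // m IHm [|n] nm; rewrite exprS -mulrA coef_fpsXM //.
exact: IHm.
Qed.

Lemma fps_shiftn (a : O) m :
  (forall n, (n < m)%N -> fps_coef a n = 0) -> exists b, a = fpsX ^+ m * b.
Proof.
elim: m a => [|m IHm] a am; first by exists a; rewrite expr0 mul1r.
have [b Eb] := fps_shift (am 0%N isT); rewrite Eb in am *.
have [n nm|c ->] := IHm b; last by exists c; rewrite exprS mulrA.
by have := am n.+1; rewrite coef_fpsXM; apply.
Qed.

(* Completeness of [k[[w]]], in the form of a contraction principle. *)
Lemma fps_fixpoint (phi : O -> O) :
    (forall n a b, (exists c, a - b = fpsX ^+ n * c) ->
                   exists c, phi a - phi b = fpsX ^+ n.+1 * c) ->
  exists x, phi x = x.
Proof.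
move=> phiP; pose y n := iter n phi 0.
have yS n : exists c, y n.+1 - y n = fpsX ^+ n * c.
  elim: n => [|n IHn]; first by exists (y 1%N - y 0%N); rewrite expr0 mul1r.
  exact: phiP.
have yD m n : exists c, y (m + n)%N - y n = fpsX ^+ n * c.
  elim: m => [|m [c IHm]]; first by exists 0; rewrite subrr mulr0.
  have [d Ed] := yS (m + n)%N.
  exists (fpsX ^+ m * d + c); rewrite mulrDr -IHm mulrA -exprD [(n + m)%N]addnC -Ed.
  by rewrite addrA subrK.
pose x := Fps (fun n => fps_coef (y n.+1) n).
have xy n : exists c, x - y n = fpsX ^+ n * c.
  apply: fps_shiftn => j jn; rewrite coefB_fps /=.
  have [c Ec] := yD (n - j.+1)%N j.+1; rewrite subnK // in Ec.
  have := congr1 (fun a => fps_coef a j) Ec.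
  by rewrite coefB_fps coef_fpsXnM // => /subr0_eq ->; rewrite subrr.
exists x; apply: fpsP => n; apply/eqP; rewrite -subr_eq0 -coefB_fps; apply/eqP.
have [c Ec] := phiP _ _ _ (xy n); have [d Ed] := xy n.+1.
have -> : phi x - x = fpsX ^+ n.+1 * (c - d).
  by rewrite mulrBr -Ec -Ed /= opprB addrA subrK.
exact: coef_fpsXnM.
Qed.

Lemma fps_unitP (a : O) : reflect (fps_coef a 0 != 0) (a \is a GRing.unit).
Proof.
apply: (iffP idP) => [/mulVr/(congr1 (fun b => fps_coef b 0%N))|a0].
  rewrite {1}/GRing.mul /= big_ord1 /= => E; apply: contraTneq isT => a0.
  by move: E; rewrite a0 mulr0 => /eqP; rewrite eq_sym oner_eq0.
have [b Eb] : exists b, a = ktoO k (fps_coef a 0) + fpsX * b.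
  have [|b Eb] := @fps_shift (a - ktoO k (fps_coef a 0)).
    by rewrite coefB_fps subrr.
  by exists b; rewrite -Eb addrC subrK.
set a0' := fps_coef a 0 in a0 Eb.
have [|x Ex] := @fps_fixpoint (fun x => ktoO k a0'^-1 * (1 - fpsX * b * x)).
  move=> n c d [e Ee]; exists (- (ktoO k a0'^-1 * b * e)).
  have -> : c = d + fpsX ^+ n * e by rewrite -Ee addrC subrK.
  by rewrite exprS; ring.
apply/unitrP; exists x; suff xa : x * a = 1 by split; rewrite // mulrC.
rewrite Eb mulrDr -{1}Ex mulrAC -rmorphM mulVf // rmorph1 mul1r.
by rewrite [x * _]mulrC subrK.
Qed.

Lemma fps_factor (a : O) : a != 0 -> exists n u,
  a = fpsX ^+ n * u /\ u \is a GRing.unit.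
Proof.
move=> a0; have ex : exists n, fps_coef a n != 0.
  apply: contrapT => H; move/eqP: a0; apply; apply: fpsP => n.
  by case: (eqVneq (fps_coef a n) 0) => [->|an]; [case: n | case: H; exists n].
case: (ex_minnP ex) => n an minn.
have [|u Eu] := @fps_shiftn a n.
  by move=> j jn; apply: contraTeq jn => /minn; rewrite -leqNgt.
exists n, u; split=> //; apply/fps_unitP; move: an; rewrite Eu.
by elim: {minn Eu} n => [|n IHn]; rewrite ?expr0 ?mul1r // exprS -mulrA coef_fpsXM.
Qed.

Lemma fpsX_neq0 : fpsX != 0.
Proof.
by apply/eqP => /(congr1 (fun a => fps_coef a 1%N)) /eqP; rewrite /= oner_eq0.
Qed.

Definition Oint : {pred F} := fun x => `[< range (OtoF k) x >].

Lemma OintP x : reflect (exists o, x = OtoF k o) (x \in Oint).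
Proof.
by apply: (iffP (asboolP _)) => [[o _ <-]|[o ->]]; exists o.
Qed.

Lemma OtoF_int o : OtoF k o \in Oint.
Proof. by apply/OintP; exists o. Qed.
Hint Resolve OtoF_int : core.

Lemma Oint_subring : subring_closed Oint.
Proof.
split; first by rewrite -(rmorph1 (OtoF k)).
  by move=> _ _ /OintP[a ->] /OintP[b ->]; rewrite -rmorphB.
by move=> _ _ /OintP[a ->] /OintP[b ->]; rewrite -rmorphM.
Qed.
HB.instance Definition _ := GRing.isSubringClosed.Build F Oint Oint_subring.

Definition varpi : F := OtoF k fpsX.

Lemma varpi_neq0 : varpi != 0.
Proof. by rewrite tofrac_eq0 fpsX_neq0. Qed.

Lemma varpi_int : varpi \in Oint. Proof. exact: OtoF_int. Qed.

Definition Ounit : {pred F} := fun x => [&& x != 0, x \in Oint & x^-1 \in Oint].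

Lemma OunitP x : reflect [/\ x != 0, x \in Oint & x^-1 \in Oint] (x \in Ounit).
Proof. exact: and3P. Qed.

Lemma OunitV x : x \in Ounit -> x^-1 \in Ounit.
Proof. by case/OunitP=> *; apply/OunitP; rewrite invr_eq0 invrK. Qed.
Lemma OunitM x y : x \in Ounit -> y \in Ounit -> x * y \in Ounit.
Proof.
case/OunitP=> ? ? ? /OunitP[? ? ?]; apply/OunitP.
by rewrite mulf_neq0 // invfM !rpredM.
Qed.
Lemma OtoF_unit u : u \is a GRing.unit -> OtoF k u \in Ounit.
Proof.
move=> uu; apply/OunitP; split; rewrite -?rmorphV //.
by rewrite tofrac_eq0; apply: contraTneq uu => ->; rewrite unitr0.
Qed.

Lemma ktoF_unit c : c != 0 -> ktoF k c \in Ounit.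
Proof. by move=> c0; apply: OtoF_unit; apply/fps_unitP. Qed.

Lemma varpi_exp_int n : (varpi ^ n \in Oint) = (0 <= n).
Proof.
case: n => n; first by rewrite /exprz rpredX ?varpi_int.
rewrite /= /exprz; apply/negbTE/negP => /OintP[o Eo].
have := congr1 (fun x => x * varpi ^+ n.+1) Eo.
rewrite mulVf ?expf_neq0 ?varpi_neq0 // -rmorphXn -rmorphM.
rewrite -(rmorph1 (OtoF k)) => /OtoF_inj/(congr1 (fun a => fps_coef a 0%N)).
by rewrite mulrC coef_fpsXnM // => /eqP; rewrite oner_eq0.
Qed.

Lemma laurent_frac (x : F) : exists a b, b != 0 /\ x = OtoF k a / OtoF k b.
Proof.
elim/quotW: x => r; exists (frac r).1, (frac r).2.
split; first exact: denom_ratioP.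
have b0 : OtoF k (frac r).2 != 0 by rewrite tofrac_eq0 denom_ratioP.
apply: (mulIf b0); rewrite divfK //.
rewrite /OtoF /=; unlock FracField.tofrac; rewrite /GRing.mul /= -FracField.pi_mul.
apply/eqmodP; rewrite /= /FracField.equivf /FracField.mulf /=.
by rewrite !numden_Ratio ?mulr1 ?oner_neq0 ?denom_ratioP // mulrC.
Qed.

Lemma laurent_factor (x : F) : x != 0 ->
  exists n u, x = varpi ^ n * u /\ u \in Ounit.
Proof.
have [a [b [b0 ->]]] := laurent_frac x => x0.
have a0 : a != 0 by apply: contraNneq x0 => ->; rewrite rmorph0 mul0r.
have [n [u [-> uu]]] := fps_factor a0; have [m [v [-> vu]]] := fps_factor b0.
exists (n%:Z - m%:Z), (OtoF k u / OtoF k v); split; last first.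
  by apply: OunitM; rewrite ?OunitV ?OtoF_unit.
rewrite !rmorphM !rmorphXn -/varpi expfzDr ?varpi_neq0 // -exprz_inv -!exprnP.
by rewrite exprVn invfM mulrACA.
Qed.

End Valuation.
Arguments Oint : clear implicits.
Arguments Ounit : clear implicits.

Lemma Ohensel (k : fieldType) (a b s : laurent k) :
  a \in Oint k -> b \in Oint k -> s \in Ounit k ->
  exists2 t, t \in Oint k & a + s * t + varpi k * b * t ^+ 2 = 0.
Proof.
move=> /OintP[a' Ea] /OintP[b' Eb] /OunitP[s0 _ /OintP[s' Es]].
have [|x Ex] := @fps_fixpoint k (fun x => - s' * (a' + fpsX k * b' * x ^+ 2)).
  move=> n c d [e Ee]; exists (- s' * b' * e * (c + d)).
  have -> : c = d + fpsX k ^+ n * e by rewrite -Ee addrC subrK.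
  by rewrite [fpsX k ^+ n.+1]exprS; ring.
exists (OtoF k x); first exact: OtoF_int.
have -> : a + s * OtoF k x + varpi k * b * OtoF k x ^+ 2 =
   s * (OtoF k x + s^-1 * (a + varpi k * b * OtoF k x ^+ 2)).
  by rewrite [RHS]mulrDr mulVKf //; ring.
rewrite Es Ea Eb /varpi -rmorphXn -!rmorphM -!rmorphD -!rmorphM -!rmorphD.
by rewrite -{1}Ex mulNr addNr rmorph0 mulr0.
Qed.

(* The lemmas on lattices and forms are proved over this abstract henselian
   discretely valued field: the concrete fraction field would be unfolded by
   the conversion checks. *)
Record hdvf := Hdvf {
  hfield :> fieldType;
  hint : {pred hfield};
  hpi : hfield;
  hint_closed : subring_closed hint;
  hpi_neq0 : hpi != 0;
  hpi_int : forall n, (hpi ^ n \in hint) = (0 <= n);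
  hfactor : forall x, x != 0 -> exists n u,
    [/\ x = hpi ^ n * u, u \in hint & u^-1 \in hint];
  hhensel : forall a b s, a \in hint -> b \in hint ->
    s != 0 -> s \in hint -> s^-1 \in hint ->
    exists2 t, t \in hint & a + s * t + hpi * b * t ^+ 2 = 0 }.
HB.instance Definition _ (E : hdvf) :=
  GRing.isSubringClosed.Build E (@hint E) (@hint_closed E).

Section Hdvf.
Variable E : hdvf.
Local Notation Oi := (@hint E).
Local Notation w := (hpi E).
Implicit Types x y u : E.

Definition hunit : {pred E} := fun x => [&& x != 0, x \in Oi & x^-1 \in Oi].

Lemma hunitP x : reflect [/\ x != 0, x \in Oi & x^-1 \in Oi] (x \in hunit).
Proof. exact: and3P. Qed.

Lemma hunitW x : x \in hunit -> x \in Oi. Proof. by case/hunitP. Qed.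
Lemma hunit_neq0 x : x \in hunit -> x != 0. Proof. by case/hunitP. Qed.
Lemma hunitV x : x \in hunit -> x^-1 \in hunit.
Proof. by case/hunitP=> *; apply/hunitP; rewrite invr_eq0 invrK. Qed.
Lemma hunitM x y : x \in hunit -> y \in hunit -> x * y \in hunit.
Proof.
case/hunitP=> ? ? ? /hunitP[? ? ?]; apply/hunitP.
by rewrite mulf_neq0 // invfM !rpredM.
Qed.
Lemma hunit1 : 1 \in hunit.
Proof. by apply/hunitP; rewrite oner_neq0 invr1 !rpred1. Qed.
Lemma hunitN x : x \in hunit -> - x \in hunit.
Proof. by case/hunitP=> *; apply/hunitP; rewrite oppr_eq0 invrN !rpredN. Qed.

Lemma hpiXM_int n u : u \in hunit -> (w ^ n * u \in Oi) = (0 <= n).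
Proof.
move=> uu; rewrite -(hpi_int E); apply/idP/idP => H.
  by rewrite -[_ ^ n](mulfK (hunit_neq0 uu)) rpredM // hunitW ?hunitV.
by rewrite rpredM // hunitW.
Qed.

Lemma hpiX_neq0 (n : int) : w ^ n != 0.
Proof. by rewrite expfz_neq0 ?hpi_neq0. Qed.

Lemma hfactorP x : x != 0 -> exists n u, x = w ^ n * u /\ u \in hunit.
Proof.
move=> x0; have [n [u [Ex uO uV]]] := hfactor x0; exists n, u; split=> //.
by apply/hunitP; split=> //; apply: contraNneq x0 => u0; rewrite Ex u0 mulr0.
Qed.

Lemma hint_or_inv x : x \in Oi \/ x^-1 \in Oi.
Proof.
have [->|/hfactorP[n [u [-> uu]]]] := eqVneq x 0.
  by left; rewrite rpred0.
rewrite invfM invr_expz !hpiXM_int ?hunitV //.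
by have [|] := leP 0 n; [left | right; lia].
Qed.

Lemma hint_unit_or x : x \in Oi -> x \in hunit \/ w^-1 * x \in Oi.
Proof.
have [->|/hfactorP[n [u [-> uu]]]] := eqVneq x 0.
  by right; rewrite mulr0 rpred0.
rewrite -exprN1 mulrA -expfzDr ?hpi_neq0 // !hpiXM_int //.
have [-> _|] := eqVneq n 0; first by left; rewrite mul1r.
by right; lia.
Qed.

Lemma hunit_max x : x \in hunit -> w^-1 * x \notin Oi.
Proof. by move=> xu; rewrite -exprN1 hpiXM_int. Qed.

Lemma hunit_root x n : (0 < n)%N -> x ^+ n \in hunit -> x \in hunit.
Proof.
move=> n0 xu; have x0 : x != 0.
  by move: (hunit_neq0 xu); rewrite expf_eq0 n0.
have [m [u [Ex uu]]] := hfactorP x0.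
have uX j : u ^+ j \in hunit.
  by elim: j => [|j IHj]; rewrite ?hunit1 // exprS hunitM.
suff m0 : m = 0 by rewrite Ex m0 mul1r.
case/hunitP: xu => _; rewrite Ex exprMn [(w ^ m) ^+ n]exprnP exprz_exp.
rewrite invfM invr_expz !hpiXM_int ?hunitV //.
move=> *; nia.
Qed.

End Hdvf.

Definition laurent_hdvf (k : fieldType) : hdvf.
Proof.
apply: (@Hdvf (laurent k) (Oint k) (varpi k)).
- exact: Oint_subring.
- exact: varpi_neq0.
- exact: varpi_exp_int.
- move=> x /laurent_factor[n [u [-> /OunitP[_ uO uV]]]]; by exists n, u.
- by move=> a b s aO bO s0 sO sV; apply: Ohensel => //; apply/OunitP.
Defined.

(** * Integral matrices, length and degree *)

Section IntegralMatrices.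
Variable F : hdvf.
Local Notation Oi := (@hint F).
Local Notation w := (hpi F).

Definition GLO n : {pred 'M[F]_n} := fun A =>
  [&& A \in unitmx, A \is a mxOver Oi & invmx A \is a mxOver Oi].
Arguments GLO : clear implicits.

Lemma GLOP n (A : 'M[F]_n) :
  reflect [/\ A \in unitmx, A \is a mxOver Oi & invmx A \is a mxOver Oi]
          (A \in GLO n).
Proof. exact: and3P. Qed.

Lemma mxOver_mul m n p (A : 'M[F]_(m, n)) (B : 'M_(n, p)) :
  A \is a mxOver Oi -> B \is a mxOver Oi -> A *m B \is a mxOver Oi.
Proof. exact: mxOverM. Qed.

Lemma mxOver_tr m n (A : 'M[F]_(m, n)) : A \is a mxOver Oi -> A^T \is a mxOver Oi.
Proof. by move/mxOverP=> HA; apply/mxOverP=> i j; rewrite mxE. Qed.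

Lemma mxOver_1 n : (1%:M : 'M[F]_n) \is a mxOver Oi.
Proof. by rewrite mxOver_scalar ?rpred0 ?rpred1. Qed.

Lemma mxOver_det n (A : 'M[F]_n) : A \is a mxOver Oi -> \det A \in Oi.
Proof.
move/mxOverP=> HA; apply: rpred_sum => s _; apply: rpredM.
  by rewrite rpredX // rpredN rpred1.
exact: rpred_prod.
Qed.

Lemma mxOver_adj n (A : 'M[F]_n) : A \is a mxOver Oi -> \adj A \is a mxOver Oi.
Proof.
move/mxOverP=> HA; apply/mxOverP=> i j; rewrite !mxE rpredM //.
  by rewrite rpredX // rpredN rpred1.
by apply: mxOver_det; apply/mxOverP=> *; rewrite !mxE.
Qed.

Lemma GLO_unit n (A : 'M[F]_n) : A \in GLO n -> A \in unitmx.
Proof. by case/GLOP. Qed.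
Lemma GLO_int n (A : 'M[F]_n) : A \in GLO n -> A \is a mxOver Oi.
Proof. by case/GLOP. Qed.

Lemma GLO_V n (A : 'M[F]_n) : A \in GLO n -> invmx A \in GLO n.
Proof. by case/GLOP=> *; apply/GLOP; rewrite unitmx_inv invmxK. Qed.

Lemma GLO_inv n (A B : 'M[F]_n) : A \is a mxOver Oi -> B \is a mxOver Oi ->
  A *m B = 1%:M -> A \in GLO n.
Proof.
move=> HA HB AB; have [Au Bu] := mulmx1_unit AB; apply/GLOP; split=> //.
by rewrite -[invmx A]mulmx1 -AB mulKmx.
Qed.

Lemma GLO_M n (A B : 'M[F]_n) : A \in GLO n -> B \in GLO n -> A *m B \in GLO n.
Proof.
move=> /GLOP[Au Ai AV] /GLOP[Bu Bi BV].
apply: (@GLO_inv _ _ (invmx B *m invmx A)); rewrite ?mxOver_mul //.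
by rewrite mulmxA mulmxK // mulmxV.
Qed.

Lemma GLO_1 n : 1%:M \in GLO n.
Proof. by apply: (@GLO_inv _ _ 1%:M); rewrite ?mxOver_1 ?mulmx1. Qed.

Lemma GLO_tr n (A : 'M[F]_n) : A \in GLO n -> A^T \in GLO n.
Proof.
move=> /GLOP[Au Ai AV]; apply: (@GLO_inv _ _ (invmx A)^T); rewrite ?mxOver_tr //.
by rewrite -trmx_mul mulVmx // trmx1.
Qed.

Lemma GLO_det n (A : 'M[F]_n) :
  (A \in GLO n) = (A \is a mxOver Oi) && (\det A \in @hunit F).
Proof.
apply/idP/andP => [/GLOP[Au Ai AV]|[Ai /hunitP[d0 di dV]]].
  split=> //; apply/hunitP; rewrite -det_inv !mxOver_det //; split=> //.
  by move: Au; rewrite unitmxE unitfE.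
have Au : A \in unitmx by rewrite unitmxE unitfE.
by apply/GLOP; rewrite Au Ai /invmx Au mxOverZ // mxOver_adj.
Qed.

Lemma seq_gcd (s : seq F) : s != [::] ->
  exists2 x, x \in s & forall y, y \in s -> exists2 c, c \in Oi & y = c * x.
Proof.
elim: s => // a [_ _|b s /(_ isT)[x xs Hx] _].
  by exists a; rewrite ?inE // => y /[!inE] /eqP ->; exists 1; rewrite ?rpred1 ?mul1r.
have [xa|ax] : (exists2 c, c \in Oi & a = c * x) \/ (exists2 c, c \in Oi & x = c * a).
  have [->|x0] := eqVneq x 0; first by right; exists 0; rewrite ?rpred0 ?mul0r.
  have [->|a0] := eqVneq a 0; first by left; exists 0; rewrite ?rpred0 ?mul0r.
  case: (hint_or_inv (a / x)) => H; first by left; exists (a / x); rewrite ?divfK.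
  by right; exists (x / a); rewrite ?divfK // -invf_div.
- exists x; first by rewrite inE xs orbT.
  by move=> y; rewrite inE => /orP[/eqP->|/Hx].
exists a; first by rewrite inE eqxx.
move=> y; rewrite inE => /orP[/eqP->|/Hx[c cO ->]].
  by exists 1; rewrite ?rpred1 ?mul1r.
by case: ax => d dO ->; exists (c * d); rewrite ?rpredM ?mulrA.
Qed.

Lemma GLO_perm n (s : 'S_n) : perm_mx s \in GLO n.
Proof.
have H (t : 'S_n) : (perm_mx t : 'M[F]_n) \is a mxOver Oi.
  by apply/mxOverP=> i j; rewrite !mxE rpred_nat.
by apply: (@GLO_inv _ _ (perm_mx s^-1)); rewrite -?perm_mxM ?mulgV ?perm_mx1.
Qed.

Lemma mxOver_block m1 m2 n1 n2 (A : 'M[F]_(m1, n1)) B C (D : 'M[F]_(m2, n2)) :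
  A \is a mxOver Oi -> B \is a mxOver Oi -> C \is a mxOver Oi ->
  D \is a mxOver Oi -> block_mx A B C D \is a mxOver Oi.
Proof.
move=> /mxOverP HA /mxOverP HB /mxOverP HC /mxOverP HD; apply/mxOverP=> i j.
by rewrite !mxE; case: splitP => i' _; rewrite mxE; case: splitP => j' _.
Qed.

Lemma GLO_lblock m n (C : 'M[F]_(n, m)) (U : 'M[F]_n) :
  C \is a mxOver Oi -> U \in GLO n -> block_mx 1%:M 0 C U \in GLO (m + n).
Proof.
move=> HC /[dup] HU; rewrite !GLO_det => /andP[Ui Ud].
by rewrite det_lblock det1 mul1r Ud mxOver_block ?mxOver0 ?rpred0 ?mxOver_1.
Qed.

Lemma GLO_ublock m n (C : 'M[F]_(m, n)) (U : 'M[F]_n) :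
  C \is a mxOver Oi -> U \in GLO n -> block_mx 1%:M C 0 U \in GLO (m + n).
Proof.
move=> HC HU; rewrite -[block_mx _ _ _ _]trmxK; apply: GLO_tr.
by rewrite tr_block_mx trmx1 trmx0 GLO_lblock ?GLO_tr ?mxOver_tr.
Qed.

Lemma smith_step m n (A : 'M[F]_(m.+1, n.+1)) : exists U V a (B : 'M[F]_(m, n)),
  [/\ U \in GLO m.+1, V \in GLO n.+1
    & A = (U : 'M_(1 + m)) *m block_mx a%:M 0 0 B *m (V : 'M_(1 + n))].
Proof.
have [|x xA Hx] := @seq_gcd [seq A p.1 p.2 | p : 'I_m.+1 * 'I_n.+1].
  by rewrite -size_eq0 size_image card_prod !card_ord.
have /fintype.imageP[[i0 j0] _ /= Ex] := xA; rewrite {}Ex {xA} in Hx.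
have Hd i j : exists2 c, c \in Oi & A i j = c * A i0 j0.
  by apply: Hx; apply/fintype.imageP; exists (i, j).
pose A' : 'M[F]_(1 + m, 1 + n) := perm_mx (tperm i0 0) *m A *m perm_mx (tperm j0 0).
pose a := A i0 j0.
have A'E i j : exists2 c, c \in Oi & A' i j = c * a.
  by rewrite /A' -(tpermV j0 0) -col_permE -row_permE !mxE; apply: Hd.
have A'0 : A' 0 0 = a.
  by rewrite /A' -(tpermV j0 0) -col_permE -row_permE !mxE !tpermR.
have A'def : A' = perm_mx (tperm i0 0) *m A *m perm_mx (tperm j0 0) by [].
clearbody A'.
have /choice[r Hr] : forall j, exists c, c \in Oi /\ A' 0 (rshift 1 j) = c * a.
  by move=> j; case: (A'E 0 (rshift 1 j)) => c; exists c.
have /choice[c Hc] : forall i, exists c, c \in Oi /\ A' (rshift 1 i) 0 = c * a.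
  by move=> i; case: (A'E (rshift 1 i) 0) => c; exists c.
pose R : 'rV[F]_n := \row_j r j; pose C : 'cV[F]_m := \col_i c i.
have Ri : R \is a mxOver Oi by apply/mxOverP=> i j; rewrite mxE; case: (Hr j).
have Ci : C \is a mxOver Oi by apply/mxOverP=> i j; rewrite mxE; case: (Hc i).
pose B := drsubmx A' - C *m (a *: R).
have EA' : A' = block_mx 1%:M 0 C 1%:M *m block_mx a%:M 0 0 B *m block_mx 1%:M R 0 1%:M.
  rewrite !mulmx_block !mulmx0 !mul0mx !mulmx1 !mul1mx !addr0 !add0r.
  rewrite mul_scalar_mx mul_mx_scalar -[LHS]submxK; congr block_mx.
  - by apply/matrixP=> i j; rewrite !ord1 !mxE !lshift0 A'0 eqxx.
  - apply/matrixP=> i j; rewrite ord1 !mxE !lshift0 mulrC; by case: (Hr j).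
  - apply/matrixP=> i j; rewrite ord1 !mxE !lshift0 mulrC; by case: (Hc i).
  - by rewrite /B addrC -scalemxAr -scalemxAl subrK.
exists (perm_mx (tperm i0 0) *m block_mx 1%:M 0 C 1%:M).
exists (block_mx 1%:M R 0 1%:M *m perm_mx (tperm j0 0)), a, B; split.
- apply: GLO_M; first exact: GLO_perm.
  by apply: (@GLO_lblock 1 m) => //; apply: GLO_1.
- apply: GLO_M; last exact: GLO_perm.
  by apply: (@GLO_ublock 1 n) => //; apply: GLO_1.
have tp2 l (s : 'I_l.+1) : perm_mx (tperm s 0) *m perm_mx (tperm s 0) = 1%:M :> 'M[F]_(l.+1).
  by rewrite -perm_mxM tperm2 perm_mx1.
rewrite !mulmxA -[_ *m block_mx 1%:M 0 C 1%:M *m _ *m _]mulmxA.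
rewrite -!mulmxA [X in _ *m X]mulmxA [X in _ *m X]mulmxA -EA' A'def.
by rewrite -!mulmxA tp2 mulmx1 mulmxA tp2 mul1mx.
Qed.

Lemma smith m n (A : 'M[F]_(m, n)) : exists U V D,
  [/\ U \in GLO m, V \in GLO n, is_diag_mx D & A = U *m D *m V].
Proof.
elim: m n A => [|m IHm] [|n] A.
- by exists 1%:M, 1%:M, 0; rewrite !GLO_1 mx0_is_diag; split=> //; apply/matrixP=> -[].
- by exists 1%:M, 1%:M, 0; rewrite !GLO_1 mx0_is_diag; split=> //; apply/matrixP=> -[].
- by exists 1%:M, 1%:M, 0; rewrite !GLO_1 mx0_is_diag; split=> //; apply/matrixP=> i [].
have [U [V [a [B [UG VG ->]]]]] := smith_step A.
have [U' [V' [D [U'G V'G HD ->]]]] := IHm _ B.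
exists ((U : 'M_(1 + m)) *m block_mx 1%:M 0 0 U').
exists (block_mx 1%:M 0 0 V' *m (V : 'M_(1 + n))).
exists (block_mx a%:M 0 0 D : 'M_(1 + m, 1 + n)); split.
- by apply: GLO_M => //; apply: (@GLO_lblock 1 m); rewrite ?mxOver0 ?rpred0.
- by apply: GLO_M => //; apply: (@GLO_lblock 1 n); rewrite ?mxOver0 ?rpred0.
- by rewrite (@is_diag_block_mx _ 1 m 1 n) // !eqxx HD mx11_is_diag.
have <- : block_mx 1%:M 0 0 U' *m block_mx a%:M 0 0 D *m block_mx 1%:M 0 0 V'
        = block_mx (a%:M : 'M_1) 0 0 (U' *m D *m V') :> 'M_(1 + m, 1 + n).
  by rewrite !mulmx_block !mulmx0 !mul0mx !mulmx1 !mul1mx !addr0 !add0r mul0mx.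
by rewrite !mulmxA.
Qed.

Lemma smith_unit n (A : 'M[F]_n) : A \in unitmx -> exists U V (e : 'I_n -> int),
  [/\ U \in GLO n, V \in GLO n & A = U *m diag_mx (\row_i w ^ e i) *m V].
Proof.
have [U [V [D [UG VG HD ->]]]] := smith A => uA.
have D0 i : D i i != 0.
  have : D \in unitmx.
    by move: uA; rewrite !unitmx_mul (GLO_unit UG) (GLO_unit VG) andbT.
  move/is_diag_mxP: HD => HD.
  have -> : D = diag_mx (\row_i D i i).
    apply/matrixP=> r s; rewrite !mxE; have [->|rs] := eqVneq r s => //.
    by rewrite HD.
  rewrite unitmxE det_diag unitfE => /prodf_neq0/(_ i isT).
  by rewrite !mxE eqxx.
have /choice[f Hf] : forall i, exists p : int * F, D i i = w ^ p.1 * p.2 /\ p.2 \in @hunit F.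
  by move=> i; have [e [u Hu]] := hfactorP (D0 i); exists (e, u).
exists U, (diag_mx (\row_i (f i).2) *m V), (fun i => (f i).1); split=> //.
  rewrite GLO_M // GLO_det det_diag mxOver_diag ?rpred0 //=; last first.
    by apply/mxOverP=> i j; rewrite mxE hunitW //; case: (Hf j).
  elim/big_rec: _ => [|i x _ xu]; first exact: hunit1.
  by rewrite hunitM // mxE; case: (Hf i).
rewrite mulmxA; congr (_ *m _); rewrite -mulmxA; congr (_ *m _).
apply/matrixP=> r s; rewrite mul_diag_mx !mxE.
have [->|rs] := eqVneq r s; first by case: (Hf s).
by rewrite mulr0; move/is_diag_mxP: HD => ->.
Qed.

End IntegralMatrices.
Arguments GLO {F} n _.

Section Length.
Variables (k : fieldType) (V : lmodType (laurent k)).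
Local Notation F := (laurent k).
Local Notation w := (varpi k).
Implicit Types (L N : set V).

Lemma Osubmodule_lin L n (v : 'I_n -> V) (c : 'I_n -> fps k) (P : pred 'I_n) :
  Osubmodule L -> (forall i, P i -> L (v i)) ->
  L (\sum_(i | P i) OtoF k (c i) *: v i).
Proof.
move=> [L0 LD LZ] Lv; elim/big_ind: _ => // i Pi; exact: LZ (Lv i Pi).
Qed.

Lemma chain_subset n (M : nat -> set V) i j :
  (forall i, (i < n)%N -> M i `<` M i.+1) -> (i <= j)%N -> (j <= n)%N ->
  M i `<=` M j.
Proof.
move=> Ms ij; rewrite -(subnKC ij); elim: (j - i)%N => [|m IHm] lemn.
  by rewrite addn0.
move: lemn; rewrite addnS => lemn.
by apply: subset_trans (IHm (ltnW lemn)) (properW (Ms _ lemn)).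
Qed.

Lemma Ochain_bound L N J (f : V -> 'rV[k]_J) :
  (forall n (v : 'I_n -> V) (c : 'I_n -> k), (forall i, L (v i)) ->
     \sum_i c i *: f (v i) = 0 -> N (\sum_i ktoF k (c i) *: v i)) ->
  forall n, Ochain L N n -> (n <= J)%N.
Proof.
move=> fP n [M [M0 Mn Msub Ms]]; rewrite leqNgt; apply/negP => Jn.
have MS := fun i j => @chain_subset n M i j Ms.
have /choice[v Hv] : forall i : 'I_n, exists v, M i.+1 v /\ ~ M i v.
  move=> i; have [_ /existsNP[v /not_implyP Hv]] := Ms i (ltn_ord i).
  by exists v.
have Lv i : L (v i) by rewrite -Mn; apply: (MS i.+1 n) => //; case: (Hv i).
pose C : 'M[k]_(n, J) := \matrix_i f (v i).
have : kermx C != 0.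
  rewrite kermx_eq0 /row_free; apply: contraTneq Jn => <-.
  by rewrite -leqNgt rank_leq_col.
case/rowV0Pn=> c /sub_kermxP cC c0.
have [i0 ci0 maxi0] : exists2 i0, c 0 i0 != 0 & forall i : 'I_n, (i0 < i)%N -> c 0 i = 0.
  have [i1 ci1] : exists i, c 0 i != 0 by apply/rV0Pn.
  case: (@arg_maxnP _ i1 (fun i => c 0 i != 0) (@nat_of_ord n) ci1) => i0 ci0 Hi0.
  by exists i0 => // i; rewrite ltnNge; apply: contraNeq => /Hi0.
have NS : N (\sum_i ktoF k (c 0 i) *: v i).
  by apply: fP => //; rewrite -[RHS]cC mulmx_sum_row; apply: eq_bigr => i _; rewrite rowK.
have HM := Msub i0 (ltnW (ltn_ord i0)); have [Mi00 MiD MiZ] := HM.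
case: (Hv i0) => _; apply.
have E : v i0 = OtoF k (ktoO k (c 0 i0)^-1) *:
    ((\sum_i ktoF k (c 0 i) *: v i) +
     \sum_(i < n | (i < i0)%N) OtoF k (ktoO k (- c 0 i)) *: v i).
  rewrite (bigD1 i0) //= (bigID (fun i : 'I_n => (i < i0)%N)) /=.
  rewrite [X in _ + (_ + X)]big1 ?addr0; last first.
    move=> i /andP[ii0]; rewrite -leqNgt leq_eqVlt eq_sym (inj_eq val_inj).
    by rewrite (negbTE ii0) => /maxi0 ->; rewrite rmorph0 scale0r.
  rewrite [X in _ + X + _](_ : _ = \sum_(i < n | (i < i0)%N) ktoF k (c 0 i) *: v i).
    rewrite -addrA -big_split /= big1 ?addr0; last first.
      by move=> i _; rewrite -scalerDl -!rmorphD subrr !rmorph0 scale0r.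
    by rewrite scalerA -!rmorphM mulVf // !rmorph1 scale1r.
  apply: eq_bigl => i; case: (ltngtP i i0) => [ii0||]; rewrite ?andbF ?andbT //.
  by rewrite -(inj_eq val_inj) neq_ltn ii0.
rewrite E; apply: MiZ; apply: MiD; first by apply: (MS 0%N); rewrite ?M0 // ltnW.
apply: (@Osubmodule_lin _ _ v (fun i => ktoO k (- c 0 i)) (fun i => (i < i0)%N) HM) => i ii0.
by apply: (MS i.+1 i0 ii0 (ltnW (ltn_ord i0))); case: (Hv i).
Qed.

Lemma Ochain_cons L N N' n : Osubmodule N -> N `<` N' -> Ochain L N' n ->
  Ochain L N n.+1.
Proof.
move=> HN NN' [M [M0 Mn Msub Ms]]; exists (fun i => if i is j.+1 then M j else N).
split=> // -[|i] //; first exact: Msub.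
  by move=> _; rewrite M0.
exact: Ms.
Qed.

Lemma Olength_eq L N n : Ochain L N n -> (forall m, Ochain L N m -> (m <= n)%N) ->
  Olength L N = n.
Proof.
move=> Hn Hm; rewrite /Olength; case: xgetP => [m _ [Cm maxm]|/(_ n)/= []//].
by apply/eqP; rewrite eqn_leq Hm // maxm.
Qed.

Section Boxes.
Variable d : nat.
Variable Psi : {linear 'cV[F]_d -> V}.
Hypothesis Psi_inj : injective Psi.

Definition box (e : 'I_d -> int) : set 'cV[F]_d :=
  [set x | forall r, w ^ (- e r) * x r 0 \in Oint k].

Lemma box_Osubmodule e : Osubmodule (Psi @` box e).
Proof.
split.
- by exists 0; rewrite ?raddf0 // => r; rewrite mxE mulr0 rpred0.
- move=> _ _ [x Hx <-] [y Hy <-]; exists (x + y); rewrite ?raddfD //= => r.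
  by rewrite mxE mulrDr rpredD.
- move=> o _ [x Hx <-]; exists (OtoF k o *: x); rewrite ?linearZ //= => r.
  by rewrite mxE mulrCA rpredM ?OtoF_int.
Qed.

Lemma box_chain (b : 'I_d -> nat) e :
  Ochain (Psi @` box e) (Psi @` box (fun r => e r + (b r)%:Z)) (\sum_r b r)%N.
Proof.
move: {2}(\sum_r b r)%N (erefl (\sum_r b r)%N) => n; elim: n b => [|n IHn] b Eb.
  rewrite Eb; exists (fun=> Psi @` box e); split=> // [|i _]; last exact: box_Osubmodule.
  congr (_ @` box _); apply: funext => r; move/eqP: Eb; rewrite sum_nat_eq0.
  by move=> /forallP/(_ r)/eqP ->; rewrite addr0.
have [r br] : exists r, (0 < b r)%N.
  case: (pickP (fun r => (0 < b r)%N)) => [r br|b0]; first by exists r.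
  by move: Eb; rewrite big1 // => r _; apply/eqP; rewrite -leqn0 leqNgt b0.
pose b' s := if s == r then (b s).-1 else b s.
have Eb' : (\sum_s b' s)%N = n.
  apply: succn_inj; rewrite -Eb (bigD1 r) //= [in RHS](bigD1 r) //=.
  rewrite /b' eqxx -addSn prednK //; congr addn.
  by apply: eq_bigr => s /negbTE ->.
rewrite Eb -Eb'; apply: Ochain_cons (IHn _ Eb'); first exact: box_Osubmodule.
split.
  move=> _ [x Hx <-]; exists x => // s; rewrite /b'; case: eqP => [->|_] //.
  have -> : - (e r + (b r).-1%:Z) = 1 - (e r + (b r)%:Z) by lia.
  by rewrite expfzDr ?varpi_neq0 // expr1z -mulrA rpredM ?varpi_int.
pose x : 'cV[F]_d := \col_s (w ^ (e r + (b r).-1%:Z) *+ (s == r)).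
move/(_ (Psi x)) => /= [].
  exists x => // s; rewrite mxE /b'; case: eqP => [->|_]; last by rewrite mulr0 rpred0.
  by rewrite mulr1n -expfzDr ?varpi_neq0 // addNr expr0z rpred1.
move=> y /(_ r) Hy /Psi_inj yx; move: Hy; rewrite yx mxE eqxx mulr1n.
rewrite -expfzDr ?varpi_neq0 // varpi_exp_int; lia.
Qed.

Lemma box_bound (b : 'I_d -> nat) e n :
  Ochain (Psi @` box e) (Psi @` box (fun r => e r + (b r)%:Z)) n ->
  (n <= \sum_r b r)%N.
Proof.
pose J : finType := {r : 'I_d & 'I_(b r)}.
have -> : (\sum_r b r)%N = #|J|.
  rewrite card_tagged sumnE big_map big_enum; apply: eq_bigr => r _.
  by rewrite card_ord.
have /choice[X HX] : forall v : V, exists X : 'I_d -> fps k, (Psi @` box e) v ->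
    exists2 x, Psi x = v & forall r, x r 0 = w ^ e r * OtoF k (X r).
  move=> v; have [[x Hx <-]|nv] := pselect ((Psi @` box e) v); last by exists (fun=> 0).
  have /choice[X HX] : forall r, exists o, w ^ (- e r) * x r 0 = OtoF k o.
    by move=> r; apply/OintP.
  exists X => _; exists x => // r; rewrite -HX mulrA -expfzDr ?varpi_neq0 //.
  by rewrite subrr expr0z mul1r.
pose f v : 'rV[k]_(#|J|) :=
  \row_(p < #|J|) let q : {r : 'I_d & 'I_(b r)} := enum_val p in
    fps_coef (X v (tag q)) (nat_of_ord (tagged q)).
apply: (@Ochain_bound _ _ _ f) => m v c Lv Hf.
have /choice[x Hx] : forall i, exists x, Psi x = v i /\
    forall r, x r 0 = w ^ e r * OtoF k (X (v i) r).
  by move=> i; have [x] := HX _ (Lv i); exists x.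
exists (\sum_i ktoF k (c i) *: x i); last first.
  by rewrite linear_sum; apply: eq_bigr => i _; rewrite linearZ /=; case: (Hx i) => ->.
move=> r; rewrite summxE mulr_sumr.
have [|o Eo] := @fps_shiftn k (\sum_i ktoO k (c i) * X (v i) r) (b r).
  move=> j jb.
  have := congr1 (fun u : 'rV_ _ =>
    u 0 (enum_rank (Tagged (fun r => 'I_(b r)) (Ordinal jb) : J))) Hf.
  rewrite summxE mxE => E; rewrite -[RHS]E.
  have sumc (s : seq 'I_m) G :
      fps_coef (\sum_(i <- s) G i : fps k) j = \sum_(i <- s) fps_coef (G i) j.
    elim: s => [|i s IHs]; first by rewrite !big_nil; case: (j).
    by rewrite !big_cons -IHs.
  by rewrite sumc; apply: eq_bigr => i _; rewrite !mxE enum_rankK coef_ktoOM.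
have -> : \sum_(i < m) w ^ (- (e r + (b r)%:Z)) * (ktoF k (c i) *: x i) r 0 =
    w ^ (- (b r)%:Z) * OtoF k (\sum_i ktoO k (c i) * X (v i) r).
  rewrite rmorph_sum mulr_sumr; apply: eq_bigr => i _.
  rewrite mxE (Hx i).2 rmorphM mulrCA [RHS]mulrCA; congr (_ * _).
  by rewrite mulrA -expfzDr ?varpi_neq0 // opprD addrAC addNr add0r.
rewrite Eo rmorphM rmorphXn -/w exprnP mulrA -expfzDr ?varpi_neq0 //.
by rewrite addNr expr0z mul1r OtoF_int.
Qed.

Lemma box_length (b : 'I_d -> nat) e :
  Olength (Psi @` box e) (Psi @` box (fun r => e r + (b r)%:Z)) = (\sum_r b r)%N.
Proof. by apply: Olength_eq; [exact: box_chain | exact: box_bound]. Qed.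

Lemma box_degree e : degree (Psi @` box e) (Psi @` box (fun=> 0)) = - \sum_r e r.
Proof.
pose p r : nat := `|Num.max (e r) 0|%N; pose q r : nat := `|Num.max (- e r) 0|%N.
have epq r : e r + (q r)%:Z = (p r)%:Z by rewrite /p /q; lia.
rewrite /degree.
have -> : Psi @` box e `&` Psi @` box (fun=> 0) = Psi @` box (fun r => (p r)%:Z).
  apply/seteqP; split=> [_ [[x Hx <-] [y Hy /Psi_inj Exy]]|_ [x Hx <-]].
    rewrite {y}Exy in Hy; exists x => // r.
    have [->|->] : (p r)%:Z = e r \/ (p r)%:Z = 0 by rewrite /p; lia.
      exact: Hx.
    exact: Hy.
  have H e' : (forall r, e' r <= (p r)%:Z) -> box e' x.
    move=> He r; have -> : - e' r = ((p r)%:Z - e' r) + - (p r)%:Z by lia.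
    rewrite expfzDr ?varpi_neq0 // -mulrA rpredM ?varpi_exp_int //.
    by have := He r; lia.
  by split; exists x => //; apply: H => r; rewrite /p; lia.
have -> : (fun r => (p r)%:Z) = (fun r => e r + (q r)%:Z).
  by apply: funext => r; rewrite epq.
rewrite box_length.
have -> : (fun r => e r + (q r)%:Z) = (fun r => 0 + (p r)%:Z).
  by apply: funext => r; rewrite epq add0r.
rewrite box_length -sumrN !(big_morph Posz PoszD (erefl _)) -sumrB.
by apply: eq_bigr => r _; have := epq r; lia.
Qed.

End Boxes.
End Length.

(** * Unimodular bilinear forms *)

Section UnimodularForms.
Variables (E : hdvf) (n : nat).
Local Notation Oi := (@hint E).
Local Notation w := (hpi E).
Implicit Types (J h : 'M[E]_n) (e : 'I_n -> int) (i j l m p : 'I_n).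

Lemma hpi_O : w \in Oi.
Proof. by have := hpi_int E 1. Qed.

Lemma hunitD_max (u x : E) : u \in @hunit E -> x \in Oi -> u + w * x \in @hunit E.
Proof.
move=> uu xO; have [|//|H] := @hint_unit_or E (u + w * x).
  by apply: rpredD; [exact: hunitW | rewrite rpredM ?hpi_O].
have := hunit_max uu; rewrite -[u](addrK (w * x)) mulrBr mulKf ?hpi_neq0 //.
by rewrite rpredB.
Qed.

Lemma hpiX_int (d : nat) (x : E) : x \in Oi -> w ^+ d * x \in Oi.
Proof. by move=> xO; rewrite rpredM // exprnP hpi_int. Qed.

Definition dpi e : 'M[E]_n := diag_mx (\row_i w ^ e i).

Lemma dpiE e J l m : (dpi e *m J *m dpi e) l m = w ^ (e l + e m) * J l m.
Proof.
rewrite /dpi mul_diag_mx mul_mx_diag !mxE expfzDr ?hpi_neq0 //.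
by rewrite mulrAC.
Qed.

Lemma dpi_mul e e' : dpi e *m dpi e' = dpi (fun i => e i + e' i).
Proof.
rewrite /dpi mulmx_diag; congr diag_mx; apply/rowP=> i.
by rewrite !mxE expfzDr ?hpi_neq0.
Qed.

Lemma dpi0 : dpi (fun=> 0) = 1%:M.
Proof. by rewrite -diag_const_mx; congr diag_mx; apply/rowP=> i; rewrite !mxE. Qed.

Variable eps : E.
Hypothesis eps1 : eps = 1 \/ eps = -1.
Hypothesis unit2 : 2%:R \in @hunit E.

Definition unimodular e J :=
  [/\ J \in GLO n, dpi e *m J *m dpi e \in GLO n & J^T = eps *: J].
Definition isometric e J :=
  exists2 h, h \in GLO n & h^T *m (dpi e *m J *m dpi e) *m h = J.

Definition shear p (a : 'rV[E]_n) : 'M[E]_n := 1%:M + delta_mx p 0 *m a.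

Lemma shear_GLO p (a : 'rV[E]_n) : a 0 p = 0 -> a \is a mxOver Oi -> shear p a \in GLO n.
Proof.
move=> ap aO.
have H b : b \is a mxOver Oi -> shear p b \is a mxOver Oi.
  move=> bO; rewrite rpredD ?mxOver_1 ?mxOver_mul //.
  by apply/mxOverP=> i j; rewrite mxE rpred_nat.
apply: (@GLO_inv _ _ _ (shear p (- a))); rewrite ?H ?rpredN //.
have ad : a *m delta_mx p 0 = 0 :> 'M_1.
  by apply/matrixP=> i j; rewrite !ord1 -colE !mxE ap.
rewrite /shear mulmxDl mul1mx mulmxDr mulmx1 -mulmxA (mulmxA a) ad.
by rewrite mul0mx mulmx0 addr0 mulmxN subrK.
Qed.

Lemma shearE p (a : 'rV[E]_n) J l m : ((shear p a)^T *m J *m shear p a) l m =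
  J l m + a 0 l * J p m + J l p * a 0 m + a 0 l * J p p * a 0 m.
Proof.
rewrite /shear [_^T]raddfD /= trmx1 trmx_mul trmx_delta. 
rewrite mulmxDl mul1mx mulmxDr mulmx1 mulmxA mulmxDl.
have rowp (A : 'M[E]_n) : delta_mx 0 p *m A = row p A by rewrite rowE.
rewrite -!(mulmxA a^T) rowp -!colE mulmxDl !mxE !big_ord1 !mxE !big_ord1 !mxE.
ring.
Qed.

Lemma shear_unimodular e J p (a : 'rV[E]_n) : a 0 p = 0 -> (forall l, a 0 l \in Oi) ->
    (forall l, w ^ (e l - e p) * a 0 l \in Oi) -> unimodular e J ->
  unimodular e ((shear p a)^T *m J *m shear p a) /\
  (isometric e ((shear p a)^T *m J *m shear p a) -> isometric e J).
Proof.
move=> ap aO aeO [JG JeG JT]; set S := shear p a; set J2 := _ *m S.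
pose b := \row_l (w ^ (e l - e p) * a 0 l); pose S' := shear p b.
have SG : S \in GLO n by apply: shear_GLO => //; apply/mxOverP=> i l; rewrite ord1.
have SG' : S' \in GLO n.
  by apply: shear_GLO; [rewrite mxE ap mulr0 | apply/mxOverP=> i l; rewrite mxE].
have SD : S *m dpi e = dpi e *m S'.
  rewrite /S /S' /shear mulmxDl mul1mx mulmxDr mulmx1; congr (_ + _).
  apply/matrixP=> i l; rewrite /dpi mul_mx_diag mul_diag_mx !mxE !big_ord1 !mxE.
  rewrite eqxx !andbT; case: eqP => [->|_]; rewrite ?mul0r ?mulr0 // !mul1r.
  by rewrite mulrA -expfzDr ?hpi_neq0 // addrC subrK mulrC.
have DJ2 : dpi e *m J2 *m dpi e = S'^T *m (dpi e *m J *m dpi e) *m S'.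
  have DS : dpi e *m S^T = S'^T *m dpi e.
    by rewrite -[LHS]trmxK trmx_mul trmxK /dpi tr_diag_mx SD trmx_mul tr_diag_mx.
  by rewrite /J2 !mulmxA DS -!mulmxA SD.
split.
  split; first by rewrite GLO_M // GLO_M ?GLO_tr.
    by rewrite DJ2 GLO_M // GLO_M ?GLO_tr.
  by rewrite /J2 !trmx_mul trmxK JT -scalemxAl -scalemxAr mulmxA.
case=> h hG Eh; exists (S' *m h *m invmx S).
  by rewrite GLO_M ?GLO_V // GLO_M.
have Su := GLO_unit SG.
transitivity (invmx S^T *m (h^T *m (S'^T *m (dpi e *m J *m dpi e) *m S') *m h) *m invmx S).
  by rewrite !trmx_mul trmx_inv !mulmxA.
by rewrite -DJ2 Eh /J2 !mulmxA mulVmx ?unitmx_tr // mul1mx mulmxK.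
Qed.

Lemma unit_entry (A : 'M[E]_n) l : A \in GLO n -> exists m, A l m \in @hunit E.
Proof.
move=> /GLOP[Au /mxOverP AO /mxOverP BO]; apply: contrapT => nex.
have := hunit_max (@hunit1 E); rewrite mulr1 => /negP; apply.
have -> : w^-1 = w^-1 * (A *m invmx A) l l by rewrite mulmxV // mxE eqxx mulr1.
rewrite mxE mulr_sumr rpred_sum // => m _; rewrite mulrA rpredM //.
by have [lm|//] := hint_unit_or (AO l m); case: nex; exists m.
Qed.

Lemma dpi_GLO_inv e J : dpi e *m J *m dpi e \in GLO n -> J \in GLO n ->
  dpi (fun i => - e i) *m invmx J *m dpi (fun i => - e i) \is a mxOver Oi.
Proof.
move=> XG JG; set Y := _ *m dpi _.
have XY : (dpi e *m J *m dpi e) *m Y = 1%:M.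
  rewrite /Y -!mulmxA (mulmxA (dpi e) (dpi _)) dpi_mul.
  have -> : (fun i => e i + - e i) = (fun=> 0) by apply: funext => i; rewrite subrr.
  rewrite dpi0 mul1mx (mulmxA J) mulmxV ?GLO_unit // mul1mx dpi_mul.
  by rewrite -dpi0; congr dpi; apply: funext => i; rewrite subrr.
rewrite -[Y]mul1mx -(mulVmx (GLO_unit XG)) -(mulmxA (invmx _)) XY mulmx1.
by case/GLOP: XG.
Qed.

Lemma pivot e J : unimodular e J -> (exists i, e i != 0) ->
  exists i j, [/\ e i < 0, e j = - e i & J i j \in @hunit E].
Proof.
move=> [JG XG JT] [l el0].
have A i : exists2 j, - e i <= e j & J i j \in @hunit E.
  have [j Jij] := unit_entry i JG; exists j => //.
  by rewrite -subr_ge0 opprK addrC -(hpiXM_int _ Jij) -dpiE; move/GLO_int/mxOverP: XG; apply.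
have B i : exists j, e j <= - e i.
  have [j Kij] := unit_entry i (GLO_V JG); exists j.
  rewrite -subr_ge0 -(hpiXM_int _ Kij) -(dpiE (fun i => - e i)).
  by move/mxOverP: (dpi_GLO_inv XG JG); apply.
have [i Hi] : exists i, forall m, e i <= e m.
  by case: (@Order.TotalTheory.arg_minP _ _ _ l xpredT e isT) => i _ Hi; exists i => m; apply: Hi.
have ei0 : e i < 0.
  have [m Hm] := B l; have Him := Hi m; have Hil := Hi l.
  case: (ltgtP (e l) 0) => [||el]; [lia | lia | by rewrite el eqxx in el0].
have [j ij0 Jij] := A i; exists i, j; split=> //.
have [m Hm] := B j; have := Hi m; lia.
Qed.

Lemma unimodular_sym e J i j : unimodular e J -> J j i = eps * J i j.
Proof. by case=> _ _ /matrixP/(_ i j); rewrite !mxE. Qed.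

Lemma unimodular_int e J i j : unimodular e J -> J i j \in Oi.
Proof. by case=> /GLO_int/mxOverP. Qed.

Lemma unimodular_dint e J i j : unimodular e J -> w ^ (e i + e j) * J i j \in Oi.
Proof. by case=> _ /GLO_int/mxOverP JG _; rewrite -dpiE. Qed.

Lemma eps_unit : eps \in @hunit E.
Proof. by case: eps1 => ->; rewrite ?hunitN ?hunit1. Qed.

(* The three shears make the pivot plane hyperbolic, then orthogonal to the
   other basis vectors. *)
Lemma isotropic_pivot e J i j : unimodular e J -> e i < 0 -> e j = - e i ->
    J i j \in @hunit E ->
  exists J', [/\ unimodular e J', isometric e J' -> isometric e J, J' i i = 0
    & J' i j \in @hunit E].
Proof.
move=> HJ ei0 ej Jij.
have nij : i != j by apply: contraTneq ei0 => ij; move: ej; rewrite -ij; lia.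
have wi : w ^ (e i + e i) * J i i \in Oi by exact: unimodular_dint HJ.
have [t [tO tr]] : exists t, w ^ (e i - e j) * t \in Oi /\
    J i i + t * J j i + J i j * t + t * J j j * t = 0.
  case: eps1 (unimodular_sym i j HJ) (unimodular_sym i i HJ) => -> Jji Jii.
    pose d := `|e i|%N; have d0 : (0 < d)%N by rewrite /d; lia.
    have Ed : e i = - d%:Z by rewrite /d; lia.
    have [||||| tau tauO Etau] := @hhensel E (w ^ (e i + e i) * J i i)
      (w ^+ (d.*2.-1) * J j j) (2%:R * J i j).
    - by [].
    - by rewrite hpiX_int // (unimodular_int _ _ HJ).
    - by rewrite hunit_neq0 // hunitM.
    - by rewrite hunitW // hunitM.
    - by rewrite hunitW // hunitV // hunitM.
    have cW : w ^ (e i + e i) * w ^+ d.*2 = 1.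
      rewrite exprnP -expfzDr ?hpi_neq0 // (_ : _ + _ = 0) ?expr0z //.
      by lia.
    exists (w ^+ d.*2 * tau); split.
      by rewrite ej opprK mulrA cW mul1r.
    apply: (mulfI (hpiX_neq0 _ (e i + e i))); rewrite mulr0 -[RHS]Etau Jji.
    transitivity (w ^ (e i + e i) * J i i
        + (w ^ (e i + e i) * w ^+ d.*2) * (2%:R * J i j * tau + w ^+ d.*2 * tau * J j j * tau)).
      by ring.
    rewrite cW mul1r (_ : w ^+ d.*2 = w * w ^+ d.*2.-1); first by ring.
    by rewrite -exprS prednK // double_gt0.
  exists 0; rewrite mulr0 rpred0 !(mul0r, mulr0, addr0); split=> //.
  have : 2%:R * J i i = 0 by rewrite mulr2n mulrDl !mul1r {1}Jii mulN1r addNr.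
  by move/eqP; rewrite mulf_eq0 (negbTE (hunit_neq0 unit2)) => /eqP.
pose a := \row_l (t *+ (l == i)).
have t1 : w^-1 * t \in Oi.
  have -> : w^-1 * t = w ^ (e j - e i - 1) * (w ^ (e i - e j) * t).
    rewrite mulrA -expfzDr ?hpi_neq0 // -exprN1; congr (w ^ _ * t); lia.
  by rewrite rpredM // hpi_int; lia.
have tO1 : t \in Oi.
  by rewrite -[t](mulVKf (hpi_neq0 E)) rpredM // hpi_O.
have [|l|l|HJ1 SJ1] := @shear_unimodular e J j a _ _ _ HJ.
- by rewrite mxE eq_sym (negbTE nij).
- by rewrite mxE; case: eqP => _; rewrite ?rpred0.
- by rewrite mxE; case: eqP => [->|_]; rewrite ?mulr0 ?rpred0.
exists ((shear j a)^T *m J *m shear j a); split=> //.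
  by rewrite shearE !mxE eqxx mulr1n.
rewrite shearE !mxE eqxx eq_sym (negbTE nij) mulr1n mulr0n !mulr0 !addr0.
have -> : t * J j j = w * (w^-1 * t * J j j) by rewrite -mulrA mulVKf ?hpi_neq0.
by rewrite hunitD_max // rpredM // (unimodular_int _ _ HJ).
Qed.

Lemma hyperbolic_pivot e J i j : unimodular e J -> e i < 0 -> e j = - e i ->
    J i i = 0 -> J i j \in @hunit E ->
  exists J', [/\ unimodular e J', isometric e J' -> isometric e J, J' i i = 0, J' j j = 0
    & J' i j \in @hunit E].
Proof.
move=> HJ ei0 ej Jii Jij.
have nij : i != j by apply: contraTneq ei0 => ij; move: ej; rewrite -ij; lia.
pose t := - J j j / (2%:R * J i j).
have tO : t \in Oi.
  by rewrite rpredM ?rpredN ?(unimodular_int _ _ HJ) // hunitW // hunitV // hunitM.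
pose a := \row_l (t *+ (l == j)).
have [|l|l|HJ1 SJ1] := @shear_unimodular e J i a _ _ _ HJ.
- by rewrite mxE (negbTE nij).
- by rewrite mxE; case: eqP => _; rewrite ?rpred0.
- rewrite mxE; case: eqP => [->|_]; last by rewrite mulr0 rpred0.
  by rewrite mulr1n rpredM // hpi_int; lia.
exists ((shear i a)^T *m J *m shear i a); split=> //.
- by rewrite shearE !mxE (negbTE nij) Jii !(mul0r, mulr0, addr0).
- rewrite shearE !mxE eqxx mulr1n Jii !(mul0r, mulr0, addr0).
  case: eps1 (unimodular_sym i j HJ) (unimodular_sym j j HJ) => -> Jji Jjj.
    by rewrite Jji mul1r /t; field; rewrite !hunit_neq0.
  have Jjj0 : J j j = 0.
    have : 2%:R * J j j = 0 by rewrite mulr2n mulrDl !mul1r {1}Jjj mulN1r addNr.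
    by move/eqP; rewrite mulf_eq0 (negbTE (hunit_neq0 unit2)) => /eqP.
  by rewrite /t Jjj0 oppr0 !(mul0r, mulr0, addr0).
by rewrite shearE !mxE (negbTE nij) Jii !(mul0r, mulr0, addr0).
Qed.

Lemma split_pivot e J i j : unimodular e J -> e i < 0 -> e j = - e i ->
    J i i = 0 -> J j j = 0 -> J i j \in @hunit E ->
  exists J', [/\ unimodular e J', isometric e J' -> isometric e J, J' i j \in @hunit E,
    forall l, l != j -> J' i l = 0 & forall l, l != i -> J' j l = 0].
Proof.
move=> HJ ei0 ej Jii Jjj Jij.
have nij : i != j by apply: contraTneq ei0 => ij; move: ej; rewrite -ij; lia.
have nji : j != i by rewrite eq_sym.
pose a := \row_l (if (l == i) || (l == j) then 0 else - (J i j)^-1 * J i l).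
have [|l|l|] := @shear_unimodular e J j a _ _ _ HJ.
- by rewrite mxE eqxx orbT.
- rewrite mxE; case: ifP => _; rewrite ?rpred0 // rpredM ?(unimodular_int _ _ HJ) //.
  by rewrite rpredN hunitW ?hunitV.
- rewrite mxE; case: ifP => _; rewrite ?mulr0 ?rpred0 // mulrCA rpredM //.
    by rewrite rpredN hunitW ?hunitV.
  by rewrite ej opprK addrC (unimodular_dint _ _ HJ).
set J1 := _ *m shear j a => HJ1 SJ1.
have J1E l m : J1 l m = J l m + a 0 l * J j m + J l j * a 0 m.
  by rewrite shearE Jjj mulr0 mul0r addr0.
have ai : a 0 i = 0 by rewrite mxE eqxx.
have aj : a 0 j = 0 by rewrite mxE eqxx orbT.
have J1ij : J1 i j = J i j by rewrite J1E ai aj !(mul0r, mulr0, addr0).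
have J1il l : l != j -> J1 i l = 0.
  move=> lj; rewrite J1E ai mul0r addr0.
  have [->|li] := eqVneq l i; first by rewrite Jii ai mulr0 addr0.
  by rewrite mxE (negbTE li) (negbTE lj) /= mulNr mulrN mulVKf ?subrr ?hunit_neq0.
have J1jj : J1 j j = 0 by rewrite J1E aj Jjj !(mul0r, addr0).
have J1ji : J1 j i \in @hunit E.
  by rewrite (unimodular_sym i j HJ1) J1ij hunitM ?eps_unit.
pose b := \row_l (if (l == i) || (l == j) then 0 else - (J1 j i)^-1 * J1 j l).
have [|l|l|HJ2 SJ2] := @shear_unimodular e J1 i b _ _ _ HJ1.
- by rewrite mxE eqxx.
- rewrite mxE; case: ifP => _; rewrite ?rpred0 // rpredM ?(unimodular_int _ _ HJ1) //.
  by rewrite rpredN hunitW ?hunitV.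
- rewrite mxE; case: ifP => _; rewrite ?mulr0 ?rpred0 // mulrCA rpredM //.
    by rewrite rpredN hunitW ?hunitV.
  by rewrite -[e i]opprK -ej opprK addrC (unimodular_dint _ _ HJ1).
have bi : b 0 i = 0 by rewrite mxE eqxx.
have bj : b 0 j = 0 by rewrite mxE eqxx orbT.
exists ((shear i b)^T *m J1 *m shear i b); split=> //; first by move/SJ2/SJ1.
- by rewrite shearE bi bj !(mul0r, mulr0, addr0) J1ij.
- by move=> l lj; rewrite shearE bi !J1il // !(mul0r, mulr0, addr0). 
move=> l li; rewrite shearE bj !(mul0r, addr0).
have [->|lj] := eqVneq l j; first by rewrite bj J1jj mulr0 addr0.
have -> : b 0 l = - (J1 j i)^-1 * J1 j l by rewrite mxE (negbTE li) (negbTE lj).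
by rewrite mulNr mulrN mulVKf ?subrr ?hunit_neq0.
Qed.

Lemma dpi_isometric e J : unimodular e J -> isometric e J.
Proof.
have [r] := ubnP #|[pred i | e i != 0]|; elim: r e J => // r IHr e J ler HJ.
have [/existsP exe|/existsPn noe] := boolP [exists i, e i != 0]; last first.
  exists 1%:M; first exact: GLO_1.
  have -> : e = fun=> 0 by apply: funext => i; apply/eqP; have := noe i; rewrite negbK.
  by rewrite dpi0 trmx1 !mul1mx !mulmx1.
have [i [j [ei0 ej Jij]]] := pivot HJ exe.
have [J1 [HJ1 SJ1 J1ii J1ij]] := isotropic_pivot HJ ei0 ej Jij.
have [J2 [HJ2 SJ2 J2ii J2jj J2ij]] := hyperbolic_pivot HJ1 ei0 ej J1ii J1ij.
have [J3 [HJ3 SJ3 J3ij J3i J3j]] := split_pivot HJ2 ei0 ej J2ii J2jj J2ij.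
apply/SJ1/SJ2/SJ3 => {J J1 J2 HJ SJ1 J1ii J1ij HJ1 SJ2 J2ii J2jj J2ij HJ2 SJ3 Jij}.
pose e' l := if (l == i) || (l == j) then 0 else e l.
have J3s l m : J3 l m = 0 -> J3 m l = 0 by rewrite (unimodular_sym l m HJ3) => ->; rewrite mulr0.
have De : dpi e *m J3 *m dpi e = dpi e' *m J3 *m dpi e'.
  apply/matrixP=> l m; rewrite !dpiE /e'.
  have [->|li] := eqVneq l i => /=.
    have [->|mj] := eqVneq m j; last by rewrite J3i ?mulr0.
    by rewrite orbT ej subrr addr0.
  have [->|lj] := eqVneq l j => /=.
    have [->|mi] := eqVneq m i; last by rewrite J3j ?mulr0.
    by rewrite ej addNr addr0.
  have [->|mi] := eqVneq m i => /=; first by rewrite (J3s i l) ?J3i ?mulr0.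
  by have [->|mj] := eqVneq m j => //=; rewrite (J3s j l) ?J3j ?mulr0.
have [||h hG Eh] := IHr e' J3; last 1 first.
- by exists h; rewrite ?De.
- rewrite ltnS in ler; apply: leq_trans ler; apply: proper_card; apply/properP; split.
    by apply/fintype.subsetP=> l; rewrite !inE /e'; case: ifP; rewrite ?eqxx.
  by exists i; rewrite !inE /e' ?eqxx //= lt_eqF.
by case: HJ3 => JG JeG JT; split; [exact: JG | rewrite -De; exact: JeG | exact: JT].
Qed.

End UnimodularForms.

Lemma unimodular_isometric (E : hdvf) n (eps : E) (J g : 'M[E]_n) :
    eps = 1 \/ eps = -1 -> 2%:R \in @hunit E ->
    J \in GLO n -> J^T = eps *: J -> g \in unitmx ->
    g^T *m J *m g \in GLO n ->
  exists2 h, h \in GLO n & (g *m h)^T *m J *m (g *m h) = J.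
Proof.
move=> eps1 unit2 JG JT gu gJg; have [U [V [e [UG VG Eg]]]] := smith_unit gu.
have [Uu Vu] := (GLO_unit UG, GLO_unit VG).
pose J1 := U^T *m J *m U.
have EgJg : g^T *m J *m g = V^T *m (dpi E e *m J1 *m dpi E e) *m V.
  by rewrite Eg !trmx_mul tr_diag_mx !mulmxA.
have [|h hG Eh] := @dpi_isometric E n eps eps1 unit2 e J1.
  split; first by rewrite GLO_M // GLO_M ?GLO_tr.
    have -> : dpi E e *m J1 *m dpi E e = (invmx V)^T *m (g^T *m J *m g) *m invmx V.
      rewrite EgJg !mulmxA -trmx_mul mulmxV // trmx1 mul1mx.
      by rewrite -!mulmxA mulmxV // mulmx1.
    by rewrite GLO_M ?GLO_V // GLO_M ?GLO_tr ?GLO_V.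
  by rewrite !trmx_mul trmxK JT -scalemxAl -scalemxAr mulmxA.
exists (invmx V *m h *m invmx U); first by rewrite !GLO_M ?GLO_V.
transitivity ((invmx U)^T *m (h^T *m ((invmx V)^T *m (g^T *m J *m g) *m invmx V) *m h) *m invmx U).
  by rewrite !trmx_mul !mulmxA.
have -> : (invmx V)^T *m (g^T *m J *m g) *m invmx V = dpi E e *m J1 *m dpi E e.
  by rewrite EgJg !mulmxA -trmx_mul mulmxV // trmx1 mul1mx -!mulmxA mulmxV // mulmx1.
rewrite Eh /J1 !mulmxA -trmx_mul mulmxV // trmx1 mul1mx.
by rewrite -mulmxA mulmxV // mulmx1.
Qed.

(** * The split form of type G2 *)

Section SplitG2.
Variable F : fieldType.
Implicit Types (x y z : 'cV[F]_7) (a b c : F).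

Definition co x (i : nat) : F := x (inord i) 0.
Definition cv7 (s : seq F) : 'cV[F]_7 := \col_i nth 0 s i.

Lemma co_cv7 s i : (i < 7)%N -> co (cv7 s) i = nth 0 s i.
Proof. by move=> i7; rewrite /co mxE inordK. Qed.

Lemma coD x y i : co (x + y) i = co x i + co y i.
Proof. by rewrite /co mxE. Qed.
Lemma coN x i : co (- x) i = - co x i.
Proof. by rewrite /co mxE. Qed.
Lemma coZ a x i : co (a *: x) i = a * co x i.
Proof. by rewrite /co mxE. Qed.
Definition coE := (coD, coN, coZ).

Lemma cv7P x y : (forall i, (i < 7)%N -> co x i = co y i) -> x = y.
Proof.
move=> H; apply/colP=> i; have := H i (ltn_ord i).
by rewrite /co inord_val.
Qed.

Lemma cv7_split (P : nat -> Prop) : P 0%N -> P 1%N -> P 2%N -> P 3%N -> P 4%N ->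
  P 5%N -> P 6%N -> forall i, (i < 7)%N -> P i.
Proof. by move=> P0 P1 P2 P3 P4 P5 P6; do 7?case=> //. Qed.

Definition minor2 x y (i j : nat) := co x i * co y j - co x j * co y i.
Definition minor3 x y z i j l :=
  minor2 x y i j * co z l - minor2 x y i l * co z j + minor2 x y j l * co z i.

(* The split form of type G2 on F (+) W (+) W^*, W of dimension 3, with the
   pairing and a volume form on each of W and W^*. *)
Definition phi x y z := minor3 x y z 0 1 4 + minor3 x y z 0 2 5
  + minor3 x y z 0 3 6 + minor3 x y z 1 2 3 + 2%:R * minor3 x y z 4 5 6.

Definition ip x y := - (co x 0 * co y 0) + co x 1 * co y 4 + co x 4 * co y 1
  + co x 2 * co y 5 + co x 5 * co y 2 + co x 3 * co y 6 + co x 6 * co y 3.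

Definition cross x y := let m i j := minor2 x y i j in
  cv7 [:: - (m 1%N 4%N + m 2%N 5%N + m 3%N 6%N)%R; m 0%N 1%N + 2%:R * m 5%N 6%N;
          m 0%N 2%N - 2%:R * m 4%N 6%N;
          m 0%N 3%N + 2%:R * m 4%N 5%N; m 2%N 3%N - m 0%N 4%N;
          - m 1%N 3%N - m 0%N 5%N; m 1%N 2%N - m 0%N 6%N].

Lemma ip_cross x y z : ip (cross x y) z = phi x y z.
Proof. rewrite /ip /phi /cross !co_cv7 //= /minor3 /minor2; ring. Qed.

Lemma ipC x y : ip x y = ip y x.
Proof. rewrite /ip; ring. Qed.

Lemma phi_rot x y z : phi x y z = phi y z x.
Proof. rewrite /phi /minor3 /minor2; ring. Qed.

Lemma phi_alt x y : phi x x y = 0.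
Proof. rewrite /phi /minor3 /minor2; ring. Qed.

Lemma phiC x y z : phi x y z = - phi y x z.
Proof. rewrite /phi /minor3 /minor2; ring. Qed.

Lemma crossC x y : cross x y = - cross y x.
Proof.
apply: cv7P; apply: cv7_split; rewrite coN !co_cv7 //= /minor2; ring.
Qed.

Lemma cross_twice x y z : cross x (cross y z) + cross y (cross x z) =
  - (2%:R * ip x y) *: z + ip x z *: y + ip y z *: x.
Proof.
apply: cv7P; apply: cv7_split;
  rewrite !coE !co_cv7 //= /minor2 !co_cv7 //= /minor2 /ip; ring.
Qed.

Lemma crossDl x y z : cross (x + y) z = cross x z + cross y z.
Proof. apply: cv7P; apply: cv7_split; rewrite !coE !co_cv7 //= /minor2 !coE; ring. Qed.
Lemma crossZl a x z : cross (a *: x) z = a *: cross x z.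
Proof. apply: cv7P; apply: cv7_split; rewrite !coE !co_cv7 //= /minor2 !coE; ring. Qed.
Lemma crossDr x y z : cross z (x + y) = cross z x + cross z y.
Proof. by rewrite ![cross z _]crossC crossDl opprD. Qed.
Lemma crossZr a x z : cross z (a *: x) = a *: cross z x.
Proof. by rewrite ![cross z _]crossC crossZl scalerN. Qed.
Lemma crossNl x z : cross (- x) z = - cross x z.
Proof. by rewrite -scaleN1r crossZl scaleN1r. Qed.
Lemma crossNr x z : cross z (- x) = - cross z x.
Proof. by rewrite -scaleN1r crossZr scaleN1r. Qed.

Lemma ipDl x y z : ip (x + y) z = ip x z + ip y z.
Proof. rewrite /ip !coE; ring. Qed.
Lemma ipZl a x z : ip (a *: x) z = a * ip x z.
Proof. rewrite /ip !coE; ring. Qed.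
Lemma ipDr x y z : ip z (x + y) = ip z x + ip z y.
Proof. by rewrite ![ip z _]ipC ipDl. Qed.
Lemma ipZr a x z : ip z (a *: x) = a * ip z x.
Proof. by rewrite ![ip z _]ipC ipZl. Qed.
Lemma ipNl x z : ip (- x) z = - ip x z.
Proof. by rewrite -scaleN1r ipZl mulN1r. Qed.
Lemma ipNr x z : ip z (- x) = - ip z x.
Proof. by rewrite -scaleN1r ipZr mulN1r. Qed.
Definition ipE := (ipDl, ipDr, ipNl, ipNr, ipZl, ipZr).
Definition crossE := (crossDl, crossDr, crossNl, crossNr, crossZl, crossZr).

End SplitG2.

Fixpoint altsum (n : nat) (G : seq nat -> int) : int :=
  if n is n'.+1 then
    foldr (fun j acc =>
      (if odd j then - altsum n' (fun l => G (j :: map (bump j) l))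
       else altsum n' (fun l => G (j :: map (bump j) l))) + acc) 0 (iota 0 n)
  else G [::].

Lemma lift0_perm_bij n :
  bijective (fun p : 'I_n.+1 * 'S_n => lift_perm ord0 p.1 p.2).
Proof.
apply: inj_card_bij => [[j s] [j' s'] /= E|]; last first.
  by rewrite card_prod card_ord !card_Sn factS.
have jj : j = j' by rewrite -[j](lift_perm_id ord0 j s) E lift_perm_id.
rewrite -{}jj in E *; congr (_, _); apply/permP=> i.
by apply: (@lift_inj _ j); rewrite -!(lift_perm_lift ord0) E.
Qed.

Lemma altsumE n (G : seq nat -> int) :
  \sum_(s : 'S_n) (-1) ^+ s * G [seq val (s i) | i <- enum 'I_n] = altsum n G.
Proof.
elim: n G => [|n IHn] G.
  rewrite (bigD1 (1%g : 'S_0)) //= big1 ?addr0 => [|s]; last first.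
    by rewrite -[s]mulg1 => /eqP[]; apply/permP=> -[].
  rewrite odd_perm1 expr0 mul1r (_ : enum _ = [::]) //.
  by apply: size0nil; rewrite size_enum_ord.
rewrite (reindex _ (onW_bij _ (lift0_perm_bij n))) /=.
rewrite -(pair_bigA _ (fun j s => (-1) ^+ lift_perm ord0 j s *
   G [seq val (lift_perm ord0 j s i) | i <- enum 'I_n.+1])) /=.
transitivity (\sum_(0 <= j < n.+1) (if odd j
  then - altsum n (fun l => G (j :: map (bump j) l))
  else altsum n (fun l => G (j :: map (bump j) l)))); last first.
  by rewrite /index_iota subn0 unlock.
rewrite big_mkord; apply: eq_bigr => j _.
have GE s : [seq val (lift_perm ord0 j s i) | i <- enum 'I_n.+1]
    = val j :: map (bump j) [seq val (s i) | i <- enum 'I_n].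
  rewrite enum_ordSl /= lift_perm_id -!map_comp; congr cons.
  by apply: eq_map => i /=; rewrite lift_perm_lift.
have sE s : (-1) ^+ lift_perm ord0 j s = (-1) ^+ odd j * (-1) ^+ odd_perm s :> int.
  by rewrite odd_lift_perm signr_addb.
under eq_bigr do rewrite GE sE -mulrA.
rewrite -mulr_sumr (IHn (fun l => G (val j :: map (bump j) l))).
by case: (odd j); rewrite ?mulN1r ?mul1r.
Qed.

Definition phi_base (i j l : nat) : int :=
  let t a b c := ((i == a) && (j == b) && (l == c) : nat)%:Z in
  t 0 1 4 + t 0 2 5 + t 0 3 6 + t 1 2 3 + 2%:Z * t 4 5 6.
Definition phi_coef (i j l : nat) : int :=
  phi_base i j l + phi_base j l i + phi_base l i j
  - phi_base j i l - phi_base i l j - phi_base l j i.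
Definition ip_coef (i j : nat) : int :=
  let t a b := ((i == a) && (j == b) : nat)%:Z in
  - t 0 0 + t 1 4 + t 4 1 + t 2 5 + t 5 2 + t 3 6 + t 6 3.

(* Tabulated so that [altsum_phi] is checked in a reasonable time. *)
Definition phi_tab : seq (seq (seq int)) :=
  mkseq (fun i => mkseq (fun j => mkseq (phi_coef i j) 7) 7) 7.
Definition phi_look (tab : seq (seq (seq int))) i j l :=
  nth 0 (nth [::] (nth [::] tab i) j) l.

Definition phi_term tab (i j : nat) (s : seq nat) : int :=
  let n m := nth 0%N s m in
  let c := phi_look tab (n 0%N) (n 1%N) (n 2%N) in if c == 0 then 0 else
  let c' := phi_look tab i (n 3%N) (n 4%N) in if c' == 0 then 0 else
  c * (c' * phi_look tab j (n 5%N) (n 6%N)).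

Lemma altsum_phi : let tab := phi_tab in all (fun i => all (fun j =>
    altsum 7 (phi_term tab i j) == 144%:R * ip_coef i j) (iota 0 7)) (iota 0 7).
Proof. by vm_cast_no_check (erefl true). Qed.

Lemma phi_lookE i j l : (i < 7)%N -> (j < 7)%N -> (l < 7)%N ->
  phi_look phi_tab i j l = phi_coef i j l.
Proof. by move=> i7 j7 l7; rewrite /phi_look !nth_mkseq. Qed.

Section Contraction.
Variable F : fieldType.
Implicit Types (x y z u v : 'cV[F]_7) (M : 'M[F]_7).
Local Notation e_ i := (delta_mx i 0 : 'cV[F]_7).

Lemma co_delta i a : (a < 7)%N -> co (e_ i) a = (val i == a)%:R.
Proof. by move=> a7; rewrite /co mxE andbT -val_eqE /= inordK // eq_sym. Qed.

Lemma phi_delta i j l : phi (e_ i) (e_ j) (e_ l) = (phi_coef i j l)%:~R.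
Proof.
rewrite /phi_coef /phi_base /phi /minor3 /minor2 !co_delta //.
rewrite !(intrD, mulrNz, intrM) -!mulnb !PoszM !intrM.
ring.
Qed.

Lemma ip_delta i j : ip (e_ i) (e_ j) = (ip_coef i j)%:~R.
Proof.
rewrite /ip_coef /ip !co_delta //.
rewrite !(intrD, mulrNz) -!mulnb !PoszM !intrM.
ring.
Qed.

Lemma cV_delta x : x = \sum_i x i 0 *: e_ i.
Proof. by rewrite {1}[x]matrix_sum_delta; apply: eq_bigr => i _; rewrite big_ord1. Qed.

Lemma ip_sumr x z : ip x z = \sum_i z i 0 * ip x (e_ i).
Proof.
rewrite {1}[z]cV_delta; elim/big_rec2: _ => [|i a y _ <-].
  by rewrite -(scale0r x) ipZr mul0r.
by rewrite !ipE.
Qed.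

Lemma phi_sum x y z : phi x y z =
  \sum_(p : 'I_7 * 'I_7 * 'I_7) phi (e_ p.1.1) (e_ p.1.2) (e_ p.2)
     * (x p.1.1 0 * y p.1.2 0 * z p.2 0).
Proof.
have L x' y' z' : phi x' y' z' = \sum_i z' i 0 * phi x' y' (e_ i).
  by rewrite -ip_cross ip_sumr; apply: eq_bigr => i _; rewrite ip_cross.
rewrite -(pair_bigA _ (fun p l => phi (e_ p.1) (e_ p.2) (e_ l) *
  (x p.1 0 * y p.2 0 * z l 0))) /=.
rewrite -(pair_bigA _ (fun i j => \sum_l phi (e_ i) (e_ j) (e_ l) *
  (x i 0 * y j 0 * z l 0))) /=.
rewrite phi_rot L; apply: eq_bigr => i _; rewrite phi_rot L mulr_sumr.
apply: eq_bigr => j _; rewrite phi_rot L !mulr_sumr; apply: eq_bigr => l _.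
ring.
Qed.

Lemma phi_sum2 u y z : phi u y z =
  \sum_(p : 'I_7 * 'I_7) phi u (e_ p.1) (e_ p.2) * (y p.1 0 * z p.2 0).
Proof.
have L x' y' z' : phi x' y' z' = \sum_i z' i 0 * phi x' y' (e_ i).
  by rewrite -ip_cross ip_sumr; apply: eq_bigr => i _; rewrite ip_cross.
rewrite -(pair_bigA _ (fun i j => phi u (e_ i) (e_ j) * (y i 0 * z j 0))) /=.
rewrite -phi_rot L; apply: eq_bigr => i _.
rewrite phi_rot L mulr_sumr; apply: eq_bigr => j _; ring.
Qed.

Definition contraction M u v : F := \sum_(s : 'S_7) (-1) ^+ s *
  (phi (col (s (inord 0)) M) (col (s (inord 1)) M) (col (s (inord 2)) M) *
   (phi u (col (s (inord 3)) M) (col (s (inord 4)) M) *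
    phi v (col (s (inord 5)) M) (col (s (inord 6)) M))).

Lemma prod7 (G : 'I_7 -> F) : \prod_i G i = G (inord 0) * (G (inord 1) *
  (G (inord 2) * (G (inord 3) * (G (inord 4) * (G (inord 5) * G (inord 6)))))).
Proof.
rewrite !big_ord_recl big_ord0 mulr1.
by do ![congr (_ * _)]; congr G; apply: val_inj; rewrite /= inordK.
Qed.

(* Both sides are alternating in the columns of [M]. *)
Lemma contraction_det M u v : contraction M u v = \det M * contraction 1%:M u v.
Proof.
have E N : contraction N u v =
  (\sum_(p : 'I_7 * 'I_7 * 'I_7) \sum_(q : 'I_7 * 'I_7) \sum_(r : 'I_7 * 'I_7)
    phi (e_ p.1.1) (e_ p.1.2) (e_ p.2) * phi u (e_ q.1) (e_ q.2)
    * phi v (e_ r.1) (e_ r.2) * \det (\matrix_(i, j)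
      (nth ord0 [:: p.1.1; p.1.2; p.2; q.1; q.2; r.1; r.2] i == j)%:R)) * \det N.
  have rearrange (A B C g x0 x1 x2 x3 x4 x5 x6 : F) :
      g * (A * (x0 * x1 * x2) * (B * (x3 * x4) * (C * (x5 * x6)))) =
      A * B * C * (g * (x0 * (x1 * (x2 * (x3 * (x4 * (x5 * x6))))))) by ring.
  pose f p q r := nth ord0 [:: p.1.1; p.1.2; p.2; q.1; q.2; r.1; r.2] : nat -> 'I_7.
  transitivity (\sum_(s : 'S_7) \sum_(p : 'I_7 * 'I_7 * 'I_7) \sum_(q : 'I_7 * 'I_7)
      \sum_(r : 'I_7 * 'I_7) phi (e_ p.1.1) (e_ p.1.2) (e_ p.2) *
      phi u (e_ q.1) (e_ q.2) * phi v (e_ r.1) (e_ r.2) *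
      ((-1) ^+ s * \prod_(i < 7) N (f p q r i) (s i))).
    apply: eq_bigr => s _; rewrite phi_sum (phi_sum2 u) (phi_sum2 v).
    rewrite mulr_suml mulr_sumr; apply: eq_bigr => p _.
    rewrite mulr_suml 2!mulr_sumr; apply: eq_bigr => q _.
    rewrite 3!mulr_sumr; apply: eq_bigr => r _.
    rewrite prod7 /f !inordK // [nth _ _ 0]/= [nth _ _ 1]/= [nth _ _ 2]/= [nth _ _ 3]/=.
    rewrite [nth _ _ 4]/= [nth _ _ 5]/= [nth _ _ 6]/= ![col _ _ _ _]mxE.
    exact: rearrange.
  rewrite exchange_big mulr_suml; apply: eq_bigr => p _.
  rewrite exchange_big mulr_suml; apply: eq_bigr => q _.
  rewrite exchange_big mulr_suml; apply: eq_bigr => r _.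
  rewrite -mulr_sumr -[RHS]mulrA -det_mulmx; congr (_ * _).
  apply: eq_bigr => s _; congr (_ * _); apply: eq_bigr => i _.
  rewrite mxE (bigD1 (f p q r i)) //= big1 => [|j /negbTE nj].
    by rewrite mxE eqxx mul1r addr0.
  by rewrite mxE eq_sym nj mul0r.
by rewrite !E det1 mulr1 mulrC.
Qed.

Lemma contraction_phi i j :
  contraction 1%:M (e_ i) (e_ j) = 144%:R * ip (e_ i) (e_ j).
Proof.
have col1 l : col l 1%:M = e_ l by rewrite -[RHS]mul1mx -colE.
have := altsum_phi; move/allP/(_ (val i)); rewrite mem_iota ltn_ord => /(_ isT).
move/allP/(_ (val j)); rewrite mem_iota ltn_ord => /(_ isT)/eqP.
move=> E; have {E} <- : (altsum 7 (phi_term phi_tab i j))%:~R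
    = 144%:R * ip (e_ i) (e_ j) by rewrite E rmorphM rmorph_nat ip_delta.
rewrite -altsumE rmorph_sum; apply: eq_bigr => s _.
rewrite rmorphM rmorphXn rmorphN rmorph1; congr (_ * _).
have sE m : (m < 7)%N -> nth 0%N [seq val (s i) | i <- enum 'I_7] m = s (inord m).
  move=> m7; rewrite (nth_map ord0) ?size_enum_ord //; congr (val (s _)).
  by apply: val_inj; rewrite /= nth_enum_ord // inordK.
rewrite !col1 !phi_delta -!rmorphM /phi_term !sE // !phi_lookE //.
congr (_%:~R); case: eqP => [->|_]; rewrite ?mul0r //.
by case: eqP => [->|_]; rewrite ?mul0r ?mulr0.
Qed.

Lemma phi_suml x y z : phi x y z = \sum_i x i 0 * phi (e_ i) y z.
Proof.
rewrite phi_rot -ip_cross ip_sumr; apply: eq_bigr => i _.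
by rewrite ip_cross -phi_rot.
Qed.

Lemma contraction1 u v : contraction 1%:M u v = 144%:R * ip u v.
Proof.
have rl (a b c d p : F) : a * (b * (c * d * p)) = c * (a * (b * (d * p))) by ring.
have rr (a b c d p : F) : a * (b * (c * (d * p))) = d * (a * (b * (c * p))) by ring.
have Suml : contraction 1%:M u v = \sum_i u i 0 * contraction 1%:M (e_ i) v.
  transitivity (\sum_(s : 'S_7) \sum_i u i 0 * ((-1) ^+ s *
      (phi (col (s (inord 0)) 1%:M) (col (s (inord 1)) 1%:M) (col (s (inord 2)) 1%:M) *
      (phi (e_ i) (col (s (inord 3)) 1%:M) (col (s (inord 4)) 1%:M) *
       phi v (col (s (inord 5)) 1%:M) (col (s (inord 6)) 1%:M))))).
    apply: eq_bigr => s _; rewrite (phi_suml u) mulr_suml 2!mulr_sumr.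
    by apply: eq_bigr => i _; exact: rl.
  by rewrite exchange_big; apply: eq_bigr => i _; rewrite mulr_sumr.
have Sumr i : contraction 1%:M (e_ i) v = \sum_j v j 0 * contraction 1%:M (e_ i) (e_ j).
  transitivity (\sum_(s : 'S_7) \sum_j v j 0 * ((-1) ^+ s *
      (phi (col (s (inord 0)) 1%:M) (col (s (inord 1)) 1%:M) (col (s (inord 2)) 1%:M) *
      (phi (e_ i) (col (s (inord 3)) 1%:M) (col (s (inord 4)) 1%:M) *
       phi (e_ j) (col (s (inord 5)) 1%:M) (col (s (inord 6)) 1%:M))))).
    apply: eq_bigr => s _; rewrite (phi_suml v) 3!mulr_sumr.
    by apply: eq_bigr => j _; exact: rr.
  by rewrite exchange_big; apply: eq_bigr => j _; rewrite mulr_sumr.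
rewrite Suml ipC ip_sumr mulr_sumr; apply: eq_bigr => i _.
rewrite Sumr ipC ip_sumr !mulr_sumr; apply: eq_bigr => j _.
by rewrite contraction_phi [RHS]mulrCA; congr (_ * _); exact: mulrCA.
Qed.

End Contraction.

Section Frames.
Variable F : fieldType.
Hypothesis two_neq0 : 2%:R != 0 :> F.
Implicit Types x y z : 'cV[F]_7.

Lemma cross_self x : cross x x = 0.
Proof. by apply: cv7P; apply: cv7_split; rewrite !co_cv7 //= /minor2 /co mxE; ring. Qed.

Lemma phi_self x y : phi x y x = 0.
Proof. by rewrite -phi_rot phi_alt. Qed.

Lemma two_inj (V : lmodType F) (u v : V) : 2%:R *: u = 2%:R *: v -> u = v.
Proof. by move/(congr1 ( *:%R 2%:R^-1)); rewrite !scalerA mulVf // !scale1r. Qed.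

Lemma sum7 (G : 'I_7 -> F) : \sum_i G i = G (inord 0) + G (inord 1) +
  G (inord 2) + G (inord 3) + G (inord 4) + G (inord 5) + G (inord 6).
Proof.
rewrite !big_ord_recl big_ord0 addr0 !addrA.
by do ![congr (_ + _)]; congr G; apply: val_inj; rewrite /= inordK.
Qed.

Variables c e1 e2 f1 f2 : 'cV[F]_7.
Hypotheses (cc : ip c c = -1) (ce1 : cross c e1 = e1) (ce2 : cross c e2 = e2)
  (cf1 : cross c f1 = - f1) (cf2 : cross c f2 = - f2)
  (e1f1 : ip e1 f1 = 1) (e1f2 : ip e1 f2 = 0) (e2f1 : ip e2 f1 = 0)
  (e2f2 : ip e2 f2 = 1).

Lemma phi_swap x y z : phi x y z = - phi x z y.
Proof. by rewrite phi_rot phiC -phi_rot. Qed.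

Lemma cross_eigen a b x y : cross c x = a *: x -> cross c y = b *: y ->
  (a + b) * ip x y = 0.
Proof.
move=> Hx Hy; rewrite mulrDl -ipZl -Hx -ipZr -Hy ip_cross ipC ip_cross.
by rewrite phi_swap addNr.
Qed.

Lemma cross_eigen_orth a x : a != 0 -> cross c x = a *: x -> ip c x = 0.
Proof.
move=> a0 Hx; apply: (mulfI a0).
by rewrite -ipZr -Hx ipC ip_cross phi_self mulr0.
Qed.

Let pp x y : cross c x = x -> cross c y = y -> ip x y = 0.
Proof.
move=> Hx Hy; have := @cross_eigen 1 1 x y; rewrite !scale1r => /(_ Hx Hy)/eqP.
by rewrite -[1 + 1]/2%:R mulf_eq0 (negbTE two_neq0) => /eqP.
Qed.

Let mm x y : cross c x = - x -> cross c y = - y -> ip x y = 0.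
Proof.
move=> Hx Hy; have := @cross_eigen (-1) (-1) x y; rewrite !scaleN1r => /(_ Hx Hy)/eqP.
by rewrite -opprD -[1 + 1]/2%:R mulf_eq0 oppr_eq0 (negbTE two_neq0) => /eqP.
Qed.

Let cp x : cross c x = x -> ip c x = 0.
Proof. by move=> Hx; apply: (@cross_eigen_orth 1); rewrite ?oner_neq0 ?scale1r. Qed.

Let cm x : cross c x = - x -> ip c x = 0.
Proof.
by move=> Hx; apply: (@cross_eigen_orth (-1)); rewrite ?oppr_eq0 ?oner_neq0 ?scaleN1r.
Qed.

Let pm x y : cross c x = x -> cross c y = - y -> cross x y = - ip x y *: c.
Proof.
move=> Hx Hy; apply: two_inj.
have := cross_twice c x y; rewrite Hy (cp Hx) (cm Hy) crossNr.
rewrite mulr0 oppr0 !scale0r !add0r => H1.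
have := cross_twice c y x; rewrite Hx (cp Hx) (cm Hy) (crossC y x) crossNr.
rewrite mulr0 oppr0 !scale0r !add0r [ip y x]ipC => H2.
rewrite scaleNr scalerN !scaler_nat !mulr2n -{1}H1 -H2 opprD opprB opprD !opprK.
by rewrite addrA subrK.
Qed.

Let mp x y : cross c x = - x -> cross c y = y -> cross x y = ip x y *: c.
Proof. by move=> Hx Hy; rewrite crossC pm // scaleNr opprK ipC. Qed.

Definition frame_e3 := 2%:R^-1 *: cross f1 f2.
Definition frame_f3 := cross e1 e2.
Local Notation e3 := frame_e3.
Local Notation f3 := frame_f3.

Let f12 : cross f1 f2 = 2%:R *: e3.
Proof. by rewrite scalerA divff // scale1r. Qed.

Let ce3 : cross c e3 = e3.
Proof.
have := cross_twice c f1 f2; rewrite cf2 (cm cf1) (cm cf2) (mm cf1 cf2) crossNr.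
rewrite mulr0 oppr0 !scale0r !addr0 f12 crossZr -scalerBr => /eqP.
by rewrite scaler_eq0 (negbTE two_neq0) subr_eq0 => /eqP.
Qed.

Let cf3 : cross c f3 = - f3.
Proof.
have := cross_twice c e1 e2; rewrite ce2 (cp ce1) (cp ce2) (pp ce1 ce2).
by rewrite mulr0 oppr0 !scale0r !addr0 => /eqP; rewrite addr_eq0 => /eqP.
Qed.

Let e1f3 : ip e1 f3 = 0. Proof. by rewrite ipC ip_cross phi_self. Qed.
Let e2f3 : ip e2 f3 = 0. Proof. by rewrite ipC ip_cross phi_rot phi_alt. Qed.
Let e3f1 : ip e3 f1 = 0. Proof. by rewrite ipZl ip_cross phi_self mulr0. Qed.
Let e3f2 : ip e3 f2 = 0. Proof. by rewrite ipZl ip_cross phi_rot phi_alt mulr0. Qed.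

Let e1f2c : cross e1 f2 = 0. Proof. by rewrite (pm ce1 cf2) e1f2 oppr0 scale0r. Qed.
Let e2f1c : cross e2 f1 = 0. Proof. by rewrite (pm ce2 cf1) e2f1 oppr0 scale0r. Qed.

Let e13 : cross e1 e3 = - f2.
Proof.
apply: two_inj; rewrite -crossZr -f12.
have := cross_twice e1 f1 f2; rewrite e1f2c e1f1 e1f2 (mm cf1 cf2).
rewrite -[in cross f1 0](scale0r f1) crossZr !scale0r !addr0 mulr1 => ->.
by rewrite scaleNr scalerN.
Qed.

Let e23 : cross e2 e3 = f1.
Proof.
apply: two_inj; rewrite -crossZr -f12.
have := cross_twice e2 f1 f2; rewrite (pm ce2 cf2) e2f2 e2f1 (mm cf1 cf2).
rewrite mulr0 oppr0 !scale0r add0r addr0 scale1r scaleN1r crossNr [cross f1 c]crossC.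
by rewrite cf1 !opprK => /(canRL (addrK _)) ->; rewrite opprK scaler_nat mulr2n.
Qed.

Let f13 : cross f1 f3 = - (2%:R *: e2).
Proof.
have := cross_twice f1 e1 e2; rewrite [cross f1 e2]crossC e2f1c oppr0.
rewrite -[in cross e1 0](scale0r e1) crossZr scale0r addr0 => ->.
by rewrite [ip f1 e1]ipC e1f1 [ip f1 e2]ipC e2f1 (pp ce1 ce2) !scale0r !addr0 mulr1 scaleNr.
Qed.

Let f23 : cross f2 f3 = 2%:R *: e1.
Proof.
have := cross_twice f2 e1 e2; rewrite (mp cf2 ce2) ![ip f2 _]ipC e2f2 e1f2 (pp ce1 ce2).
rewrite mulr0 oppr0 !scale0r add0r addr0 !scale1r [cross e1 c]crossC ce1.
by move/(canRL (subrK _)) ->; rewrite scaler_nat mulr2n.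
Qed.

Let e3f3 : ip e3 f3 = 1.
Proof.
rewrite ipZl ip_cross phi_rot -ip_cross f23 ipZl e1f1 mulr1 mulVf //.
Qed.

Definition frame_seq := [:: c; e1; e2; e3; f1; f2; f3].
Definition frame_mx : 'M[F]_7 := \matrix_(i, j) nth 0 frame_seq j i 0.

Lemma frame_mulE x : frame_mx *m x = co x 0 *: c + co x 1 *: e1 + co x 2 *: e2
  + co x 3 *: e3 + co x 4 *: f1 + co x 5 *: f2 + co x 6 *: f3.
Proof.
apply/colP=> i; rewrite mxE sum7 /frame_mx /frame_seq.
move: frame_e3 frame_f3 => e f; rewrite !mxE !inordK //= /co.
ring.
Qed.

Let gram := (
  cc, cp ce1, cp ce2, cp ce3, cm cf1, cm cf2, cm cf3, etrans (ipC _ _) (cp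
  ce1), pp ce1 ce1, pp ce1 ce2, pp ce1 ce3, e1f1, e1f2, e1f3, etrans (ipC _
  _) (cp ce2), pp ce2 ce1, pp ce2 ce2, pp ce2 ce3, e2f1, e2f2, e2f3, etrans
  (ipC _ _) (cp ce3), pp ce3 ce1, pp ce3 ce2, pp ce3 ce3, e3f1, e3f2, e3f3,
  etrans (ipC _ _) (cm cf1), etrans (ipC _ _) e1f1, etrans (ipC _ _) e2f1,
  etrans (ipC _ _) e3f1, mm cf1 cf1, mm cf1 cf2, mm cf1 cf3, etrans (ipC _
  _) (cm cf2), etrans (ipC _ _) e1f2, etrans (ipC _ _) e2f2, etrans (ipC _
  _) e3f2, mm cf2 cf1, mm cf2 cf2, mm cf2 cf3, etrans (ipC _ _) (cm cf3),
  etrans (ipC _ _) e1f3, etrans (ipC _ _) e2f3, etrans (ipC _ _) e3f3, mm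
  cf3 cf1, mm cf3 cf2, mm cf3 cf3).

Lemma frame_ip x y : ip (frame_mx *m x) (frame_mx *m y) = ip x y.
Proof.
rewrite !frame_mulE [in RHS]/ip; move: (co x) (co y) => X Y.
move: gram; move: e3 f3 => e f g; rewrite !ipE !g; ring.
Qed.

Let e12 : cross e1 e2 = f3. Proof. by []. Qed.

Let table := (
  ce1, ce2, ce3, cf1, cf2, cf3, etrans (crossC _ _) (congr1 -%R ce1), etrans
  (crossC _ _) (congr1 -%R ce2), etrans (crossC _ _) (congr1 -%R ce3),
  etrans (crossC _ _) (congr1 -%R cf1), etrans (crossC _ _) (congr1 -%R
  cf2), etrans (crossC _ _) (congr1 -%R cf3), cross_self, e12, e13, e23,
  f12, f13, f23, etrans (crossC _ _) (congr1 -%R e12), etrans (crossC _ _)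
  (congr1 -%R e13), etrans (crossC _ _) (congr1 -%R e23), etrans (crossC _
  _) (congr1 -%R f12), etrans (crossC _ _) (congr1 -%R f13), etrans (crossC
  _ _) (congr1 -%R f23), pm ce1 cf1, pm ce1 cf2, pm ce1 cf3, pm ce2 cf1, pm
  ce2 cf2, pm ce2 cf3, pm ce3 cf1, pm ce3 cf2, pm ce3 cf3, mp cf1 ce1, mp
  cf1 ce2, mp cf1 ce3, mp cf2 ce1, mp cf2 ce2, mp cf2 ce3, mp cf3 ce1, mp
  cf3 ce2, mp cf3 ce3).

Lemma frame_cross x y : cross (frame_mx *m x) (frame_mx *m y) = frame_mx *m cross x y.
Proof.
rewrite !frame_mulE [in RHS]/cross !co_cv7 // [nth _ _ _]/= /minor2.
move: (co x) (co y) => X Y; move: gram table; move: e3 f3 => e f g t.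
rewrite !crossE !t !g; apply/colP=> i; rewrite /= !mxE.
ring.
Qed.

Lemma frame_phi x y z :
  phi (frame_mx *m x) (frame_mx *m y) (frame_mx *m z) = phi x y z.
Proof. by rewrite -ip_cross frame_cross frame_ip ip_cross. Qed.

End Frames.

Lemma phi_isometry_det (F : fieldType) (M : 'M[F]_7) : 144%:R != 0 :> F ->
    (forall x y z, phi (M *m x) (M *m y) (M *m z) = phi x y z) ->
    (forall x y, ip (M *m x) (M *m y) = ip x y) -> \det M = 1.
Proof.
move=> n0 Hphi Hip; pose e := delta_mx 0 0 : 'cV[F]_7.
have colM i : col i M = M *m col i 1%:M by rewrite colE [col i 1%:M]colE mul1mx.
have := contraction_det M (M *m e) (M *m e); rewrite contraction1 Hip.
have -> : contraction M (M *m e) (M *m e) = contraction 1%:M e e.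
  by apply: eq_bigr => s _; rewrite !colM !Hphi.
rewrite contraction1 => H; have X0 : 144%:R * ip e e != 0.
  by rewrite ip_delta /ip_coef /= mulrN1z mulrN mulr1 oppr_eq0.
by apply: (mulIf X0); rewrite mul1r -H.
Qed.

Section SplitG2Lattices.
Variable E : hdvf.
Local Notation Oi := (@hint E).
Local Notation w := (hpi E).
Local Notation e_ i := (delta_mx i 0 : 'cV[E]_7).
Hypotheses (unit2 : 2%:R \in @hunit E) (unit3 : 3%:R \in @hunit E).
Implicit Types (x y z : 'cV[E]_7).

Definition ip_mx : 'M[E]_7 := \matrix_(i, j) ip (e_ i) (e_ j).

Lemma ip_mxE x y : x^T *m ip_mx *m y = (ip x y)%:M.
Proof.
apply/matrixP=> i j; rewrite !ord1 !mxE eqxx mulr1n ip_sumr.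
apply: eq_bigr => l _; rewrite mulrC mxE; congr (_ * _).
rewrite ipC ip_sumr; apply: eq_bigr => m _.
by rewrite !mxE [ip (e_ l) _]ipC.
Qed.

Lemma ip_mxK : ip_mx *m ip_mx = 1%:M.
Proof.
have : all (fun i => all (fun j => foldr (fun l s => ip_coef i l * ip_coef l j + s) 0
  (iota 0 7) == (i == j)%:Z) (iota 0 7)) (iota 0 7) by vm_compute.
move=> /allP H; apply/matrixP=> i j; rewrite !mxE.
have /allP/(_ (val j)) := H (val i) ltac:(by rewrite mem_iota ltn_ord).
rewrite mem_iota ltn_ord => /(_ isT)/eqP/(congr1 (fun z : int => z%:~R : E)).
rewrite -[RHS]pmulrn [_ == _ :> nat]val_eqE => <-.
transitivity ((\sum_(0 <= l < 7) ip_coef i l * ip_coef l j)%:~R : E); last first.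
  by rewrite unlock.
rewrite big_mkord rmorph_sum; apply: eq_bigr => l _.
by rewrite !mxE !ip_delta rmorphM.
Qed.

Lemma ip_mx_GLO : ip_mx \in GLO 7.
Proof.
have iO : ip_mx \is a mxOver Oi.
  by apply/mxOverP=> i j; rewrite mxE ip_delta rpred_int.
exact: (GLO_inv iO iO ip_mxK).
Qed.

Lemma unit144 : 144%:R \in @hunit E.
Proof.
have -> : 144%:R = 2%:R ^+ 4 * 3%:R ^+ 2 :> E by rewrite -!natrX -natrM.
by rewrite !(exprS, expr0, mulr1) !hunitM.
Qed.

Variable g : 'M[E]_7.
Hypothesis det_g : \det g \in @hunit E.
Hypothesis phi_g : forall x y z, x \is a mxOver Oi -> y \is a mxOver Oi ->
  z \is a mxOver Oi -> phi (g *m x) (g *m y) (g *m z) \in Oi.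

Let gu : g \in unitmx. Proof. by rewrite unitmxE unitfE hunit_neq0. Qed.
(* Sealed: rewriting with [mulmxA] would otherwise look inside. *)
Let gram_sig : {G : 'M[E]_7 | G = g^T *m ip_mx *m g}. Proof. by eexists. Qed.
Let G := sval gram_sig.
Let GE : G = g^T *m ip_mx *m g. Proof. exact: (svalP gram_sig). Qed.

Let delta_int i : e_ i \is a mxOver Oi.
Proof. by apply/mxOverP=> j l; rewrite mxE rpred_nat. Qed.

Let gram_entry (N : 'M[E]_7) i j :
  (N^T *m ip_mx *m N) i j = ip (N *m e_ i) (N *m e_ j).
Proof.
have := ip_mxE (N *m e_ i) (N *m e_ j); rewrite trmx_mul trmx_delta.
move/(congr1 (fun u : 'M_1 => u 0 0)); rewrite [RHS]mxE eqxx mulr1n => <-.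
by rewrite !mulmxA -colE -!mulmxA -rowE !mxE.
Qed.

Let G_GLO : G \in GLO 7.
Proof.
have [Sd Si] : \det ip_mx \in @hunit E /\ ip_mx \is a mxOver Oi.
  by have := ip_mx_GLO; rewrite GLO_det => /andP[].
rewrite GLO_det GE !det_mulmx det_tr !hunitM // andbT.
apply/mxOverP=> i j.
rewrite gram_entry -(mulKf (hunit_neq0 unit144) (ip _ _)).
rewrite -contraction1 -(mulKf (hunit_neq0 det_g) (contraction _ _ _)).
rewrite -contraction_det.
apply: rpredM; first by rewrite hunitW // hunitV // unit144.
apply: rpredM; first by rewrite hunitW // hunitV.
have phiO x y z a b c : x = e_ a -> y = e_ b -> z = e_ c ->
    phi (g *m x) (g *m y) (g *m z) \in Oi by move=> -> -> ->; apply: phi_g.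
rewrite rpred_sum // => s _; rewrite rpredM ?rpredX ?rpredN ?rpred1 //.
by rewrite !colE !rpredM //; apply: phiO.
Qed.

Let L x := invmx g *m x \is a mxOver Oi.

Let Lg y : y \is a mxOver Oi -> L (g *m y).
Proof. by rewrite /L mulKmx. Qed.
Let LD x y : L x -> L y -> L (x + y).
Proof. by rewrite /L mulmxDr => ? ?; rewrite rpredD. Qed.
Let LN x : L x -> L (- x).
Proof. by rewrite /L mulmxN => ?; rewrite rpredN. Qed.
Let LZ a x : a \in Oi -> L x -> L (a *: x).
Proof. by rewrite /L -scalemxAr => ? ?; rewrite mxOverZ. Qed.

Let ip_G x y : ip x y = ((invmx g *m x)^T *m G *m (invmx g *m y)) 0 0.
Proof.
rewrite GE !mulmxA -trmx_mul mulKVmx // -!mulmxA mulKVmx // mulmxA ip_mxE.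
by rewrite mxE eqxx.
Qed.

Let L_ip x y : L x -> L y -> ip x y \in Oi.
Proof.
move=> Lx Ly; rewrite ip_G; apply/mxOverP; apply: mxOver_mul => //.
by apply: mxOver_mul; [exact: mxOver_tr | exact: GLO_int G_GLO].
Qed.

Let L_dual x : (forall y, L y -> ip x y \in Oi) -> L x.
Proof.
move=> Hx; have H : (invmx g *m x)^T *m G \is a mxOver Oi.
  apply/mxOverP=> i j; rewrite !ord1.
  have := Hx _ (Lg (delta_int j)); rewrite ip_G mulKmx //.
  by rewrite -colE mxE.
rewrite /L -[invmx g *m x]trmxK mxOver_tr // -[_^T](mulmxK (GLO_unit G_GLO)).
by apply: mxOver_mul => //; apply: GLO_int; apply: GLO_V.
Qed.

Let L_cross x y : L x -> L y -> L (cross x y).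
Proof.
move=> Lx Ly; apply: L_dual => z Lz; rewrite ip_cross.
by rewrite -[x](mulKVmx gu) -[y](mulKVmx gu) -[z](mulKVmx gu) phi_g.
Qed.

Let halfO : 2%:R^-1 \in Oi. Proof. by rewrite hunitW ?hunitV. Qed.
Let two0 : 2%:R != 0 :> E. Proof. exact: hunit_neq0. Qed.

Let exists_isotropic_pair : exists u v,
  [/\ L u, L v, ip u u = 0, ip v v = 0 & ip u v = 1].
Proof.
pose e := e_ (inord 1); have ee : ip e e = 0 by rewrite ip_delta /ip_coef inordK.
pose y := invmx g *m e.
have [|l ly Hl] := @seq_gcd E [seq y i 0 | i : 'I_7].
  by rewrite -size_eq0 size_image card_ord.
have /fintype.imageP[i0 _ El] := ly.
have l0 : l != 0.
  apply: contraTneq isT => l0; suff : e = 0.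
    move/(congr1 (fun x : 'cV_7 => x (inord 1) 0)); rewrite !mxE eqxx.
    by move/eqP; rewrite oner_eq0.
  rewrite -[e](mulKVmx gu) (_ : invmx g *m e = 0) ?mulmx0 //.
  apply/colP=> i; rewrite [RHS]mxE; have [|c _ Ec] := Hl (y i 0).
    exact/fintype.imageP/ex_intro2.
  by rewrite -/y Ec l0 mulr0.
pose u := l^-1 *: e.
have Lu : L u.
  rewrite /L /u -scalemxAr; apply/mxOverP=> i j; rewrite ord1 mxE -/y.
  have [|c cO ->] := Hl (y i 0); first by apply/fintype.imageP; exists i.
  by rewrite mulrCA mulVf // mulr1.
have uu : ip u u = 0 by rewrite ipZl ipZr ee !mulr0.
pose v0 := g *m ((invmx G)^T *m e_ i0).
have Lv0 : L v0 by apply: Lg; rewrite mxOver_mul ?mxOver_tr ?GLO_int ?GLO_V.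
have uv0 : ip u v0 = 1.
  rewrite ipC ip_G /v0 mulKmx // trmx_mul trmxK -!mulmxA (mulmxA (invmx G)).
  rewrite mulVmx ?GLO_unit // mul1mx trmx_delta -rowE mxE -scalemxAr mxE -/y.
  by rewrite -El mulVf.
clearbody u v0; pose t := 2%:R^-1 * ip v0 v0.
have uv : ip u (v0 - t *: u) = 1 by rewrite !ipE uu uv0 mulr0 oppr0 addr0.
exists u, (v0 - t *: u); split=> //.
  by apply: LD => //; apply/LN/LZ => //; rewrite rpredM // L_ip.
rewrite !ipE uu [ip v0 u]ipC uv0 /t; field; exact: two0.
Qed.

Section Complement.
Variables c e1 f1 : 'cV[E]_7.
Hypotheses (cc : ip c c = -1) (ce1 : cross c e1 = e1) (cf1 : cross c f1 = - f1)
  (ce : ip c e1 = 0) (cf : ip c f1 = 0) (ee : ip e1 e1 = 0) (ff : ip f1 f1 = 0)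
  (ef : ip e1 f1 = 1) (Lc : L c) (Le : L e1) (Lf : L f1).

Definition orth_proj x := x + ip c x *: c - ip f1 x *: e1 - ip e1 x *: f1.

Let pi_c x : ip c (orth_proj x) = 0.
Proof. rewrite /orth_proj !ipE cc ce cf; ring. Qed.
Let pi_e x : ip e1 (orth_proj x) = 0.
Proof. rewrite /orth_proj !ipE [ip e1 c]ipC ce ee ef; ring. Qed.
Let pi_f x : ip f1 (orth_proj x) = 0.
Proof. rewrite /orth_proj !ipE [ip f1 c]ipC cf ff [ip f1 e1]ipC ef; ring. Qed.

Let pi_L x : L x -> L (orth_proj x).
Proof.
move=> Lx; apply: LD; last by apply/LN/LZ => //; apply: L_ip.
apply: LD; last by apply/LN/LZ => //; apply: L_ip.
by apply: LD => //; apply: LZ => //; apply: L_ip.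
Qed.

(* The orthogonal projection has trace 4, a unit, so that it does not vanish
   modulo the maximal ideal. *)
Let exists_unit_pair : exists x y, [/\ L x, L y & ip (orth_proj x) y \in @hunit E].
Proof.
apply: contrapT => nex.
have piw x : L x -> L (w^-1 *: orth_proj x).
  move=> Lx; apply: L_dual => y Ly; rewrite ipZl.
  have [u|//] := hint_unit_or (L_ip (pi_L Lx) Ly).
  by case: nex; exists x, y.
pose P : 'M[E]_7 := 1%:M + c *m (c^T *m ip_mx) - e1 *m (f1^T *m ip_mx)
  - f1 *m (e1^T *m ip_mx).
have PE x : P *m x = orth_proj x.
  have H a b : a *m (b^T *m ip_mx) *m x = ip b x *: a.
    by rewrite -mulmxA ip_mxE mul_mx_scalar.
  by rewrite /P !mulmxBl mulmxDl mul1mx !H.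
have trP : \tr P = 4%:R.
  have H a b : \tr (a *m (b^T *m ip_mx)) = ip b a.
    by rewrite mxtrace_mulC ip_mxE mxtrace_scalar.
  rewrite /P !raddfB raddfD /= !H mxtrace1 cc [ip f1 e1]ipC ef; ring.
have : w^-1 * 4%:R \in Oi.
  rewrite -trP -[P]mul1mx -(mulmxV gu) -mulmxA mxtrace_mulC -mulmxA mulr_sumr.
  rewrite rpred_sum // => i _.
  have /mxOverP/(_ i 0) := piw _ (Lg (delta_int i)).
  by rewrite -PE -scalemxAr mxE !mulmxA -colE mxE.
apply/negP/hunit_max; rewrite (_ : 4%:R = 2%:R * 2%:R) ?hunitM //.
by rewrite -natrM.
Qed.

Let split_L x a : a \in Oi -> L x -> L (2%:R^-1 *: (x + a *: cross c x)).
Proof. by move=> aO Lx; apply: LZ => //; apply: LD => //; apply/LZ/L_cross. Qed.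

Let cross_sq x : ip c x = 0 -> cross c (cross c x) = x.
Proof.
move=> cx; apply: (two_inj two0); rewrite scaler_nat mulr2n cross_twice cc cx.
by rewrite !scale0r !addr0 mulrN1 opprK.
Qed.

Let split_eig x a : a * a = 1 -> ip c x = 0 ->
  cross c (2%:R^-1 *: (x + a *: cross c x)) = a *: (2%:R^-1 *: (x + a *: cross c x)).
Proof.
move=> aa cx; rewrite crossZr crossDr crossZr cross_sq // [RHS]scalerA [a * _]mulrC.
by rewrite -[RHS]scalerA; congr (_ *: _); rewrite scalerDr scalerA aa scale1r addrC.
Qed.

Let split_orth x a v b : cross c v = b *: v -> ip v x = 0 ->
  ip v (2%:R^-1 *: (x + a *: cross c x)) = 0.
Proof.
move=> Hv vx; rewrite ipZr ipDr ipZr vx add0r ipC ip_cross phi_swap -ip_cross.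
by rewrite Hv ipZl vx !(mulr0, oppr0).
Qed.

Lemma exists_complement_pair : exists e2 f2,
  [/\ L e2, L f2, cross c e2 = e2 & cross c f2 = - f2] /\
  [/\ ip e1 f2 = 0, ip e2 f1 = 0 & ip e2 f2 = 1].
Proof.
have [x [y [Lx Ly xy]]] := exists_unit_pair.
pose pl a z := 2%:R^-1 *: (orth_proj z + a *: cross c (orth_proj z)).
have plE z : orth_proj z = pl 1 z + pl (-1) z.
  rewrite /pl -scalerDr scale1r scaleN1r addrACA subrr addr0 -mulr2n -scaler_nat.
  by rewrite scalerA mulVf ?scale1r.
have Lp z : L z -> L (pl 1 z) by move=> Lz; apply: split_L (pi_L Lz); rewrite rpred1.
have Lm z : L z -> L (pl (-1) z).
  by move=> Lz; apply: split_L (pi_L Lz); rewrite rpredN rpred1.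
have cp z : cross c (pl 1 z) = pl 1 z by rewrite -[RHS]scale1r; apply: split_eig; rewrite ?mulr1 ?pi_c.
have cm z : cross c (pl (-1) z) = - pl (-1) z.
  by rewrite -[RHS]scaleN1r; apply: split_eig; rewrite ?mulrNN ?mulr1 ?pi_c.
have e1p a z : ip e1 (pl a z) = 0 by apply: (@split_orth _ _ _ 1); rewrite ?scale1r ?pi_e.
have f1p a z : ip f1 (pl a z) = 0 by apply: (@split_orth _ _ _ (-1)); rewrite ?scaleN1r ?pi_f.
have pp z z' : ip (pl 1 z) (pl 1 z') = 0.
  have := @cross_eigen _ c 1 1 (pl 1 z) (pl 1 z'); rewrite !scale1r => /(_ (cp _) (cp _)).
  by move/eqP; rewrite -[1 + 1]/2%:R mulf_eq0 (negbTE two0) => /eqP.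
have mm z z' : ip (pl (-1) z) (pl (-1) z') = 0.
  have := @cross_eigen _ c (-1) (-1) (pl (-1) z) (pl (-1) z').
  rewrite !scaleN1r => /(_ (cm _) (cm _))/eqP.
  by rewrite -opprD -[1 + 1]/2%:R mulf_eq0 oppr_eq0 (negbTE two0) => /eqP.
have xyE : ip (orth_proj x) y = ip (pl 1 x) (pl (-1) y) + ip (pl 1 y) (pl (-1) x).
  transitivity (ip (orth_proj x) (orth_proj y)).
    rewrite [orth_proj y]/orth_proj !(ipDr, ipNr, ipZr).
    by rewrite ![ip (orth_proj x) _]ipC pi_c pi_e pi_f !mulr0 !(oppr0, addr0) ipC.
  by rewrite !plE !(ipDl, ipDr) pp mm add0r addr0 [ip (pl (-1) x) _]ipC.
have [[z z'] [Lz Lz' zz']] : exists p, [/\ L p.1, L p.2 & ip (pl 1 p.1) (pl (-1) p.2) \in @hunit E].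
  have [u|v1] := hint_unit_or (L_ip (Lp _ Lx) (Lm _ Ly)); first by exists (x, y).
  have [u|v2] := hint_unit_or (L_ip (Lp _ Ly) (Lm _ Lx)); first by exists (y, x).
  by have := hunit_max xy; rewrite xyE mulrDr rpredD.
exists (pl 1 z), ((ip (pl 1 z) (pl (-1) z'))^-1 *: pl (-1) z').
split; split=> //; first exact: Lp.
- by apply: LZ (Lm _ Lz'); rewrite hunitW ?hunitV.
- by rewrite crossZr cm scalerN.
- by rewrite ipZr e1p mulr0.
- by rewrite ipC f1p.
- by rewrite ipZr mulVf // hunit_neq0.
Qed.

End Complement.

Lemma split_G2_lattice : exists2 h, h \in GLO 7 &
  (forall x y z, phi (g *m h *m x) (g *m h *m y) (g *m h *m z) = phi x y z)
  /\ \det (g *m h) = 1.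
Proof.
have [u [v [Lu Lv uu vv uv]]] := exists_isotropic_pair.
pose c := u - 2%:R^-1 *: v; pose d := u + 2%:R^-1 *: v.
have Lc : L c by apply: LD => //; apply/LN/LZ.
have Ld : L d by apply: LD => //; apply/LZ.
have cc : ip c c = -1 by rewrite !ipE uu vv uv [ip v u]ipC uv; field; exact: two0.
have cd : ip c d = 0 by rewrite !ipE uu vv uv [ip v u]ipC uv; field; exact: two0.
have dd : ip d d = 1 by rewrite !ipE uu vv uv [ip v u]ipC uv; field; exact: two0.
clearbody c d.
have ccd : cross c (cross c d) = d.
  apply: (two_inj two0); rewrite scaler_nat mulr2n cross_twice cc cd.
  by rewrite !scale0r !addr0 mulrN1 opprK.
pose e1 := 2%:R^-1 *: (d + cross c d); pose f1 := d - cross c d.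
have ce1 : cross c e1 = e1 by rewrite crossZr crossDr ccd addrC.
have cf1 : cross c f1 = - f1 by rewrite crossDr crossNr ccd opprB.
have Le : L e1 by apply: LZ => //; apply: LD => //; apply: L_cross.
have Lf : L f1 by apply: LD => //; apply/LN/L_cross.
have ef : ip e1 f1 = 1.
  have xx : ip (cross c d) (cross c d) = -1.
    by rewrite ip_cross phi_swap -ip_cross ccd dd.
  by rewrite !ipE dd xx [ip d (cross c d)]ipC; field; exact: two0.
clearbody e1 f1.
have ce : ip c e1 = 0 by apply: (@cross_eigen_orth _ _ 1); rewrite ?oner_neq0 ?scale1r.
have cf : ip c f1 = 0.
  by apply: (@cross_eigen_orth _ _ (-1)); rewrite ?oppr_eq0 ?oner_neq0 ?scaleN1r.
have ee : ip e1 e1 = 0.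
  have := @cross_eigen _ c 1 1 e1 e1; rewrite !scale1r => /(_ ce1 ce1)/eqP.
  by rewrite -[1 + 1]/2%:R mulf_eq0 (negbTE two0) => /eqP.
have ff : ip f1 f1 = 0.
  have := @cross_eigen _ c (-1) (-1) f1 f1; rewrite !scaleN1r => /(_ cf1 cf1)/eqP.
  by rewrite -opprD -[1 + 1]/2%:R mulf_eq0 oppr_eq0 (negbTE two0) => /eqP.
have [e2 [f2 [[Le2 Lf2 ce2 cf2] [e1f2 e2f1 e2f2]]]] :=
  exists_complement_pair cc ce1 cf1 ce cf ee ff ef Lc Le Lf.
pose M := frame_mx c e1 e2 f1 f2.
have Mphi := frame_phi two0 cc ce1 ce2 cf1 cf2 ef e1f2 e2f1 e2f2.
have Mip := frame_ip two0 cc ce1 ce2 cf1 cf2 ef e1f2 e2f1 e2f2.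
have detM : \det M = 1 by apply: phi_isometry_det Mphi Mip; rewrite hunit_neq0 ?unit144.
have ghM : g *m (invmx g *m M) = M by rewrite mulKVmx.
exists (invmx g *m M); last by rewrite ghM.
rewrite GLO_det det_mulmx detM mulr1 det_inv hunitV // andbT.
apply/mxOverP=> i j.
have : L (M *m e_ j).
  have coO a : co (e_ j) a \in Oi by rewrite /co mxE rpred_nat.
  have Z a v1 : L v1 -> L (co (e_ j) a *: v1) by apply: LZ.
  have Le3 : L (frame_e3 f1 f2) by apply: LZ halfO (L_cross Lf Lf2).
  rewrite frame_mulE; exact: LD (LD (LD (LD (LD (LD (Z _ _ Lc) (Z _ _ Le)) (Z _ _ Le2))
    (Z _ _ Le3)) (Z _ _ Lf)) (Z _ _ Lf2)) (Z _ _ (L_cross Le Le2)).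
by move/mxOverP/(_ i 0); rewrite mulmxA -colE mxE.
Qed.

End SplitG2Lattices.

(** * Affine Springer fibers and lattices *)

Section LaurentLattices.
Variable k : fieldType.
Local Notation F := (laurent k).
Local Notation K := (laurent_hdvf k).

Lemma mxOver_map m n (A : 'M[F]_(m, n)) :
  reflect (exists B, A = map_mx (OtoF k) B) (A \is a mxOver (@hint K)).
Proof.
apply: (iffP mxOverP) => [HA|[B -> i j]]; last by rewrite mxE; apply: OtoF_int.
have /choice[f Hf] : forall p : 'I_m * 'I_n, exists o, A p.1 p.2 = OtoF k o.
  by move=> p; apply/OintP; apply: HA.
by exists (\matrix_(i, j) f (i, j)); apply/matrixP=> i j; rewrite !mxE -Hf.
Qed.

Lemma map_OtoF_inj m n : injective (@map_mx _ _ (OtoF k) m n).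
Proof.
move=> A B /matrixP AB; apply/matrixP=> i j; apply: OtoF_inj.
by have := AB i j; rewrite !mxE.
Qed.

Lemma GLO_map n (A : 'M[F]_n) :
  reflect (exists2 B, B \in unitmx & A = map_mx (OtoF k) B) (A \in @GLO K n).
Proof.
apply: (iffP idP) => [/GLOP[Au /mxOver_map[B EA] /mxOver_map[C EC]]|[B Bu ->]].
  exists B => //; suff /mulmx1_unit[] : B *m C = 1%:M by [].
  by apply: map_OtoF_inj; rewrite map_mxM map_mx1 -EA -EC mulmxV.
apply: (@GLO_inv K _ _ (map_mx (OtoF k) (invmx B))); try by apply/mxOver_map; eexists.
by rewrite -map_mxM mulmxV // map_mx1.
Qed.

Definition Ocol d : set 'cV[F]_d := [set x | x \is a mxOver (@hint K)].

Lemma Ocol_GLO d (h : 'M[F]_d) x : h \in @GLO K d -> Ocol (h *m x) <-> Ocol x.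
Proof.
move=> /GLOP[hu hi hV]; split=> H; last exact: (mxOver_mul hi H).
by rewrite -[x](mulKmx hu); apply: (mxOver_mul hV H).
Qed.

Lemma Ocol_GLO_int d (h : 'M[F]_d) : (forall x, Ocol x -> Ocol (h *m x)) ->
  h \is a mxOver (@hint K).
Proof.
move=> H; apply/mxOverP=> i j.
have /H/mxOverP/(_ i 0) : Ocol (delta_mx j 0).
  by apply/mxOverP=> a b; rewrite mxE; apply: (@rpred_nat _ (@hint K)).
by rewrite -colE mxE.
Qed.

Variables (V : lmodType F) (d : nat) (Phi : {linear 'cV[F]_d -> V}).
Hypothesis Phi_bij : bijective Phi.

Definition lat (g : 'M[F]_d) : set V := [set Phi (g *m x) | x in @Ocol d].

Lemma lat_lattice g : g \in unitmx -> lattice (lat g).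
Proof.
move=> gu; have colS (c : 'I_d -> F) :
    \sum_i c i *: Phi (col i g) = Phi (g *m \col_i c i).
  rewrite -[in RHS](mulmx1 g) -mulmxA mul1mx.
  have -> : g *m (\col_i c i) = \sum_i c i *: col i g.
    apply/colP=> r; rewrite mxE summxE; apply: eq_bigr => i _.
    by rewrite !mxE mulrC.
  by rewrite linear_sum; apply: eq_bigr => i _; rewrite linearZ.
exists d, (fun i => Phi (col i g)); split.
  apply/seteqP; split=> [_ [x /mxOver_map[o ->] <-]|_ [o ->]] /=.
    exists (fun i => o i 0); rewrite colS; congr (Phi (g *m _)).
    by apply/colP=> i; rewrite !mxE.
  exists (\col_i OtoF k (o i)); last by rewrite colS.
  by apply/mxOver_map; exists (\col_i o i); apply/colP=> i; rewrite !mxE.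
move=> v; have [Psi _ PsiK] := Phi_bij.
exists (fun i => (invmx g *m Psi v) i 0); rewrite colS.
have -> : \col_i (invmx g *m Psi v) i 0 = invmx g *m Psi v.
  by apply/colP=> i; rewrite mxE.
by rewrite (mulKVmx gu) PsiK.
Qed.

Lemma lattice_lat (L : set V) : lattice L -> exists2 g, g \in unitmx & L = lat g.
Proof.
move=> [n [b [-> Hspan]]]; have [Psi PhiK PsiK] := Phi_bij.
pose A : 'M[F]_(d, n) := \matrix_(i, j) Psi (b j) i 0.
have AE (c : 'I_n -> F) : \sum_i c i *: b i = Phi (A *m \col_i c i).
  have -> : A *m (\col_i c i) = \sum_i c i *: Psi (b i).
    apply/colP=> r; rewrite mxE summxE; apply: eq_bigr => i _.
    by rewrite !mxE mulrC.
  by rewrite linear_sum; apply: eq_bigr => i _; rewrite linearZ /= PsiK.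
have [U [W [D [UG WG /is_diag_mxP HD EA]]]] := @smith K _ _ A.
have Uu := GLO_unit UG; have Wu := GLO_unit WG.
have D0 (i : 'I_d) : exists j : 'I_n, (j = i :> nat) /\ D i j != 0.
  have [c Ec] := Hspan (Phi (U *m delta_mx i 0)).
  rewrite AE EA -!mulmxA in Ec; move/(can_inj PhiK)/(can_inj (mulKmx Uu)): Ec.
  move/(congr1 (fun u : 'cV_d => u i 0)); rewrite !mxE !eqxx => Ec; apply: contrapT => nex.
  move/eqP: Ec; rewrite big1 ?oner_eq0 // => j _.
  have [ji|ji] := eqVneq (i : nat) j; last by rewrite HD ?mul0r.
  have [->|Dij] := eqVneq (D i j) 0; first by rewrite mul0r.
  by case: nex; exists j.
have /choice[f Hf] := D0.
pose dl := \row_i D i (f i); exists (U *m diag_mx dl).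
  rewrite unitmx_mul Uu unitmxE det_diag unitfE /=.
  by apply/prodf_neq0 => i _; rewrite mxE; case: (Hf i).
have finj : injective f by move=> i i' E; apply: val_inj; rewrite /= -(Hf i).1 E (Hf i').1.
have DE (x : 'cV[F]_n) : D *m x = diag_mx dl *m \col_i x (f i) 0.
  apply/colP=> i; rewrite mul_diag_mx !mxE (bigD1 (f i)) //= big1 ?addr0 // => j.
  by rewrite -val_eqE /= (Hf i).1 eq_sym => ji; rewrite HD ?mul0r.
apply/seteqP; split=> [_ [o ->]|_ [x Ox <-]] /=.
  rewrite AE EA -!mulmxA DE mulmxA; eexists; last by [].
  have Oo : (\col_i OtoF k (o i)) \is a mxOver (@hint K).
    by apply/mxOverP=> i j; rewrite mxE; apply: OtoF_int.
  have /mxOverP H := mxOver_mul (GLO_int WG) Oo.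
  by apply/mxOverP=> i j; rewrite mxE; apply: H.
pose y : 'cV[F]_n := \col_j (if [pick i | f i == j] is Some i then x i 0 else 0).
have yO : y \is a mxOver (@hint K).
  apply/mxOverP=> j l; rewrite mxE; case: pickP => [i _|_]; first exact: (mxOverP Ox).
  exact: (@rpred0 _ (@hint K)).
have yf : \col_i y (f i) 0 = x.
  apply/colP=> i; rewrite !mxE; case: pickP => [i' /eqP/finj ->|/(_ i)] //.
  by rewrite eqxx.
have /mxOver_map[o Eo] := mxOver_mul (GLO_int (GLO_V WG)) yO.
exists (fun i => o i 0); rewrite AE EA -[x]yf -mulmxA -DE.
have -> : \col_i OtoF k (o i 0) = invmx W *m y.
  by rewrite Eo; apply/colP=> i; rewrite !mxE.
by rewrite -!mulmxA (mulKVmx Wu).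
Qed.

Lemma lat_degree g : g \in unitmx -> degree (lat g) (lat 1%:M) = 0 <->
  \det g \in @hunit K.
Proof.
move=> gu; have [U [W [e [UG WG Eg]]]] := @smith_unit K _ _ gu.
have Uu := GLO_unit UG; have Wu := GLO_unit WG.
pose Psi := (Phi \o mulmx U)%FUN.
have latE : lat g = Psi @` box e.
  apply/seteqP; split=> [_ [x Ox <-]|_ [x Bx <-]] /=.
    exists (diag_mx (\row_i varpi k ^ e i) *m (W *m x)); last first.
      by rewrite Eg /Psi /= -!mulmxA.
    move=> r; rewrite mul_diag_mx !mxE mulrA -expfzDr ?varpi_neq0 // addNr expr0z mul1r.
    have /mxOverP/(_ r 0) := mxOver_mul (GLO_int WG) Ox.
    by rewrite mxE.
  exists (invmx W *m (diag_mx (\row_i varpi k ^ (- e i)) *m x)).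
    apply: (mxOver_mul (GLO_int (GLO_V WG))); apply/mxOverP=> r j.
    by rewrite ord1 mul_diag_mx !mxE; apply: Bx.
  rewrite /Psi /= Eg -!mulmxA (mulKVmx Wu); congr (Phi (U *m _)).
  rewrite mulmxA mulmx_diag; apply/colP=> r; rewrite mul_diag_mx !mxE.
  by rewrite -expfzDr ?varpi_neq0 // subrr expr0z mul1r.
have lat1 : lat 1%:M = Psi @` box (fun=> 0).
  apply/seteqP; split=> [_ [x Ox <-]|_ [x Bx <-]] /=.
    exists (invmx U *m x); last by rewrite /Psi /= (mulKVmx Uu) mul1mx.
    move=> r; rewrite oppr0 expr0z mul1r.
    by have /mxOverP/(_ r 0) := mxOver_mul (GLO_int (GLO_V UG)) Ox.
  exists (U *m x); last by rewrite mul1mx.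
  apply: (mxOver_mul (GLO_int UG)); apply/mxOverP=> r j.
  by rewrite ord1; have := Bx r; rewrite oppr0 expr0z mul1r.
have Psi_inj : injective Psi.
  move=> x y /(bij_inj Phi_bij) /(congr1 (mulmx (invmx U))).
  by rewrite !(mulKmx Uu).
rewrite latE lat1 (@box_degree k V d Psi Psi_inj e).
have [u Hu Eu] : exists2 u, u \in @hunit K & \det g = varpi k ^ (\sum_r e r) * u.
  exists (\det U * \det W).
    by apply: hunitM; [move: UG | move: WG]; rewrite GLO_det => /andP[].
  rewrite Eg !det_mulmx det_diag mulrAC mulrC; congr (_ * _).
  rewrite (big_morph (fun m : int => varpi k ^ m) (id1 := 1) (op1 := *%R)) //.
    by apply: eq_bigr => i _; rewrite mxE.
  by move=> m n; rewrite expfzDr ?varpi_neq0.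
rewrite Eu; split=> [/eqP|/hunitP[_ H1 H2]].
  by rewrite oppr_eq0 => /eqP ->; rewrite expr0z mul1r.
rewrite (@hpiXM_int K _ _ Hu) in H1.
rewrite invfM invr_expz (@hpiXM_int K _ _ (hunitV Hu)) in H2.
by apply/eqP; rewrite oppr_eq0 eq_le H1 -oppr_ge0 H2.
Qed.

End LaurentLattices.

Section Assembly.
Variables (G : grp) (k : fieldType).
Local Notation F := (laurent k).
Local Notation K := (laurent_hdvf k).
Local Notation d := (gdim G).
Variables (a : cpoint G (fps k)) (T : tensor G k).

Lemma map_std_form (v : 'I_(arity G) -> 'cV[fps k]_d) :
  std_form (ktoF k) T (fun i => map_mx (OtoF k) (v i)) = OtoF k (std_form (ktoO k) T v).
Proof.
rewrite /std_form rmorph_sum; apply: eq_bigr => s _.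
rewrite rmorphM rmorph_prod; congr (_ * _); apply: eq_bigr => i _.
by rewrite mxE.
Qed.

Lemma OdE : @Od G k = @Ocol k d.
Proof.
apply/seteqP; split=> [_ [o _ <-]|x /mxOver_map[o ->]]; last by exists o.
by apply/mxOver_map; exists o.
Qed.

Lemma Gpoints1 (R : comUnitRingType) (iota : {rmorphism k -> R}) :
  Gpoints T iota 1%:M.
Proof.
split; [exact: unitmx1 | | by rewrite det1].
by move=> v; congr std_form; apply: funext => i; rewrite mul1mx.
Qed.

Lemma GpointsM (R : comUnitRingType) (iota : {rmorphism k -> R}) g h :
  Gpoints T iota g -> Gpoints T iota h -> Gpoints T iota (g *m h).
Proof.
move=> [gu gT gd] [hu hT hd]; split; first by rewrite unitmx_mul gu.
  move=> v; rewrite -[RHS]hT -[RHS]gT; congr std_form; apply: funext => i.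
  by rewrite mulmxA.
by move=> sG; rewrite det_mulmx gd // hd // mulr1.
Qed.

Lemma GpointsV (R : comUnitRingType) (iota : {rmorphism k -> R}) g :
  Gpoints T iota g -> Gpoints T iota (invmx g).
Proof.
move=> [gu gT gd]; split; first by rewrite unitmx_inv.
  move=> v; rewrite -[LHS]gT; congr std_form; apply: funext => i.
  by rewrite mulKVmx.
by move=> sG; rewrite det_inv gd // invr1.
Qed.

Lemma Gpoints_of_map (h : 'M[fps k]_d) : h \in unitmx ->
  Gpoints T (ktoF k) (map_mx (OtoF k) h) -> Gpoints T (ktoO k) h.
Proof.
move=> hu [_ hT hd]; split=> // [v|sG]; apply: OtoF_inj; last first.
  by rewrite -det_map_mx hd // rmorph1.
rewrite -!map_std_form -[RHS]hT; congr std_form; apply: funext => i.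
by rewrite map_mxM.
Qed.

Lemma coset_latticeE g : coset_lattice (GOcoset T g) = [set g *m x | x in @Ocol k d].
Proof.
apply/seteqP; split=> [_ [_ [x [[h [hu _ _] <-] Ox ->]]]|_ [x Ox <-]].
  exists (map_mx (OtoF k) h *m x); last by rewrite mulmxA.
  by rewrite OdE in Ox; apply/Ocol_GLO; first by apply/GLO_map; exists h.
exists (g *m map_mx (OtoF k) 1%:M), x; rewrite OdE; split=> //; last first.
  by rewrite map_mx1 mulmx1.
by exists 1%:M => //; apply: Gpoints1.
Qed.

Lemma GOcoset_sub g1 g2 : Gpoints T (ktoF k) g1 -> Gpoints T (ktoF k) g2 ->
  [set g1 *m x | x in @Ocol k d] = [set g2 *m x | x in @Ocol k d] ->
  GOcoset T g2 `<=` GOcoset T g1.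
Proof.
move=> G1 G2 E _ [h Gh <-].
have g1u : g1 \in unitmx by case: G1.
have g2u : g2 \in unitmx by case: G2.
have int1 : invmx g1 *m g2 \is a mxOver (@hint K).
  apply: Ocol_GLO_int => x Ox.
  have [y Oy Ey] : [set g1 *m x | x in @Ocol k d] (g2 *m x) by rewrite E; exists x.
  by rewrite -mulmxA -Ey (mulKmx g1u).
have int2 : invmx g2 *m g1 \is a mxOver (@hint K).
  apply: Ocol_GLO_int => x Ox.
  have [y Oy Ey] : [set g2 *m x | x in @Ocol k d] (g1 *m x) by rewrite -E; exists x.
  by rewrite -mulmxA -Ey (mulKmx g2u).
have /GLO_map[H Hu EH] : invmx g1 *m g2 \in @GLO K d.
  by apply: (GLO_inv int1 int2); rewrite mulmxA (mulmxK g2u) (mulVmx g1u).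
exists (H *m h).
  apply: GpointsM Gh; apply: Gpoints_of_map Hu _; rewrite -EH.
  exact: GpointsM (GpointsV G1) G2.
by rewrite map_mxM -EH !mulmxA (mulmxV g1u) mul1mx.
Qed.

Variables (Phi : {linear 'cV[F]_d -> Va a}) (gamma : 'M[F]_d).
Hypothesis Phi_bij : bijective Phi.
Hypothesis Phi_Od : Phi @` @Od G k = Ba a.
Hypothesis Phi_T : forall v : 'I_(arity G) -> 'cV[F]_d,
  omega (fun i => Phi (v i)) = std_form (ktoF k) T v.
Hypothesis Phi_gamma : forall u, Phi (gamma *m u) = alg_x (to_generic a) * Phi u.
Hypothesis Gpoints_det : forall g, Gpoints T (ktoF k) g -> \det g \in @hunit K.
Hypothesis lattice_homogeneous : forall g, g \in unitmx -> \det g \in @hunit K ->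
  (forall v : 'I_(arity G) -> 'cV[F]_d, (forall i, @Ocol k d (v i)) ->
     std_form (ktoF k) T (fun i => g *m v i) \in @hint K) ->
  exists2 h, h \in @GLO K d & Gpoints T (ktoF k) (g *m h).
Hypothesis gamma_Lie : forall v : 'I_(arity G) -> 'cV[F]_d,
  \sum_i std_form (ktoF k) T (fun j => if j == i then gamma *m v j else v j) = 0.
Hypothesis gamma_tr : special G -> \tr gamma = 0.

Lemma BaE : Ba a = lat Phi 1%:M.
Proof.
rewrite -Phi_Od OdE; apply/seteqP; split=> _ [x Ox <-]; exists x => //=;
  by rewrite mul1mx.
Qed.

Lemma springer_fiber_bij :
  set_bij (springer_fiber T gamma) (spectral_lattice a)
    (fun C => Phi @` coset_lattice C).
Proof.
have latE g : Phi @` coset_lattice (GOcoset T g) = lat Phi g.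
  rewrite coset_latticeE; apply/seteqP; split=> [_ [_ [x Ox <-] <-]|_ [x Ox <-]].
    by exists x.
  by exists (g *m x) => //; exists x.
split.
- move=> _ [g [Gg [X [_ _ ] EX]] ->] /=; rewrite latE.
  have gu : g \in unitmx by case: Gg.
  split; first exact: lat_lattice.
  + move=> _ [x Ox <-]; rewrite -Phi_gamma.
    exists (map_mx (OtoF k) X *m x); last first.
      by rewrite EX !mulmxA (mulmxV gu) mul1mx.
    by apply: (@mxOver_mul K _ _ _ _ _ _ Ox); apply/mxOver_map; exists X.
  + move=> v Lv; have /choice[x Hx] : forall i, exists x, Ocol x /\ Phi (g *m x) = v i.
      by move=> i; have [x Ox Ex] := Lv i; exists x.
    have /choice[o Ho] : forall i, exists o, x i = map_mx (OtoF k) o.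
      by move=> i; apply/mxOver_map; case: (Hx i).
    exists (std_form (ktoO k) T o) => //.
    rewrite -map_std_form; case: Gg => _ gT _; rewrite -gT -Phi_T; congr omega.
    by apply: funext => i; rewrite -(Hx i).2 (Ho i).
  + rewrite BaE; apply/(lat_degree Phi_bij gu); exact: Gpoints_det.
- move=> C1 C2; rewrite !inE => -[g1 [G1 _] ->] [g2 [G2 _] ->] /= E.
  have {}E : [set g1 *m x | x in @Ocol k d] = [set g2 *m x | x in @Ocol k d].
    have sub (A B : set 'cV[F]_d) : Phi @` A = Phi @` B -> A `<=` B.
      move=> AB x Ax; have [y By /(bij_inj Phi_bij) <- //] : (Phi @` B) (Phi x).
      by rewrite -AB; exists x.
    by rewrite -!coset_latticeE; apply/seteqP; split; apply: sub.
  by apply/seteqP; split; apply: GOcoset_sub.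
move=> L [/(lattice_lat Phi_bij)[g0 g0u ->] Lx Lint]; rewrite BaE.
move/(lat_degree Phi_bij g0u) => g0d.
have [|h hG Gg] := lattice_homogeneous g0u g0d.
  move=> v Ov; rewrite -Phi_T; apply/OintP.
  have [|o _ Eo] := Lint (fun i => Phi (g0 *m v i)); last by exists o.
  by move=> i; exists (v i).
set g := g0 *m h in Gg.
have gu : g \in unitmx by case: Gg.
have Lg : lat Phi g0 = lat Phi g.
  apply/seteqP; split=> _ [x Ox <-].
    exists (invmx h *m x); first by apply/(Ocol_GLO _ (GLO_V hG)).
    by rewrite /g -mulmxA (mulKVmx (GLO_unit hG)).
  exists (h *m x); first by apply/(Ocol_GLO _ hG).
  by rewrite /g mulmxA.
clearbody g; exists (GOcoset T g); last by rewrite latE.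
exists g => //; split=> //.
have /mxOver_map[X EX] : invmx g *m gamma *m g \is a mxOver (@hint K).
  apply: Ocol_GLO_int => x Ox.
  rewrite Lg in Lx; have [|y Oy] := Lx (Phi (g *m x)); first by exists x.
  rewrite -Phi_gamma => /(bij_inj Phi_bij) Ey.
  by rewrite -!mulmxA -Ey (mulKmx gu).
exists X; last by rewrite EX.
have gT := let: And3 _ gT _ := Gg in gT.
split=> [v|sG]; apply: OtoF_inj.
  rewrite rmorph0 rmorph_sum -[RHS](gamma_Lie (fun j => g *m map_mx (OtoF k) (v j))).
  apply: eq_bigr => i _; rewrite -map_std_form -gT; congr std_form.
  apply: funext => j; case: eqP => // _.
  by rewrite map_mxM -EX !mulmxA (mulmxV gu) mul1mx.
rewrite rmorph0 -(gamma_tr sG) -trace_map_mx -EX -mulmxA mxtrace_mulC.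
by rewrite mulmxK.
Qed.

End Assembly.

(** * The classical groups *)

Section SpectralTau.
Variables (G : grp) (R : comUnitRingType).

Lemma poly_tauD (h h' : poly_ring G R) : poly_tau (h + h') = poly_tau h + poly_tau h'.
Proof.
by case: G h h' => [m|m|m|] h h'; rewrite /poly_tau /= ?comp_polyD // raddfD comp_polyD.
Qed.

Lemma poly_tauM (h h' : poly_ring G R) : poly_tau (h * h') = poly_tau h * poly_tau h'.
Proof.
by case: G h h' => [m|m|m|] h h'; rewrite /poly_tau /= ?comp_polyM // rmorphM comp_polyM.
Qed.

Lemma poly_tau1 : poly_tau (1 : poly_ring G R) = 1.
Proof.
by case: G => [m|m|m|]; rewrite /poly_tau /= ?rmorph1 ?comp_polyC // comp_poly0r.
Qed.

Lemma poly_tau0 : poly_tau (0 : poly_ring G R) = 0.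
Proof. by apply: (addrI (poly_tau 0)); rewrite -poly_tauD !addr0. Qed.

Lemma poly_tauN (h : poly_ring G R) : poly_tau (- h) = - poly_tau h.
Proof. by apply: (addrI (poly_tau h)); rewrite -poly_tauD !subrr poly_tau0. Qed.

Lemma poly_tau_x : poly_tau (poly_x G R) = - poly_x G R.
Proof.
case: G => [m|m|m|]; rewrite /poly_tau /= ?comp_polyX //.
by rewrite map_polyC /= comp_polyX comp_polyC rmorphN.
Qed.
End SpectralTau.

Lemma comp_polyXN_even (R : comNzRingType) n : ~~ odd n ->
  ('X^n : {poly R}) \Po - 'X = 'X^n.
Proof. by move=> /negbTE nE; rewrite comp_Xn_poly exprNn -signr_odd nE mul1r. Qed.

Lemma comp_monic_even (R : comNzRingType) n (a : 'I_n -> R) :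
  monic_even_poly a \Po - 'X = monic_even_poly a.
Proof.
rewrite /monic_even_poly comp_polyD comp_polyXN_even ?odd_double // raddf_sum.
congr (_ + _).
by apply: eq_bigr => i _; rewrite /= comp_polyZ comp_polyXN_even ?odd_double.
Qed.

Lemma comp_G2_poly (R : comUnitRingType) (e q : R) : G2_poly e q \Po - 'X = G2_poly e q.
Proof.
rewrite /G2_poly !(comp_polyB, comp_polyD, comp_polyZ) comp_polyC.
by rewrite !comp_polyXN_even.
Qed.

Lemma relations_tau (G : grp) (R : comUnitRingType) (a : cpoint G R) :
  exists c : R, forall i, (i < size (relations a))%N ->
    poly_tau (relations a)`_i = poly_const G R c * (relations a)`_i.
Proof.
case: G a => [m|m|m|] a; rewrite /relations /poly_tau /=.
- by exists 1 => -[|//] _; rewrite /= mul1r comp_monic_even.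
- exists (-1) => -[|//] _; rewrite /= comp_polyM comp_polyX comp_monic_even.
  by rewrite polyCN !mulNr mul1r.
- exists 1 => -[|[|//]] _ /=; rewrite mul1r.
    rewrite raddfB /= rmorphM /= !map_polyC /= comp_polyB comp_polyM map_polyX.
    by rewrite !comp_polyC !comp_polyX rmorphN mulrNN.
  rewrite raddfD /= rmorphXn /= map_polyC /= map_polyX comp_polyD.
  by rewrite comp_polyC comp_monic_even rmorphXn /= comp_polyX sqrrN.
- exists (-1) => -[|//] _; rewrite /= comp_polyM comp_polyX comp_G2_poly.
  by rewrite polyCN !mulNr mul1r.
Qed.

Section SpectralAlgebraTau.
Variables (G : grp) (F : fieldType) (a : cpoint G F).
Local Notation V := (spectral_alg a).
Local Notation ideal := (gen_ideal (relations a)).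

Lemma alg_clsM (h h' : poly_ring G F) : alg_cls a (h * h') = alg_cls a h * alg_cls a h'.
Proof. exact: clsM. Qed.

Lemma alg_clsN (h : poly_ring G F) : alg_cls a (- h) = - alg_cls a h.
Proof.
apply/eqP; rewrite -addr_eq0; apply/eqP.
rewrite -[LHS]clsD addNr; apply: (addrI (alg_cls a 0)).
by rewrite -[LHS]clsD !addr0.
Qed.

Lemma alg_cls_rep (v : V) : exists h, v = alg_cls a h.
Proof.
by exists (rep (v : presented (poly_const G F) (relations a))); rewrite /alg_cls repK.
Qed.

Lemma tau_ideal (s : poly_ring G F) : s \in ideal -> poly_tau s \in ideal.
Proof.
move=> /asboolP[u ->]; have [c Hc] := relations_tau a; apply/asboolP.
exists (fun i => poly_tau (u i) * poly_const G F c).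
rewrite (big_morph (@poly_tau G F) (@poly_tauD G F) (@poly_tau0 G F)).
by apply: eq_bigr => i _; rewrite poly_tauM Hc // mulrA.
Qed.

Lemma alg_tau_cls (h : poly_ring G F) : alg_tau (alg_cls a h) = alg_cls a (poly_tau h).
Proof.
rewrite /alg_tau; apply/clsP.
set r := rep _; rewrite -poly_tauN -poly_tauD; apply: tau_ideal.
by apply/clsP; exact: repK.
Qed.

Lemma alg_tauM (u v : V) : alg_tau (u * v) = alg_tau u * alg_tau v.
Proof.
have [h ->] := alg_cls_rep u; have [h' ->] := alg_cls_rep v.
by rewrite -alg_clsM !alg_tau_cls poly_tauM alg_clsM.
Qed.

Lemma alg_tau_x : alg_tau (alg_x a) = - alg_x a.
Proof. by rewrite alg_tau_cls poly_tau_x alg_clsN. Qed.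

Lemma alg_tau1 : alg_tau (1 : V) = 1.
Proof. by rewrite -[1 : V]/(alg_cls a 1) alg_tau_cls poly_tau1. Qed.

(* [x] is skew for [omega]; oddness of [f] is all that is used of the trace. *)
Lemma skew_x (f : V -> F) (u v : V) : (forall b, f (- b) = - f b) ->
  f (alg_x a * u * alg_tau v) + f (u * alg_tau (alg_x a * v)) = 0.
Proof.
move=> fN; rewrite alg_tauM alg_tau_x mulNr mulrN mulrCA mulrA.
by rewrite [alg_x a * u]mulrC -mulrA fN subrr.
Qed.

End SpectralAlgebraTau.

Section BilinearTensor.
Variables (d : nat) (k : fieldType).
Implicit Types (T : {ffun 'I_2 -> 'I_d} -> k).

Definition pair_ffun (i j : 'I_d) : {ffun 'I_2 -> 'I_d} :=
  [ffun r => if r == ord0 then i else j].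

Definition tensor_mx T : 'M[k]_d := \matrix_(i, j) T (pair_ffun i j).

Lemma std_form_mx (R : comNzRingType) (iota : {rmorphism k -> R}) T
    (v : 'I_2 -> 'cV[R]_d) :
  \sum_(s : {ffun 'I_2 -> 'I_d}) iota (T s) * \prod_i v i (s i) 0
  = ((v ord0)^T *m map_mx iota (tensor_mx T) *m v ord_max) 0 0.
Proof.
rewrite (reindex (fun p => pair_ffun p.1 p.2)) /=; last first.
  exists (fun s => (s ord0, s ord_max)) => [[i j] _|s _] /=; first by rewrite !ffunE.
  apply/ffunP=> r; rewrite ffunE; case: eqP => [->|] //= /eqP r0; congr (s _).
  by apply: val_inj; case: r r0 => -[|[|]].
rewrite -(pair_bigA _ (fun i j => iota (T (pair_ffun i j)) *
  \prod_l v l (pair_ffun i j l) 0)) /= exchange_big mxE; apply: eq_bigr => j _.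
rewrite mxE mulr_suml; apply: eq_bigr => i _; rewrite !mxE.
rewrite big_ord_recl big_ord1 !ffunE /= (_ : lift _ _ = ord_max); last exact: val_inj.
by rewrite mulrA [v _ _ _ * iota _]mulrC.
Qed.

End BilinearTensor.

Lemma det_rank1 (R : comNzRingType) n (u : 'cV[R]_n) (v : 'rV[R]_n) :
  \det (1%:M + u *m v) = 1 + (v *m u) 0 0.
Proof.
have E1 : block_mx 1%:M (- v) u 1%:M =
    block_mx 1%:M 0 u 1%:M *m block_mx 1%:M (- v) 0 (1%:M + u *m v) :> 'M_(1 + n).
  rewrite mulmx_block !mulmx0 !mul0mx !mulmx1 !mul1mx !addr0.
  by rewrite mulmxN addrCA addNr addr0.
have E2 : block_mx 1%:M (- v) u 1%:M =
    block_mx 1%:M (- v) 0 1%:M *m block_mx (1%:M + v *m u) 0 u 1%:M :> 'M_(1 + n).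
  by rewrite mulmx_block !mulmx0 !mul0mx !mulmx1 !mul1mx !add0r mulNmx addrK.
have := congr1 determinant E1; rewrite E2 !det_mulmx !det_lblock !det_ublock !det1.
by rewrite !mul1r !mulr1 det_mx11 => <-; rewrite !mxE eqxx.
Qed.

Lemma mx_form_entry (R : comNzRingType) n (A : 'M[R]_n) i j :
  ((delta_mx i 0 : 'cV_n)^T *m A *m (delta_mx j 0 : 'cV_n)) 0 0 = A i j.
Proof. by rewrite trmx_delta -rowE -colE !mxE. Qed.

Lemma mx_form_inj (R : comNzRingType) n (A B : 'M[R]_n) :
  (forall u v : 'cV_n, (u^T *m A *m v) 0 0 = (u^T *m B *m v) 0 0) -> A = B.
Proof.
by move=> AB; apply/matrixP=> i j; rewrite -[LHS]mx_form_entry AB mx_form_entry.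
Qed.

Lemma exists_anisotropic (k : fieldType) n (J : 'M[k]_n) : 2%:R != 0 :> k ->
  J^T = J -> J != 0 -> exists v : 'cV_n, (v^T *m J *m v) 0 0 != 0.
Proof.
move=> two0 JT; apply: contraNP => nex.
have iso (v : 'cV_n) : (v^T *m J *m v) 0 0 = 0.
  by apply/eqP; apply: contra_notT nex => H; exists v.
apply/eqP/mx_form_inj => u v; rewrite mulmx0 mul0mx [RHS]mxE.
have D (A B : 'M[k]_1) : (A + B) 0 0 = A 0 0 + B 0 0 by rewrite mxE.
have C : (v^T *m J *m u) 0 0 = (u^T *m J *m v) 0 0.
  have -> : v^T *m J *m u = (u^T *m J *m v)^T by rewrite !trmx_mul trmxK JT mulmxA.
  by rewrite mxE.
have := iso (u + v); rewrite [_^T]raddfD /= mulmxDl !mulmxDr !mulmxDl !D !iso C.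
rewrite add0r addr0 -mulr2n -mulr_natl => /eqP.
by rewrite mulf_eq0 (negbTE two0) => /eqP.
Qed.

Lemma exists_reflection (k : fieldType) n (J : 'M[k]_n) : 2%:R != 0 :> k ->
  J^T = J -> J != 0 -> exists R : 'M_n, R^T *m J *m R = J /\ \det R = -1.
Proof.
move=> two0 JT J0; have [v q0] := exists_anisotropic two0 JT J0.
set q := (_ *m v) 0 0 in q0; pose b := v^T *m J.
have bv : b *m v = q%:M by rewrite [LHS]mx11_scalar.
have Jv : J *m v = b^T by rewrite trmx_mul trmxK JT.
pose c := - (2%:R / q); exists (1%:M + (c *: v) *m b); split; last first.
  by rewrite det_rank1 -scalemxAr bv !mxE eqxx mulr1n /c mulNr divfK // opprD addNKr.
rewrite [_^T]raddfD /= trmx1 trmx_mul mulmxDl mul1mx mulmxDr mulmx1 mulmxDl.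
rewrite linearZ /= -!scalemxAr -!scalemxAl -!scalemxAr.
have -> : J *m (v *m b) = b^T *m b by rewrite mulmxA Jv.
have -> : b^T *m v^T *m J = b^T *m b by rewrite -mulmxA.
have -> : b^T *m b *m (v *m b) = q *: (b^T *m b).
  by rewrite mulmxA -(mulmxA b^T) bv mul_mx_scalar -scalemxAl.
rewrite !scalerA -!scalerDl -addrA -scalerDl.
rewrite (_ : c + (c + c * c * q) = 0) ?scale0r ?addr0 //.
by rewrite /c; field.
Qed.

Section BilinearLattices.
Variables (k : fieldType) (n : nat) (J : 'M[k]_n) (eps : k).
Local Notation F := (laurent k).
Local Notation K := (laurent_hdvf k).
Hypotheses (eps1 : eps = 1 \/ eps = -1) (two0 : 2%:R != 0 :> k)
  (JT : J^T = eps *: J) (Ju : J \in unitmx).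
Let JF : 'M[F]_n := map_mx (ktoF k) J.

Lemma map_ktoF_GLO (A : 'M[k]_n) : A \in unitmx -> map_mx (ktoF k) A \in @GLO K n.
Proof.
move=> Au; have H (B : 'M[k]_n) : map_mx (ktoF k) B \is a mxOver (@hint K).
  by apply/mxOverP=> i j; rewrite mxE; apply: OtoF_int.
by apply: (GLO_inv (H A) (H (invmx A))); rewrite -map_mxM mulmxV // map_mx1.
Qed.

Lemma isometry_det (g : 'M[F]_n) : g^T *m JF *m g = JF -> \det g ^+ 2 = 1.
Proof.
move/(congr1 determinant); rewrite !det_mulmx det_tr mulrAC -expr2.
have J0 : \det JF != 0 by rewrite -unitfE -unitmxE map_unitmx.
by move=> H; apply: (mulIf J0); rewrite mul1r.
Qed.

Lemma isometry_det_unit (g : 'M[F]_n) : g^T *m JF *m g = JF -> \det g \in @hunit K.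
Proof.
move/isometry_det => g2; apply: (@hunit_root K _ 2) => //.
by rewrite g2; apply: hunit1.
Qed.

Lemma bilinear_homogeneous (g : 'M[F]_n) : (0 < n)%N -> g \in unitmx ->
    \det g \in @hunit K ->
    (forall u v : 'cV[F]_n, @Ocol k n u -> @Ocol k n v ->
       ((g *m u)^T *m JF *m (g *m v)) 0 0 \in @hint K) ->
  exists h, [/\ h \in @GLO K n, (g *m h)^T *m JF *m (g *m h) = JF
    & eps = 1 -> \det (g *m h) = 1].
Proof.
move=> n0 gu gd gint.
have JFG : JF \in @GLO K n by exact: map_ktoF_GLO.
have gJg : g^T *m JF *m g \in @GLO K n.
  rewrite (@GLO_det K); apply/andP; split; last first.
    rewrite !det_mulmx det_tr; apply: hunitM => //; apply: hunitM => //.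
    by move: JFG; rewrite (@GLO_det K) => /andP[].
  apply/mxOverP=> i j; rewrite -mx_form_entry.
  have dO l : Ocol (delta_mx l 0 : 'cV[F]_n).
    by apply/mxOverP=> r s; rewrite mxE; apply: (@rpred_nat _ (@hint K)).
  by have := gint _ _ (dO i) (dO j); rewrite trmx_mul !mulmxA.
have eps1F : ktoF k eps = 1 \/ ktoF k eps = -1.
  by case: eps1 => ->; [left | right]; rewrite ?rmorphN rmorph1.
have unit2 : 2%:R \in @hunit K.
  by rewrite -(rmorph_nat (ktoF k)); apply: ktoF_unit.
have JFT : JF^T = ktoF k eps *: JF by rewrite matrix.map_trmx JT map_mxZ.
have [h hG Eh] := @unimodular_isometric K n (ktoF k eps) JF g eps1F unit2 JFG JFT gu gJg.
have [d1|d1] := eqVneq (\det (g *m h)) 1; first by exists h.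
have dN1 : \det (g *m h) = -1.
  have /eqP := isometry_det Eh; rewrite sqrf_eq1 (negbTE d1) => /eqP //.
have [e1|eN1] := eqVneq eps 1; last by exists h; split=> // e1; rewrite e1 eqxx in eN1.
have J0 : J != 0.
  apply/eqP => J0; have := mulmxV Ju; rewrite J0 mul0mx.
  move/matrixP/(_ (Ordinal n0) (Ordinal n0)); rewrite !mxE eqxx => /eqP.
  by rewrite eq_sym oner_eq0.
have [|R [RJ Rd]] := exists_reflection two0 _ J0; first by rewrite JT e1 scale1r.
have RG : map_mx (ktoF k) R \in @GLO K n.
  by apply: map_ktoF_GLO; rewrite unitmxE Rd unitrN1.
exists (h *m map_mx (ktoF k) R); split.
- exact: GLO_M.
- rewrite (mulmxA g); move: (g *m h) Eh => gh Eh.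
  transitivity ((map_mx (ktoF k) R)^T *m (gh^T *m JF *m gh) *m map_mx (ktoF k) R).
    by rewrite trmx_mul !mulmxA.
  by rewrite Eh /JF matrix.map_trmx -!map_mxM RJ.
- by rewrite mulmxA det_mulmx dN1 det_map_mx Rd rmorphN rmorph1 mulrNN mulr1.
Qed.

End BilinearLattices.

Section BilinearCase.
Variables (G : grp) (k : fieldType).
Local Notation F := (laurent k).
Local Notation K := (laurent_hdvf k).
Local Notation d := (gdim G).
Variables (a : cpoint G (fps k)) (T : tensor G k).
Variables (i0 i1 : 'I_(arity G)) (J : 'M[k]_d) (eps : k).
Hypothesis i01 : i0 != i1.
Hypothesis i01E : forall i, (i == i0) || (i == i1).
Hypothesis form_J : forall (R : comNzRingType) (iota : {rmorphism k -> R})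
  (v : 'I_(arity G) -> 'cV[R]_d),
  std_form iota T v = ((v i0)^T *m map_mx iota J *m v i1) 0 0.
Hypotheses (eps1 : eps = 1 \/ eps = -1) (two0 : 2%:R != 0 :> k)
  (JT : J^T = eps *: J) (Ju : J \in unitmx) (d0 : (0 < d)%N).
Hypothesis special_eps : special G -> eps = 1.
Variables (Phi : {linear 'cV[F]_d -> Va a}) (gamma : 'M[F]_d).
Hypothesis Phi_bij : bijective Phi.
Hypothesis Phi_Od : Phi @` @Od G k = Ba a.
Hypothesis Phi_T : forall v : 'I_(arity G) -> 'cV[F]_d,
  omega (fun i => Phi (v i)) = std_form (ktoF k) T v.
Hypothesis Phi_gamma : forall u, Phi (gamma *m u) = alg_x (to_generic a) * Phi u.
Variable f : Va a -> F.
Hypothesis omegaE : forall v : 'I_(arity G) -> Va a,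
  omega v = f (v i0 * alg_tau (v i1)).

Let pick2 (A : Type) (x y : A) : 'I_(arity G) -> A := fun i => if i == i0 then x else y.
Let pick2_0 (A : Type) (x y : A) : pick2 x y i0 = x. Proof. by rewrite /pick2 eqxx. Qed.
Let pick2_1 (A : Type) (x y : A) : pick2 x y i1 = y.
Proof. by rewrite /pick2 eq_sym (negbTE i01). Qed.

Let form_pick2 (R : comNzRingType) (iota : {rmorphism k -> R}) (x y : 'cV[R]_d) :
  std_form iota T (pick2 x y) = (x^T *m map_mx iota J *m y) 0 0.
Proof. by rewrite form_J pick2_0 pick2_1. Qed.

Let Gpoints_isometry (R : comUnitRingType) (iota : {rmorphism k -> R}) g :
  Gpoints T iota g <-> [/\ g \in unitmx,
    g^T *m map_mx iota J *m g = map_mx iota J & special G -> \det g = 1].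
Proof.
split=> [[gu gT gd]|[gu gJ gd]]; split=> //.
  apply: mx_form_inj => u v; have := gT (pick2 u v); rewrite form_pick2 form_J => <-.
  by rewrite pick2_0 pick2_1 trmx_mul !mulmxA.
by move=> v; rewrite !form_J trmx_mul -[in RHS]gJ !mulmxA.
Qed.

Let f_omega (u v : 'cV[F]_d) :
  f (Phi u * alg_tau (Phi v)) = (u^T *m map_mx (ktoF k) J *m v) 0 0.
Proof.
rewrite -form_pick2 -Phi_T omegaE; congr (f (_ * alg_tau _)).
  by rewrite pick2_0.
by rewrite pick2_1.
Qed.

Let f_opp b : f (- b) = - f b.
Proof.
have [Psi _ PsiK] := Phi_bij.
have fE c : f c = ((Psi c)^T *m map_mx (ktoF k) J *m Psi 1) 0 0.
  rewrite -f_omega !PsiK; have -> : alg_tau (1 : Va a) = 1 by apply: alg_tau1.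
  by rewrite mulr1.
rewrite !fE; have -> : Psi (- b) = - Psi b.
  apply: (bij_inj Phi_bij); by rewrite [RHS]linearN !PsiK.
by rewrite [_^T]raddfN /= !mulNmx mxE.
Qed.

Let gamma_skew (u v : 'cV[F]_d) : ((gamma *m u)^T *m map_mx (ktoF k) J *m v) 0 0
  + (u^T *m map_mx (ktoF k) J *m (gamma *m v)) 0 0 = 0.
Proof. by rewrite -!f_omega !Phi_gamma; exact: skew_x f_opp. Qed.

Lemma bilinear_springer_fiber_bij :
  set_bij (springer_fiber T gamma) (spectral_lattice a)
    (fun C => Phi @` coset_lattice C).
Proof.
have JFu : map_mx (ktoF k) J \in unitmx by rewrite map_unitmx.
apply: springer_fiber_bij => //.
- by move=> g /Gpoints_isometry[_ gJ _]; apply: isometry_det_unit Ju _ gJ.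
- move=> g gu gd gint.
  have [|h [hG hJ hd]] := bilinear_homogeneous eps1 two0 JT Ju d0 gu gd.
    move=> u v Ou Ov; have := gint (pick2 u v); rewrite form_J pick2_0 pick2_1; apply.
    by move=> i; rewrite /pick2; case: ifP.
  exists h; first exact: hG.
  apply/Gpoints_isometry; split; [|exact: hJ|by move/special_eps].
  by rewrite unitmx_mul gu (GLO_unit hG).
- move=> v; rewrite (bigD1 i0) //= (big_pred1 i1) => [|i]; last first.
    by have := i01E i; case: eqP => [->|] //=; rewrite (negbTE i01).
  by rewrite !form_J !eqxx [i1 == i0]eq_sym (negbTE i01) gamma_skew.
- move=> sG; have H : gamma^T *m map_mx (ktoF k) J = - (map_mx (ktoF k) J *m gamma).
    apply/eqP; rewrite -addr_eq0; apply/eqP/mx_form_inj => u v.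
    rewrite mulmx0 mul0mx [RHS]mxE -[RHS](gamma_skew u v) mulmxDr mulmxDl mxE.
    by rewrite trmx_mul !mulmxA.
  have : \tr gamma = - \tr gamma.
    rewrite -[in LHS]mxtrace_tr -[gamma^T](mulmxK JFu) H mulNmx raddfN /=; congr (- _).
    by rewrite mxtrace_mulC mulKmx.
  move/eqP; rewrite -addr_eq0 -mulr2n -mulr_natl mulf_eq0 => /orP[|/eqP//].
  by rewrite -(rmorph_nat (ktoF k)) fmorph_eq0 (negbTE two0).
Qed.

End BilinearCase.

Section TensorMatrix.
Variables (k : fieldType) (d : nat) (T : {ffun 'I_2 -> 'I_d} -> k).
Local Notation J := (tensor_mx T).

Lemma tensor_mx_tr (eps : 'S_2 -> k) :
  (forall (p : 'S_2) (s : {ffun 'I_2 -> 'I_d}), T [ffun i => s (p i)] = eps p * T s) ->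
  J^T = eps (tperm ord0 ord_max) *: J.
Proof.
move=> HT; apply/matrixP=> i j; rewrite !mxE -HT; congr T.
apply/ffunP=> r; rewrite !ffunE; case: tpermP => [->|->|/eqP + /eqP] //.
by case: r => -[|[|]].
Qed.

Lemma tensor_mx_unit eps : eps != 0 -> J^T = eps *: J ->
    (forall u : 'cV[k]_d, (forall v : 'I_2 -> 'cV[k]_d, (exists i, v i = u) ->
       ((v ord0)^T *m J *m v ord_max) 0 0 = 0) -> u = 0) -> J \in unitmx.
Proof.
move=> eps0 JT nd; rewrite -row_free_unit -kermx_eq0; apply/eqP/row_matrixP => i.
rewrite row0; set u := row i _.
have uJ : u *m J = 0 by apply: (sub_kermxP (row_sub _ _)).
have Ju : J *m u^T = 0.
  apply/eqP; move/(congr1 trmx)/eqP: uJ; rewrite trmx_mul JT -scalemxAl trmx0.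
  by rewrite scaler_eq0 (negbTE eps0).
apply: trmx_inj; rewrite trmx0; apply: nd => v [r vr].
have [r0|r1] : r = ord0 \/ r = ord_max.
  by case: r {vr} => -[|[|//]] ?; [left | right]; apply: val_inj.
  by rewrite -r0 vr trmxK uJ mul0mx mxE.
by rewrite -r1 vr -mulmxA Ju mulmx0 mxE.
Qed.
End TensorMatrix.

Section ClassicalGroups.
Variable k : fieldType.
Local Notation F := (laurent k).

Lemma two_neq0_pchar : 2%N \notin [pchar k] -> 2%:R != 0 :> k.
Proof. by rewrite inE. Qed.

Let alternating_mx d (T : {ffun 'I_2 -> 'I_d} -> k) :
  (forall (p : 'S_2) (s : {ffun 'I_2 -> 'I_d}), T [ffun i => s (p i)] = (-1) ^+ p * T s) ->
  (tensor_mx T)^T = -1 *: tensor_mx T.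
Proof.
move=> HT; rewrite (@tensor_mx_tr _ _ _ (fun p : 'S_2 => (-1) ^+ p)) //.
by rewrite odd_tperm.
Qed.

Let symmetric_mx d (T : {ffun 'I_2 -> 'I_d} -> k) :
  (forall (p : 'S_2) (s : {ffun 'I_2 -> 'I_d}), T [ffun i => s (p i)] = T s) ->
  (tensor_mx T)^T = 1 *: tensor_mx T.
Proof.
by move=> HT; rewrite (@tensor_mx_tr _ _ _ (fun=> 1)) // => p s; rewrite mul1r.
Qed.

Let ord2E (i : 'I_2) : (i == ord0) || (i == ord_max).
Proof. by case: i => -[|[|]]. Qed.

Lemma oppr1_neq0 (R : nzRingType) : - 1 != 0 :> R.
Proof. by rewrite oppr_eq0 oner_eq0. Qed.

Lemma Sp_springer_fiber_bij m (hG : admissible (Sp m) k) (a : cpoint (Sp m) (fps k))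
    (T : tensor (Sp m) k) (hT : standard_tensor T) (cB c0 : k)
    (Phi : {linear 'cV[F]_(gdim (Sp m)) -> Va a}) (hPhi : identification T cB c0 Phi)
    (gamma : 'M[F]_(gdim (Sp m)))
    (hgamma : forall u, Phi (gamma *m u) = alg_x (to_generic a) * Phi u) :
  set_bij (springer_fiber T gamma) (spectral_lattice a)
    (fun C => Phi @` coset_lattice C).
Proof.
case: hPhi => Phi_bij Phi_Od Phi_T _; case: hT => -[_ altT] nd.
have JT := alternating_mx altT.
have [m0 /two_neq0_pchar two0] := hG.
have formJ (R : comNzRingType) (iota : {rmorphism k -> R}) v :
    std_form iota T v = ((v ord0)^T *m map_mx iota (tensor_mx T) *m v ord_max) 0 0.
  exact: std_form_mx.
have Ju : tensor_mx T \in unitmx.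
  apply: tensor_mx_unit (oppr1_neq0 k) JT _ => u Hu; apply: nd => v Hv.
  by rewrite formJ map_mx_id; [exact: Hu | by []].
have eps1 : (-1 : k) = 1 \/ (-1 : k) = -1 by right.
have d0 : (0 < gdim (Sp m))%N by rewrite /gdim double_gt0.
have sp : special (Sp m) -> -1 = 1 :> k by [].
exact: (@bilinear_springer_fiber_bij (Sp m) k a T ord0 ord_max _ _ isT ord2E formJ
  eps1 two0 JT Ju d0 sp Phi gamma Phi_bij Phi_Od Phi_T hgamma
  (fun b => Defs.coord (gdim (Sp m)) (std_basis (to_generic a)) b
     (gdim (Sp m)).-1) (fun=> erefl)).
Qed.

Lemma SOodd_springer_fiber_bij m (hG : admissible (SOodd m) k)
    (a : cpoint (SOodd m) (fps k))
    (T : tensor (SOodd m) k) (hT : standard_tensor T) (cB c0 : k)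
    (Phi : {linear 'cV[F]_(gdim (SOodd m)) -> Va a}) (hPhi : identification T cB c0 Phi)
    (gamma : 'M[F]_(gdim (SOodd m)))
    (hgamma : forall u, Phi (gamma *m u) = alg_x (to_generic a) * Phi u) :
  set_bij (springer_fiber T gamma) (spectral_lattice a)
    (fun C => Phi @` coset_lattice C).
Proof.
case: hPhi => Phi_bij Phi_Od Phi_T _; case: hT => symT nd.
have JT := symmetric_mx symT.
have [m0 /two_neq0_pchar two0] := hG.
have formJ (R : comNzRingType) (iota : {rmorphism k -> R}) v :
    std_form iota T v = ((v ord0)^T *m map_mx iota (tensor_mx T) *m v ord_max) 0 0.
  exact: std_form_mx.
have Ju : tensor_mx T \in unitmx.
  apply: tensor_mx_unit (oner_neq0 _) JT _ => u Hu; apply: nd => v Hv.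
  by rewrite formJ map_mx_id; [exact: Hu | by []].
have eps1 : (1 : k) = 1 \/ (1 : k) = -1 by left.
have d0 : (0 < gdim (SOodd m))%N by rewrite /gdim //.
have sp : special (SOodd m) -> 1 = 1 :> k by [].
exact: (@bilinear_springer_fiber_bij (SOodd m) k a T ord0 ord_max _ _ isT ord2E formJ
  eps1 two0 JT Ju d0 sp Phi gamma Phi_bij Phi_Od Phi_T hgamma
  (fun b => Defs.coord (gdim (SOodd m)) (std_basis (to_generic a)) b
     (gdim (SOodd m)).-1) (fun=> erefl)).
Qed.

Lemma SOeven_springer_fiber_bij m (hG : admissible (SOeven m) k)
    (a : cpoint (SOeven m) (fps k))
    (T : tensor (SOeven m) k) (hT : standard_tensor T) (cB c0 : k)
    (Phi : {linear 'cV[F]_(gdim (SOeven m)) -> Va a}) (hPhi : identification T cB c0 Phi)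
    (gamma : 'M[F]_(gdim (SOeven m)))
    (hgamma : forall u, Phi (gamma *m u) = alg_x (to_generic a) * Phi u) :
  set_bij (springer_fiber T gamma) (spectral_lattice a)
    (fun C => Phi @` coset_lattice C).
Proof.
case: hPhi => Phi_bij Phi_Od Phi_T _; case: hT => symT nd.
have JT := symmetric_mx symT.
have [m0 /two_neq0_pchar two0] := hG.
have formJ (R : comNzRingType) (iota : {rmorphism k -> R}) v :
    std_form iota T v = ((v ord0)^T *m map_mx iota (tensor_mx T) *m v ord_max) 0 0.
  exact: std_form_mx.
have Ju : tensor_mx T \in unitmx.
  apply: tensor_mx_unit (oner_neq0 _) JT _ => u Hu; apply: nd => v Hv.
  by rewrite formJ map_mx_id; [exact: Hu | by []].
have eps1 : (1 : k) = 1 \/ (1 : k) = -1 by left.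
have d0 : (0 < gdim (SOeven m))%N by rewrite /gdim double_gt0.
have sp : special (SOeven m) -> 1 = 1 :> k by [].
exact: (@bilinear_springer_fiber_bij (SOeven m) k a T ord0 ord_max _ _ isT ord2E formJ
  eps1 two0 JT Ju d0 sp Phi gamma Phi_bij Phi_Od Phi_T hgamma
  (fun b => alg_tr (alg_div b (SOeven_D (to_generic a)))) (fun=> erefl)).
Qed.

End ClassicalGroups.

(** * The group G2 *)

Lemma coord_sum (F : fieldType) (V : lmodType F) n (b : nat -> V) (c : nat -> F) i :
  (forall c' : nat -> F, \sum_(i < n) c' i *: b i = 0 -> forall i, (i < n)%N -> c' i = 0) ->
  (i < n)%N -> Defs.coord n b (\sum_(i < n) c i *: b i) i = c i.
Proof.
move=> free_b lt_in; rewrite /Defs.coord; case: xgetP => [c' _ [_ E]|H].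
  apply/eqP; rewrite -subr_eq0; apply/eqP.
  move: i lt_in; apply: (free_b (fun i => c' i - c i)).
  transitivity (\sum_(i < n) c' i *: b i - \sum_(i < n) c i *: b i).
    by rewrite -sumrB; apply: eq_bigr => j _; rewrite scalerBl.
  by rewrite -E subrr.
case: (H (fun i => if (i < n)%N then c i else 0)); split=> [j|].
  by rewrite leqNgt => /negbTE ->.
by apply: eq_bigr => j _; rewrite ltn_ord.
Qed.

Lemma wedge111E (F : fieldType) (a : cpoint G2 F) (l0 l1 l2 : spectral_alg a -> F) v :
  wedge111 l0 l1 l2 v =
  let v0 := v (inord 0) in let v1 := v (inord 1) in let v2 := v (inord 2) in
  l0 v0 * (l1 v1 * l2 v2 - l1 v2 * l2 v1) - l0 v1 * (l1 v0 * l2 v2 - l1 v2 * l2 v0)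
  + l0 v2 * (l1 v0 * l2 v1 - l1 v1 * l2 v0).
Proof.
have det2 (M : 'M[F]_2) : \det M = M ord0 ord0 * M (lift ord0 ord0) (lift ord0 ord0)
    - M ord0 (lift ord0 ord0) * M (lift ord0 ord0) ord0.
  rewrite (expand_det_row _ ord0) !big_ord_recl big_ord0 /cofactor !det_mx11 !mxE addr0 /=.
  rewrite expr0 expr1 mul1r mulN1r mulrN.
  by congr (_ * M _ _ - _ * M _ _); apply: val_inj.
have e0 : inord 0 = ord0 :> 'I_3 by apply: val_inj; rewrite /= inordK.
have e1 : inord 1 = lift ord0 ord0 :> 'I_3 by apply: val_inj; rewrite /= inordK.
have e2 : inord 2 = lift ord0 (lift ord0 ord0) :> 'I_3 by apply: val_inj; rewrite /= inordK.
rewrite /wedge111 (expand_det_row _ ord0) !big_ord_recl big_ord0 /cofactor.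
have l10 : lift (lift ord0 ord0) ord0 = ord0 :> 'I_3 by apply: val_inj.
have l20 : lift (lift ord0 (lift ord0 ord0)) ord0 = ord0 :> 'I_3 by apply: val_inj.
have l11 : lift (lift ord0 ord0) (lift ord0 ord0) = lift ord0 (lift ord0 ord0) :> 'I_3.
  exact: val_inj.
have l21 : lift (lift ord0 (lift ord0 ord0)) (lift ord0 ord0) = lift ord0 ord0 :> 'I_3.
  exact: val_inj.
rewrite e0 e1 e2 !det2 !mxE l10 l20 l11 l21 /= (_ : (0 + bump 0 (bump 0 0))%N = 2) //.
ring.
Qed.

Lemma G2_regular_semisimple (F : fieldType) (a : cpoint G2 F) :
  2%:R != 0 :> F -> regular_semisimple a ->
  a.2 != 0 /\ coprimep (@spectral_poly G2 F a) (@spectral_poly G2 F a)^`().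
Proof.
move=> two0 [E [iota [t [/= t0 fE [tn0 tB]]]]].
have two0E : 2%:R != 0 :> E by rewrite -(rmorph_nat iota) fmorph_eq0.
have tN i : t i + t i != 0 by rewrite -mulr2n -mulr_natl mulf_neq0.
have tD i j : i != j -> t i + t j != 0.
  move=> ij; apply/eqP => tij.
  have [l [li lj]] : exists l : 'I_3, l != i /\ l != j.
    have l3 : (3 - i - j < 3)%N.
      by move: ij; case: i j {tij} => -[|[|[|//]]] ? [[|[|[|//]]] ?].
    exists (Ordinal l3); move: ij; rewrite -!val_eqE /= {l3}.
    by case: i j {tij} => -[|[|[|//]]] ? [[|[|[|//]]] ?].
  move: t0; rewrite (bigD1 l) //= (bigD1 i) /= 1?eq_sym // (bigD1 j) /=; last first.
    by rewrite ![j == _]eq_sym lj ij.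
  rewrite big1 => [|u /andP[/andP[ul ui] uj]].
    by rewrite addr0 tij addr0; apply/eqP.
  move: ul ui uj li lj ij; rewrite -!val_eqE /=.
  by case: u l i j {tij} => -[|[|[|//]]] ? [[|[|[|//]]] ?] [[|[|[|//]]] ?] [[|[|[|//]]] ?].
have big3 (g : 'I_3 -> {poly E}) : \prod_i g i = g ord0 * (g (lift ord0 ord0) * g ord_max).
  rewrite !big_ord_recl big_ord0 mulr1; congr (_ * (_ * g _)); exact: val_inj.
have {fE}fE : map_poly iota ('X * G2_poly a.1 a.2) = \prod_(z <- [:: 0; t ord0; - t ord0;
    t (lift ord0 ord0); - t (lift ord0 ord0); t ord_max; - t ord_max]) ('X - z%:P).
  rewrite fE /torus_poly big3 !big_cons big_nil; ring.
suff sep : coprimep (@spectral_poly G2 F a) (@spectral_poly G2 F a)^`().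
  split=> //; have /(coprimep_root sep) : root (@spectral_poly G2 F a) 0.
    by rewrite /root /= hornerM hornerX mul0r.
  by rewrite /= /G2_poly !derivE !hornerE /= expr0n !mulr0 subrr !add0r.
rewrite -(coprimep_map iota) -deriv_map [spectral_poly _]/= fE.
have sepP (p : {poly E}) : separable_poly p -> coprimep p p^`() by rewrite unlock.
apply: sepP; rewrite separable_prod_XsubC /= !inE !negb_or.
have N0 i : (0 == - t i) = false by rewrite eq_sym oppr_eq0 (negbTE (tn0 i)).
have P0 i : (0 == t i) = false by rewrite eq_sym (negbTE (tn0 i)).
have PN i j : (t i == - t j) = false.
  rewrite -addr_eq0; apply/negbTE; have [->|ij] := eqVneq i j; [exact: tN | exact: tD].
have NP i j : (- t i == t j) = false by rewrite eqr_oppLR PN.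
have PP i j : i != j -> (t i == t j) = false.
  by move=> ij; rewrite -subr_eq0; apply/negbTE; case: (tB i j ij).
by rewrite !eqr_opp !N0 !P0 !PN !NP !PP.
Qed.
  
Section G2Algebra.
Variables (F : fieldType) (e q : F).
Hypothesis two_neq0 : 2%:R != 0 :> F.
Local Notation a := ((e, q) : cpoint G2 F).
Local Notation V := (spectral_alg a).
Local Notation cl := (@alg_cls G2 F a : {poly F} -> V).
Local Notation f := (@spectral_poly G2 F a).

Definition G2_vec (c : nat -> F) : V := cl (\poly_(i < 7) c i).

Lemma G2_clsD (g h : {poly F}) : cl (g + h) = cl g + cl h.
Proof. exact: clsD. Qed.

Lemma G2_clsZ c (h : {poly F}) : cl (c *: h) = c *: cl h.
Proof. by rewrite -mul_polyC; exact: clsM. Qed.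

Lemma G2_scaleAl c (u v : V) : c *: (u * v) = c *: u * v.
Proof. exact: mulrA. Qed.

Lemma G2_scaleAr c (u v : V) : c *: (u * v) = u * (c *: v).
Proof. by rewrite mulrC G2_scaleAl mulrC. Qed.

Lemma G2_cls0 : cl 0 = 0.
Proof. by apply: (addrI (cl 0)); rewrite -G2_clsD !addr0. Qed.

Lemma G2_cls_sum n (h : 'I_n -> {poly F}) : cl (\sum_i h i) = \sum_i cl (h i).
Proof. exact: (big_morph cl G2_clsD G2_cls0). Qed.

Lemma G2_cls_eq (g h : {poly F}) : cl g = cl h <-> f %| (g - h).
Proof.
rewrite clsP; split=> [/asboolP[u ->]|/dvdpP[u E]].
  by rewrite big_ord1 /= dvdp_mull.
by apply/asboolP; exists (fun=> u); rewrite big_ord1 /= E.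
Qed.

Lemma G2_polyE : f = 'X^7 - e *: 'X^5 + (e ^+ 2 / 4%:R) *: 'X^3 + q *: 'X.
Proof.
rewrite /= /G2_poly !mulrDr mulrN -!scalerAr -!exprS.
by rewrite [_ * q%:P]mulrC mul_polyC.
Qed.

Lemma size_G2_poly : size f = 8%N.
Proof.
rewrite G2_polyE -!addrA size_polyDl ?size_polyXn //.
apply: (leq_ltn_trans (size_polyD _ _)); rewrite gtn_max size_polyN.
rewrite (leq_ltn_trans (size_scale_leq _ _)) ?size_polyXn //=.
apply: (leq_ltn_trans (size_polyD _ _)); rewrite gtn_max.
rewrite (leq_ltn_trans (size_scale_leq _ _)) ?size_polyXn //=.
by rewrite (leq_ltn_trans (size_scale_leq _ _)) ?size_polyX.
Qed.

Lemma G2_std_sum (c : nat -> F) : \sum_(i < 7) c i *: std_basis a i = G2_vec c.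
Proof. by rewrite /G2_vec poly_def G2_cls_sum; apply: eq_bigr => i _; rewrite G2_clsZ. Qed.

Lemma G2_std_free (c : nat -> F) : \sum_(i < 7) c i *: std_basis a i = 0 ->
  forall i, (i < 7)%N -> c i = 0.
Proof.
rewrite G2_std_sum => E i i7.
have /G2_cls_eq fP : cl (\poly_(i < 7) c i) = cl 0 by rewrite G2_cls0.
rewrite subr0 in fP; have /polyP/(_ i) : \poly_(i < 7) c i = 0.
  apply/eqP; apply: contraLR fP => P0; apply/negP => /(dvdp_leq P0).
  by rewrite size_G2_poly leqNgt ltnS size_poly.
by rewrite coef_poly i7 coef0.
Qed.

Lemma G2_coord_std c i : (i < 7)%N -> Defs.coord 7 (std_basis a) (G2_vec c) i = c i.
Proof. by move=> i7; rewrite -G2_std_sum; apply: coord_sum => //; exact: G2_std_free. Qed.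

Lemma G2_std_span (v : V) : exists c, v = G2_vec c.
Proof.
have [h ->] := alg_cls_rep v; exists (nth 0 (h %% f)%R); apply/G2_cls_eq.
rewrite (_ : \poly_(i < 7) _ = h %% f).
  by rewrite {1}(divp_eq h f) addrK dvdp_mull.
apply/polyP=> i; rewrite coef_poly; case: ltnP => // i7; apply/esym/nth_default.
apply: leq_trans i7; rewrite -ltnS -size_G2_poly ltn_modp -size_poly_gt0.
by rewrite size_G2_poly.
Qed.

Local Notation r := (e / 4%:R).
Local Notation s := (q / 2%:R).

Let four_neq0 : 4%:R != 0 :> F.
Proof. by rewrite (natrM _ 2 2) mulf_neq0. Qed.
Let eE : e = 4%:R * r. Proof. by rewrite mulrC divfK. Qed.
Let qE : q = 2%:R * s. Proof. by rewrite mulrC divfK. Qed.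
Let e2E : e / 2%:R = 2%:R * r.
Proof. by field; rewrite four_neq0 two_neq0. Qed.
Let ee4E : e ^+ 2 / 4%:R = 4%:R * r ^+ 2.
Proof. by field; rewrite four_neq0. Qed.

Definition G2_top (v : V) : F := Defs.coord 7 (std_basis a) v 6.

Lemma G2_top_vec c : G2_top (G2_vec c) = c 6.
Proof. exact: G2_coord_std. Qed.

Lemma G2_vecD c c' : G2_vec c + G2_vec c' = G2_vec (fun i => c i + c' i).
Proof.
rewrite -G2_clsD; congr cl; apply/polyP=> i; rewrite coefD !coef_poly.
by case: ifP; rewrite ?addr0.
Qed.

Lemma G2_vecZ x c : x *: G2_vec c = G2_vec (fun i => x * c i).
Proof.
rewrite -G2_clsZ; congr cl; apply/polyP=> i; rewrite coefZ !coef_poly.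
by case: ifP; rewrite ?mulr0.
Qed.

Lemma G2_topD u v : G2_top (u + v) = G2_top u + G2_top v.
Proof.
have [c ->] := G2_std_span u; have [c' ->] := G2_std_span v.
by rewrite G2_vecD !G2_top_vec.
Qed.

Lemma G2_topZ x v : G2_top (x *: v) = x * G2_top v.
Proof. by have [c ->] := G2_std_span v; rewrite G2_vecZ !G2_top_vec. Qed.

Lemma G2_top0 : G2_top 0 = 0.
Proof. by rewrite -(scale0r 0) G2_topZ mul0r. Qed.

Lemma G2_top_sum n (v : 'I_n -> V) : G2_top (\sum_i v i) = \sum_i G2_top (v i).
Proof. exact: (big_morph G2_top G2_topD G2_top0). Qed.

Lemma G2_XnE n : cl 'X^(n + 7) =
  e *: cl 'X^(n + 5) - (4%:R * r ^+ 2) *: cl 'X^(n + 3) - q *: cl 'X^(n + 1).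
Proof.
rewrite -ee4E -!scaleNr -!G2_clsZ -!G2_clsD; apply/G2_cls_eq.
rewrite (_ : _ - _ = 'X^n * f) ?dvdp_mulIr // G2_polyE.
rewrite !mulrDr mulrN -!scalerAr -exprSr -!exprD !scaleNr addn1.
by rewrite !opprD !opprK !addrA.
Qed.

Definition G2_top_pows (r s : F) : seq F := [:: 0; 0; 0; 0; 0; 0; 1; 0; 4%:R * r; 0;
  12%:R * r ^+ 2; 0; 32%:R * r ^+ 3 - 2%:R * s; 0; 80%:R * r ^+ 4 - 16%:R * r * s; 0].

Lemma G2_top_Xn n : (n < 16)%N -> G2_top (cl 'X^n) = nth 0 (G2_top_pows r s) n.
Proof.
elim/ltn_ind: n => n IH n15; have [n7|n7] := ltnP n 7.
  rewrite (_ : cl _ = G2_vec (fun i => (i == n)%:R)) ?G2_top_vec.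
    by move: n n7 {IH n15}; do 7?case=> //.
  congr cl; apply/polyP=> i; rewrite coefXn coef_poly.
  by case: ltnP => // i7; rewrite (gtn_eqF (leq_trans n7 i7)).
have nE : n = (n - 7 + 7)%N by rewrite subnK.
have m8 : (n - 7 < 9)%N by rewrite ltn_subLR.
rewrite nE G2_XnE -!scaleNr !G2_topD !G2_topZ !IH; [|lia..].
move: (n - 7)%N m8 => m m8 {IH nE n7 n15 n}; move: r s eE qE => r s -> ->.
by move: m m8; do 9?case; move=> //= _; ring.
Qed.

Lemma G2_top_vecXn c n : (n < 10)%N ->
  G2_top (G2_vec c * cl 'X^n) = \sum_(i < 7) c i * nth 0 (G2_top_pows r s) (i + n).
Proof.
move=> n10; rewrite /G2_vec poly_def G2_cls_sum mulr_suml G2_top_sum.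
apply: eq_bigr => i _; rewrite G2_clsZ -G2_scaleAl G2_topZ -alg_clsM -exprD.
rewrite G2_top_Xn //; have := ltn_ord i; lia.
Qed.

Definition G2_coefs : seq F := [:: 0; q; 0; e ^+ 2 / 4%:R; 0; - e; 0; 1].

(* With the bilinear form [G2_top (u * v)], the basis dual to [1, x, ..., x^6]
   (Euler). *)
Definition G2_dual (i : nat) : {poly F} :=
  \sum_(j < 7) nth 0 G2_coefs (i.+1 + j) *: 'X^j.

Lemma G2_coord_dual v i : (i < 7)%N ->
  Defs.coord 7 (std_basis a) v i = G2_top (v * cl (G2_dual i)).
Proof.
move=> i7; have [c ->] := G2_std_span v; rewrite G2_coord_std //.
rewrite /G2_dual G2_cls_sum mulr_sumr G2_top_sum.
under eq_bigr => j _.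
  rewrite G2_clsZ -G2_scaleAr G2_topZ G2_top_vecXn ?(leq_trans (ltn_ord j)) //.
  over.
rewrite /G2_coefs ee4E; move: r s eE qE => r s -> -> {v}.
rewrite !big_ord_recr !big_ord0 /=.
by move: i i7; do 7?case; move=> //= _; ring.
Qed.

Lemma G2_dual_deriv : \sum_(i < 7) 'X^i * G2_dual i = f^`().
Proof.
rewrite G2_polyE !derivE /G2_dual /G2_coefs.
rewrite !big_ord_recr !big_ord0 /= -!mul_polyC; ring.
Qed.

Lemma G2_alg_tr v : alg_tr v = G2_top (v * cl f^`()).
Proof.
rewrite -G2_dual_deriv G2_cls_sum mulr_sumr G2_top_sum; apply: eq_bigr => i _.
by rewrite G2_coord_dual // alg_clsM mulrA.
Qed.

Hypotheses (q_neq0 : q != 0) (sep : coprimep f f^`()).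

Lemma G2_trE u v : G2_tr u v = G2_top (u * alg_tau v * cl (G2_z a)).
Proof.
rewrite /G2_tr; set w := _ * cl _; rewrite G2_alg_tr // /alg_div.
case: xgetP => [w' _ <-|H]; first by rewrite mulrC.
have /Bezout_eq1_coprimepP[[g h] /= gh] := sep.
have f'h : cl f^`() * cl h = 1.
  rewrite -[LHS]alg_clsM; apply/G2_cls_eq.
  by rewrite -gh mulrC opprD addrCA subrr addr0 dvdpNr dvdp_mulIr.
by case: (H (cl h * w)); rewrite /= mulrA f'h mul1r.
Qed.

Lemma G2_tau_vec c : alg_tau (G2_vec c) = G2_vec (fun i => (-1) ^+ i * c i).
Proof.
rewrite alg_tau_cls; congr cl; rewrite /poly_tau /= !poly_def raddf_sum.
apply: eq_bigr => i _ /=; rewrite comp_polyZ comp_Xn_poly [(- 'X) ^+ _]exprNn.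
rewrite -[in LHS]signr_odd -[in RHS]signr_odd; case: odd; rewrite ?mul1r //.
by rewrite !mulN1r scalerN scaleNr.
Qed.

Lemma G2_tr_vec c c' : G2_tr (G2_vec c) (G2_vec c') = \sum_(j < 7) (-1) ^+ j * c' j *
  (\sum_(i < 7) c i * nth 0 (G2_top_pows r s) (i + (j + 3))
   - 2%:R * r * \sum_(i < 7) c i * nth 0 (G2_top_pows r s) (i + (j + 1))).
Proof.
rewrite G2_trE G2_tau_vec -mulrA [X in _ * (X * _)]/G2_vec -alg_clsM poly_def mulr_suml.
rewrite G2_cls_sum mulr_sumr G2_top_sum; apply: eq_bigr => j _.
rewrite -scalerAl G2_clsZ -G2_scaleAr G2_topZ; congr (_ * _).
have -> : 'X^j * G2_z a = 'X^(j + 3) + (- (2%:R * r)) *: 'X^(j + 1).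
  rewrite /G2_z [X in X / 2%:R]/= e2E -mul_polyC polyCN !exprD; ring.
have j7 := ltn_ord j.
rewrite G2_clsD G2_clsZ mulrDr -G2_scaleAr G2_topD G2_topZ.
by rewrite !G2_top_vecXn ?mulNr //; lia.
Qed.

Definition G2_std_coords (d : nat -> F) : seq F :=
  [:: q * d 0%N; d 1%N; d 2%N + 4%:R * r ^+ 2 * d 0%N - 2%:R * r * d 4%N;
      d 3%N - 2%:R * r * d 5%N; d 4%N - 4%:R * r * d 0%N - 2%:R * r * d 6%N;
      d 5%N; d 6%N + d 0%N].

Lemma G2_basis_sum (d : nat -> F) :
  \sum_(i < 7) d i *: G2_basis a i = G2_vec (nth 0 (G2_std_coords d)).
Proof.
rewrite -(@eq_bigr _ _ _ _ _ _ (fun i : 'I_7 => cl (d i *: (if i == 0%N :> nat then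
  G2_poly e q else if (i <= 3)%N then 'X^i else 'X^(i - 3) * G2_z a)))); last first.
  by move=> i _; rewrite G2_clsZ.
rewrite -G2_cls_sum; congr cl; rewrite /G2_std_coords.
rewrite poly_def !big_ord_recr !big_ord0 /= /G2_poly /G2_z [X in X / 2%:R]/= e2E ee4E.
move: r eE => r ->.
rewrite -!mul_polyC; ring.
Qed.

Lemma G2_basis_free (d : nat -> F) : \sum_(i < 7) d i *: G2_basis a i = 0 ->
  forall i, (i < 7)%N -> d i = 0.
Proof.
rewrite G2_basis_sum -G2_std_sum => /G2_std_free H.
have d0 : d 0%N = 0.
  by have /eqP := H 0%N isT; rewrite /= mulf_eq0 (negbTE q_neq0) => /eqP.
have d6 : d 6 = 0 by have := H 6 isT; rewrite /= d0 addr0.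
have d5 : d 5 = 0 by have := H 5 isT.
have d4 : d 4 = 0 by have := H 4 isT; rewrite /= d0 d6 !mulr0 !subr0.
have d3 : d 3 = 0 by have := H 3 isT; rewrite /= d5 mulr0 subr0.
have d2 : d 2%N = 0 by have := H 2%N isT; rewrite /= d0 d4 !mulr0 subr0 addr0.
have d1 : d 1%N = 0 by have := H 1%N isT.
by do 7?case.
Qed.

Lemma G2_basis_coord (d : nat -> F) i : (i < 7)%N ->
  Defs.coord 7 (G2_basis a) (G2_vec (nth 0 (G2_std_coords d))) i = d i.
Proof. by move=> i7; rewrite -G2_basis_sum; apply: coord_sum => //; exact: G2_basis_free. Qed.

(* The coordinates in [1, x, ..., x^6] of the vector with coordinates [w] in a
   frame which brings the form to [phi] and is defined over every ring
   containing [e], [q] and [1 / 2]. *)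
Definition G2_frame_coords w : seq F :=
  [:: s * co w 1 + r * co w 2 + co w 4;
      4%:R * r * co w 0 - co w 3 - 6%:R * r ^+ 2 * co w 6;
      6%:R * r ^+ 2 * co w 1 + co w 2 - 2%:R * r * co w 5;
      - co w 0; - (5%:R * r * co w 1) + co w 5; co w 6; co w 1].

Definition G2_frame w : V := G2_vec (nth 0 (G2_frame_coords w)).

Let unit_coord w := (s * co w 1 + r * co w 2 + co w 4) / q.

Definition G2_frame_G2_coords w : seq F :=
  [:: unit_coord w; 4%:R * r * co w 0 - co w 3 - 6%:R * r ^+ 2 * co w 6;
      co w 2; - co w 0 + 2%:R * r * co w 6;
      - (3%:R * r * co w 1) + co w 5 + 2%:R * r * unit_coord w; co w 6;
      co w 1 - unit_coord w].

Lemma G2_vec_eq c c' : (forall i, (i < 7)%N -> c i = c' i) -> G2_vec c = G2_vec c'.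
Proof.
move=> cc'; rewrite /G2_vec; congr alg_cls; apply/polyP => i; rewrite !coef_poly.
by case: ltnP => // /cc'.
Qed.

Lemma G2_frame_basis w :
  G2_frame w = G2_vec (nth 0 (G2_std_coords (nth 0 (G2_frame_G2_coords w)))).
Proof.
apply: G2_vec_eq; rewrite /G2_std_coords /G2_frame_G2_coords /G2_frame_coords.
rewrite /unit_coord; move: s qE q_neq0 => s -> q0.
have s0 : s != 0 by apply: contraNneq q0 => ->; rewrite mulr0.
move: r => r; apply: cv7_split => //=; field; by rewrite ?s0 ?two_neq0.
Qed.

Lemma G2_frame_coord w i : (i < 7)%N ->
  Defs.coord 7 (G2_basis a) (G2_frame w) i = nth 0 (G2_frame_G2_coords w) i.
Proof. by move=> i7; rewrite G2_frame_basis G2_basis_coord. Qed.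

Lemma G2_tr_frame x y : G2_tr (G2_frame x) (G2_frame y) =
  let d := nth 0 (G2_frame_G2_coords x) in let d' := nth 0 (G2_frame_G2_coords y) in
  d 1 * d' 2 - d 2 * d' 1 - 2%:R * r * (d 2 * d' 3 - d 3 * d' 2)
  - q * (d 3 * d' 6 - d 6 * d' 3) + q * (d 4 * d' 5 - d 5 * d' 4)
  - 2%:R * r * q * (d 5 * d' 6 - d 6 * d' 5).
Proof.
rewrite G2_tr_vec //; set c := nth 0 (G2_frame_coords x).
set c' := nth 0 (G2_frame_coords y).
have cE : c =1 nth 0 (G2_frame_coords x) by [].
have c'E : c' =1 nth 0 (G2_frame_coords y) by [].
move: c c' cE c'E => c c' cE c'E.
rewrite !big_ord_recr !big_ord0 /= !cE !c'E.
rewrite /G2_frame_G2_coords /G2_frame_coords /unit_coord /=.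
move: s qE q_neq0 => s -> q0; have s0 : s != 0 by apply: contraNneq q0 => ->; rewrite mulr0.
move: r (co x) (co y) => r x' y'.
move: (x' _) (x' _) (x' _) (x' _) (x' _) (x' _) (x' _) => x0 x1 x2 x3 x4 x5 x6.
move: (y' _) (y' _) (y' _) (y' _) (y' _) (y' _) (y' _) => y0 y1 y2 y3 y4 y5 y6.
field; by rewrite ?s0 ?two_neq0.
Qed.

Lemma G2_form_frame (w : 'I_3 -> 'cV[F]_7) :
  G2_form (fun j => G2_frame (w j)) = phi (w (inord 0)) (w (inord 1)) (w (inord 2)).
Proof.
rewrite /G2_form !wedge111E /wedge12 /=.
move: (w _) (w _) (w _) => z y x.
rewrite !G2_tr_frame // /G2_delta /G2_eta /G2_eps !G2_frame_coord //=.
rewrite /phi /minor3 /minor2 /unit_coord.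
move: s qE q_neq0 => s -> q0; have s0 : s != 0 by apply: contraNneq q0 => ->; rewrite mulr0.
move: r (co x) (co y) (co z) => r x' y' z'.
move: (x' _) (x' _) (x' _) (x' _) (x' _) (x' _) (x' _) => x0 x1 x2 x3 x4 x5 x6.
move: (y' _) (y' _) (y' _) (y' _) (y' _) (y' _) (y' _) => y0 y1 y2 y3 y4 y5 y6.
move: (z' _) (z' _) (z' _) (z' _) (z' _) (z' _) (z' _) => z0 z1 z2 z3 z4 z5 z6.
field; by rewrite ?s0 ?two_neq0.
Qed.

Lemma G2_frameD w w' : G2_frame (w + w') = G2_frame w + G2_frame w'.
Proof.
rewrite /G2_frame G2_vecD; apply: G2_vec_eq; rewrite /G2_frame_coords.
by apply: cv7_split; rewrite /= ?coD; ring.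
Qed.

Lemma G2_frameZ b w : G2_frame (b *: w) = b *: G2_frame w.
Proof.
rewrite /G2_frame G2_vecZ; apply: G2_vec_eq; rewrite /G2_frame_coords.
by apply: cv7_split; rewrite /= ?coZ; ring.
Qed.

Lemma G2_x_vec c : alg_x a * G2_vec c = G2_vec (nth 0 [:: 0; c 0 - q * c 6; c 1;
  c 2 - e ^+ 2 / 4%:R * c 6; c 3; c 4 + e * c 6; c 5]).
Proof.
rewrite -[LHS]alg_clsM; apply/G2_cls_eq/dvdpP; exists (c 6)%:P; rewrite G2_polyE.
by rewrite !poly_def !big_ord_recr !big_ord0 /= -!mul_polyC; ring.
Qed.

Definition G2_frame_x w : 'cV[F]_7 := let w := co w in
  cv7 [:: - (2%:R * r ^+ 2 * w 1%N) - w 2%N + 2%:R * r * w 5%N; w 6%N;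
    2%:R * r * w 0%N - w 3%N - 2%:R * r ^+ 2 * w 6%N;
    (s - 2%:R * r ^+ 3) * w 1%N - 5%:R * r * w 2%N - w 4%N + 2%:R * r ^+ 2 * w 5%N;
    - (2%:R * r ^+ 2 * w 0%N) + r * w 3%N + (2%:R * r ^+ 3 - s) * w 6%N;
    - w 0%N + 5%:R * r * w 6%N; - (r * w 1%N) + w 5%N].

Lemma G2_frame_xE w : alg_x a * G2_frame w = G2_frame (G2_frame_x w).
Proof.
rewrite /G2_frame G2_x_vec; apply: G2_vec_eq; rewrite /G2_frame_coords /G2_frame_x.
rewrite ee4E; move: r s eE qE => r s -> ->; apply: cv7_split; rewrite /= ?co_cv7 //=; ring.
Qed.

Lemma G2_frame_x_skew x y z :
  phi (G2_frame_x x) y z + phi x (G2_frame_x y) z + phi x y (G2_frame_x z) = 0.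
Proof.
rewrite /phi /minor3 /minor2 /G2_frame_x /= !co_cv7 //=.
move: (co x) (co y) (co z) => x' y' z'.
move: (x' _) (x' _) (x' _) (x' _) (x' _) (x' _) (x' _) => x0 x1 x2 x3 x4 x5 x6.
move: (y' _) (y' _) (y' _) (y' _) (y' _) (y' _) (y' _) => y0 y1 y2 y3 y4 y5 y6.
move: (z' _) (z' _) (z' _) (z' _) (z' _) (z' _) (z' _) => z0 z1 z2 z3 z4 z5 z6.
move: r s => r s; ring.
Qed.

Definition G2_unframe w : 'cV[F]_7 := let w := co w in
  cv7 [:: - w 3%N; w 6%N; w 2%N + 2%:R * r * w 4%N + 4%:R * r ^+ 2 * w 6%N;
    - w 1%N - 4%:R * r * w 3%N - 6%:R * r ^+ 2 * w 5%N;
    w 0%N - r * w 2%N - 2%:R * r ^+ 2 * w 4%N - (s + 4%:R * r ^+ 3) * w 6%N;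
    w 4%N + 5%:R * r * w 6%N; w 5%N].

Lemma G2_unframeK w : cv7 (G2_frame_coords (G2_unframe w)) = w.
Proof.
apply: cv7P; rewrite /G2_unframe /=; apply: cv7_split;
  rewrite /G2_frame_coords !co_cv7 //=; ring.
Qed.

End G2Algebra.

Lemma linear_colE (R : nzRingType) (V : lmodType R) n (g : 'cV[R]_n -> V) :
  (forall x y, g (x + y) = g x + g y) -> (forall b x, g (b *: x) = b *: g x) ->
  forall x, g x = \sum_j x j 0 *: g (delta_mx j 0).
Proof.
move=> gD gZ x; have g0 : g 0 = 0 by apply: (addrI (g 0)); rewrite -gD !addr0.
have {1}-> : x = \sum_j x j 0 *: delta_mx j 0.
  rewrite {1}[x]matrix_sum_delta; apply: eq_bigr => j _.
  by rewrite (big_ord_recl 0) big_ord0 addr0.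
by rewrite (big_morph g gD g0); apply: eq_bigr => j _; rewrite gZ.
Qed.

Definition col_mx_of (R : nzRingType) m n (g : 'cV[R]_n -> 'cV[R]_m) : 'M[R]_(m, n) :=
  \matrix_(i, j) g (delta_mx j 0) i 0.

Lemma col_mx_ofE (R : comNzRingType) m n (g : 'cV[R]_n -> 'cV[R]_m) :
  (forall x y, g (x + y) = g x + g y) -> (forall b x, g (b *: x) = b *: g x) ->
  forall x, col_mx_of g *m x = g x.
Proof.
move=> gD gZ x; rewrite (linear_colE gD gZ); apply/colP=> i.
rewrite mxE summxE; apply: eq_bigr => j _; by rewrite !mxE mulrC.
Qed.

Lemma hintN (E : hdvf) x : x \in @hint E -> - x \in @hint E.
Proof. by rewrite rpredN. Qed.

Ltac subring_tac := repeat first [ done | apply: rpred_nat | apply: rpredD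
  | apply: hintN | apply: rpredM | apply: rpredX | apply/andP; split ].

Section G2FrameLattice.
Variables (E : hdvf) (e q : E).
Local Notation Oi := (@hint E).
Hypotheses (unit2 : 2%:R \in @hunit E) (e_int : e \in Oi) (q_int : q \in Oi).

Let half_int : 2%:R^-1 \in Oi. Proof. by apply/hunitW/hunitV. Qed.
Let r_int : e / 4%:R \in Oi.
Proof. by rewrite (natrM _ 2 2) invfM !rpredM. Qed.
Let s_int : q / 2%:R \in Oi. Proof. by rewrite rpredM. Qed.

Lemma cv7_int (c : seq E) : all [in Oi] c -> cv7 c \is a mxOver Oi.
Proof.
move=> /allP c_int; apply/mxOverP=> i j; rewrite mxE.
have [ic|ic] := ltnP i (size c); first by rewrite c_int // mem_nth.
by rewrite nth_default // rpred0.
Qed.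

Lemma G2_frame_coords_int w : w \is a mxOver Oi -> all [in Oi] (G2_frame_coords e q w).
Proof.
move=> /mxOverP w_int; have co_int i : co w i \in Oi by apply: w_int.
rewrite /G2_frame_coords /=.
move: (e / 4%:R) (q / 2%:R) r_int s_int (co w) co_int => r s r_int' s_int' cw cw_int.
subring_tac.
Qed.

Lemma G2_unframe_int w : w \is a mxOver Oi -> G2_unframe e q w \is a mxOver Oi.
Proof.
move=> /mxOverP w_int; have co_int i : co w i \in Oi by apply: w_int.
apply: cv7_int; rewrite /=.
move: (e / 4%:R) (q / 2%:R) r_int s_int (co w) co_int => r s r_int' s_int' cw cw_int.
subring_tac.
Qed.

Lemma G2_frame_coords_mx_GLO :
  col_mx_of (fun w => cv7 (G2_frame_coords e q w)) \in GLO 7.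
Proof.
have frameD w w' : cv7 (G2_frame_coords e q (w + w')) =
    cv7 (G2_frame_coords e q w) + cv7 (G2_frame_coords e q w').
  by apply: cv7P; apply: cv7_split; rewrite coD !co_cv7 //= ?coD; ring.
have frameZ b w : cv7 (G2_frame_coords e q (b *: w)) = b *: cv7 (G2_frame_coords e q w).
  by apply: cv7P; apply: cv7_split; rewrite coZ !co_cv7 //= ?coZ; ring.
have delta_int j : (delta_mx j 0 : 'cV[E]_7) \is a mxOver Oi.
  by apply/mxOverP=> i l; rewrite mxE rpred_nat.
apply: (@GLO_inv _ _ _ (col_mx_of (G2_unframe e q))).
- apply/mxOverP=> i j; rewrite mxE.
  by have /mxOverP := cv7_int (G2_frame_coords_int (delta_int j)); apply.
- apply/mxOverP=> i j; rewrite mxE.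
  by have /mxOverP := G2_unframe_int (delta_int j); apply.
apply/matrixP=> i j.
have eqc (B : 'M[E]_7) : B i j = (B *m delta_mx j 0 : 'cV_7) i 0 by rewrite -colE mxE.
rewrite !eqc -mulmxA !col_mx_ofE ?mul1mx ?G2_unframeK //.
  by move=> x y; apply: cv7P; apply: cv7_split; rewrite coD !co_cv7 //= ?coD; ring.
by move=> b x; apply: cv7P; apply: cv7_split; rewrite coZ !co_cv7 //= ?coZ; ring.
Qed.

End G2FrameLattice.

Section SplitForms.
Variables (E : fieldType) (S : ('I_3 -> 'cV[E]_7) -> E) (h1 : 'M[E]_7).
Hypothesis h1u : h1 \in unitmx.
Hypothesis S_h1 : forall w,
  S (fun i => h1 *m w i) = phi (w (inord 0)) (w (inord 1)) (w (inord 2)).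

Lemma split_formE v :
  S v = phi (invmx h1 *m v (inord 0)) (invmx h1 *m v (inord 1)) (invmx h1 *m v (inord 2)).
Proof.
rewrite -(S_h1 (fun i => invmx h1 *m v i)); congr S; apply: funext => i.
by rewrite mulKVmx.
Qed.

Lemma split_form_skew (gamma X : 'M[E]_7) :
  (forall x y z, phi (X *m x) y z + phi x (X *m y) z + phi x y (X *m z) = 0) ->
  gamma *m h1 = h1 *m X ->
  forall v, \sum_i S (fun j => if j == i then gamma *m v j else v j) = 0.
Proof.
move=> X_skew gh v; have hg u : invmx h1 *m (gamma *m u) = X *m (invmx h1 *m u).
  by rewrite -{1}[u](mulKVmx h1u) [gamma *m _]mulmxA gh -mulmxA mulKmx.
have iE i j : (i < 3)%N -> (j < 3)%N -> ((inord i : 'I_3) == inord j) = (i == j).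
  by move=> i3 j3; rewrite -val_eqE /= !inordK.
rewrite -[RHS](X_skew (invmx h1 *m v (inord 0)) (invmx h1 *m v (inord 1))
  (invmx h1 *m v (inord 2))) -!hg.
have big3 (G : 'I_3 -> E) : \sum_i G i = G (inord 0) + G (inord 1) + G (inord 2).
  rewrite !big_ord_recr big_ord0 /= add0r; congr (G _ + G _ + G _);
  by apply: val_inj; rewrite /= inordK.
by rewrite big3 !split_formE !iE //=.
Qed.

End SplitForms.

Lemma split_form_homogeneous (E : hdvf) (S : ('I_3 -> 'cV[E]_7) -> E) (h1 g : 'M[E]_7) :
  2%:R \in @hunit E -> 3%:R \in @hunit E -> h1 \in GLO 7 ->
  (forall w, S (fun i => h1 *m w i) = phi (w (inord 0)) (w (inord 1)) (w (inord 2))) ->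
  \det g \in @hunit E ->
  (forall v, (forall i, v i \is a mxOver (@hint E)) -> S (fun i => g *m v i) \in @hint E) ->
  exists h, [/\ h \in GLO 7, g *m h \in unitmx,
    forall v, S (fun i => g *m h *m v i) = S v & \det (g *m h) = 1].
Proof.
move=> unit2 unit3 h1O S_h1 gd g_int; have h1u := GLO_unit h1O.
have [||h hO [h_phi h_det]] := @split_G2_lattice E unit2 unit3 (invmx h1 *m g).
- rewrite det_mulmx det_inv hunitM // hunitV //.
  by move: h1O; rewrite GLO_det => /andP[].
- move=> x y z Ox Oy Oz.
  have := g_int (fun i : 'I_3 => nth 0 [:: x; y; z] i); rewrite (split_formE h1u S_h1).
  rewrite !inordK //= !mulmxA; apply => -[[|[|[|//]]] ?] //=.
exists (h *m invmx h1).
have gh1 : g *m (h *m invmx h1) = h1 *m (invmx h1 *m g *m h) *m invmx h1.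
  by rewrite !mulmxA mulmxV // mul1mx.
have detgh : \det (g *m (h *m invmx h1)) = 1.
  by rewrite gh1 det_mulmx mulrC -det_mulmx mulKmx // h_det.
split=> //.
- by apply: GLO_M hO (GLO_V h1O).
- by rewrite unitmxE detgh unitr1.
move=> v; rewrite !(split_formE h1u S_h1) -[RHS]h_phi gh1.
by rewrite -!mulmxA !(mulKmx h1u).
Qed.

Section G2FrameMatrix.
Variables (F : fieldType) (e q : F).
Local Notation X := (col_mx_of (G2_frame_x e q)).

Lemma G2_frame_x_mx w : X *m w = G2_frame_x e q w.
Proof.
apply: col_mx_ofE => [x y|b x]; apply: cv7P; apply: cv7_split;
  rewrite !coE !co_cv7 //= !coE; ring.
Qed.

Lemma G2_frame_x_tr : \tr X = 0.
Proof.
rewrite /mxtrace sum7 !mxE !inordK //= !co_delta //.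
have valE i j : (i < 7)%N -> (\val (inord i : 'I_7) == j) = (i == j).
  by move=> i7; rewrite -[\val _]/(nat_of_ord _) inordK.
rewrite !valE //=; ring.
Qed.

End G2FrameMatrix.

Lemma mulmx_inj (R : pzSemiRingType) m n (A B : 'M[R]_(m, n)) :
  (forall x : 'cV_n, A *m x = B *m x) -> A = B.
Proof.
move=> AB; apply/matrixP=> i j.
by have /colP/(_ i) := AB (delta_mx j 0); rewrite -!colE !mxE.
Qed.

Section G2Case.
Variable k : fieldType.
Local Notation F := (laurent k).
Local Notation K := (laurent_hdvf k).
Variables (e q : fps k).
Local Notation a := ((e, q) : cpoint G2 (fps k)).
Local Notation eF := (OtoF k e).
Local Notation qF := (OtoF k q).
Hypothesis hk : admissible G2 k.
Hypothesis ha : regular_semisimple (to_generic a).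
Variables (T : tensor G2 k) (cB c0 : k).
Hypotheses (hcB : cB != 0) (hc0 : c0 != 0).
Variable Phi : {linear 'cV[F]_7 -> Va a}.
Hypothesis hPhi : @identification G2 k a T cB c0 Phi.
Variable gamma : 'M[F]_7.
Hypothesis hgamma : forall u, Phi (gamma *m u) = alg_x (to_generic a) * Phi u.

Let Phi_bij : bijective Phi. Proof. by case: hPhi. Qed.

Let nat_unit n : n%:R != 0 :> k -> n%:R \in @hunit K.
Proof. by move=> n0; rewrite -(rmorph_nat (ktoF k)); apply: ktoF_unit. Qed.
Let unit2 : 2%:R \in @hunit K.
Proof. by apply: nat_unit; case: hk; rewrite inE. Qed.
Let unit3 : 3%:R \in @hunit K.
Proof. by apply: nat_unit; case: hk => _; rewrite inE. Qed.
Let two_neq0 : 2%:R != 0 :> F. Proof. exact: (hunit_neq0 unit2). Qed.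

Let q_sep : qF != 0 /\ coprimep (@spectral_poly G2 F (eF, qF))
  (@spectral_poly G2 F (eF, qF))^`().
Proof. exact: G2_regular_semisimple two_neq0 ha. Qed.

Lemma G2_exists_frame_mx : exists h1 : 'M[F]_7, forall w, Phi (h1 *m w) = G2_frame eF qF w.
Proof.
have [Psi PhiK PsiK] := Phi_bij.
exists (col_mx_of (fun w => Psi (G2_frame eF qF w))) => w.
rewrite col_mx_ofE => [|x y|b x]; first exact: PsiK.
- by apply: (bij_inj Phi_bij); rewrite linearD !PsiK; apply: G2_frameD.
- by apply: (bij_inj Phi_bij); rewrite linearZ !PsiK; apply: G2_frameZ.
Qed.

Variable h1 : 'M[F]_7.
Hypothesis Phi_h1 : forall w, Phi (h1 *m w) = G2_frame eF qF w.

Let h1_int : h1 \is a mxOver (@hint K).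
Proof.
apply: Ocol_GLO_int => x Ox; have [_ Phi_Od _ _] := hPhi.
suff [y Oy /(bij_inj Phi_bij) <-] : (Phi @` @Od G2 k) (Phi (h1 *m x)).
  by move: Oy; rewrite OdE.
rewrite Phi_Od Phi_h1.
have coords_int := @G2_frame_coords_int K eF qF unit2 (OtoF_int e) (OtoF_int q) x Ox.
have /choice[o Ho] : forall i, exists o, nth 0 (G2_frame_coords eF qF x) i = OtoF k o.
  move=> i; apply/OintP; have [i7|i7] := ltnP i 7; first exact: (all_nthP 0 coords_int).
  by rewrite nth_default //; apply: (@rpred0 _ (@hint K)).
exists (\poly_(i < 7) o i); congr alg_cls; apply/polyP=> i.
rewrite [poly_base_change _ _]/= coef_map !coef_poly; case: ifP => _; first exact: Ho.
exact: esym (rmorph0 (OtoF k)).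
Qed.

Let det_h1 : \det h1 \in @hunit K.
Proof.
have [_ _ _ /(_ I (fun j => col j h1))] := hPhi.
set B := \matrix_(i, j) _; set B' := \matrix_(i, j) _ => detE.
have B'E : B' = h1 by apply/matrixP=> i j; rewrite !mxE.
have BE : B = col_mx_of (fun w => cv7 (G2_frame_coords eF qF w)).
  apply/matrixP=> i j; rewrite !mxE -(@G2_coord_std F eF qF
    (nth 0 (G2_frame_coords eF qF (delta_mx j 0))) i (ltn_ord i)).
  by congr Defs.coord; rewrite colE Phi_h1.
have cu c : c != 0 -> ktoF k c \in @hunit K by move=> c0'; apply: ktoF_unit.
have -> : \det h1 = (ktoF k c0)^-1 * (ktoF k cB * \det B).
  by rewrite detE B'E mulKf // fmorph_eq0.
apply: hunitM; first by apply: hunitV; apply: cu.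
apply: hunitM; first exact: cu.
have := @G2_frame_coords_mx_GLO K eF qF unit2 (OtoF_int e) (OtoF_int q).
by rewrite (@GLO_det K) BE => /andP[].
Qed.

Let h1_GLO : h1 \in @GLO K 7.
Proof. by rewrite (@GLO_det K) h1_int det_h1. Qed.

Let form_h1 (w : 'I_3 -> 'cV[F]_7) : @std_form G2 k F (ktoF k) T (fun i => h1 *m w i) =
  phi (w (inord 0)) (w (inord 1)) (w (inord 2)).
Proof.
have [_ _ <- _] := hPhi; have [q0 sep] := q_sep.
rewrite -(G2_form_frame two_neq0 q0 sep); congr (@G2_form F (eF, qF) _).
by apply: funext => i; apply: Phi_h1.
Qed.

Let gamma_h1 : gamma *m h1 = h1 *m col_mx_of (G2_frame_x eF qF).
Proof.
apply: mulmx_inj => x; apply: (bij_inj Phi_bij).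
rewrite -[gamma *m _ *m _]mulmxA hgamma -[h1 *m _ *m _]mulmxA !Phi_h1 G2_frame_x_mx.
exact: G2_frame_xE.
Qed.

Lemma G2_springer_fiber_bij_frame :
  set_bij (@springer_fiber G2 k T gamma) (@spectral_lattice G2 k a)
    (fun C => Phi @` coset_lattice C).
Proof.
have [_ Phi_Od Phi_T _] := hPhi; have h1u := GLO_unit h1_GLO.
apply: (@springer_fiber_bij G2 k a T Phi gamma Phi_bij Phi_Od Phi_T hgamma).
- by move=> g [_ _ ->] //; apply: (@hunit1 K).
- move=> g gu gd gint.
  have [h [hO ghu ghT ghd]] :=
    @split_form_homogeneous K (@std_form G2 k F (ktoF k) T) h1 g unit2 unit3 h1_GLO
      form_h1 gd gint.
  by exists h.
- apply: (@split_form_skew F (@std_form G2 k F (ktoF k) T) h1 h1u form_h1 gamma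
    (col_mx_of (G2_frame_x eF qF)) _ gamma_h1) => x y z.
  by rewrite !G2_frame_x_mx G2_frame_x_skew.
move=> _; rewrite -[gamma](mulmxK h1u) gamma_h1 mxtrace_mulC mulKmx //.
exact: G2_frame_x_tr.
Qed.

End G2Case.

Lemma G2_springer_fiber_bij (k : fieldType) (hG : admissible G2 k) (a : cpoint G2 (fps k))
    (ha : regular_semisimple (to_generic a)) (T : tensor G2 k) (cB c0 : k)
    (hcB : cB != 0) (hc0 : c0 != 0)
    (Phi : {linear 'cV[laurent k]_(gdim G2) -> Va a}) (hPhi : identification T cB c0 Phi)
    (gamma : 'M[laurent k]_(gdim G2))
    (hgamma : forall u, Phi (gamma *m u) = alg_x (to_generic a) * Phi u) :
  set_bij (springer_fiber T gamma) (spectral_lattice a)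
    (fun C => Phi @` coset_lattice C).
Proof.
case: a ha Phi hPhi hgamma => e q ha Phi hPhi hgamma.
have [h1 Phi_h1] := G2_exists_frame_mx hPhi.
exact: (G2_springer_fiber_bij_frame hG ha hcB hc0 hPhi hgamma Phi_h1).
Qed.

Theorem theorem5p2 (G : grp) (k : fieldType) (hGk : admissible G k)
  (a : cpoint G (fps k)) (ha : regular_semisimple (to_generic a))
  (T : tensor G k) (hT : standard_tensor T)
  (cB c0 : k) (hcB : cB != 0) (hc0 : c0 != 0)
  (Phi : {linear 'cV[laurent k]_(gdim G) -> Va a})
  (hPhi : identification T cB c0 Phi)
  (gamma : 'M[laurent k]_(gdim G))
  (hgamma : forall u, Phi (gamma *m u) = alg_x (to_generic a) * Phi u) :
  set_bij (springer_fiber T gamma) (spectral_lattice a)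
    (fun C => Phi @` coset_lattice C).
Proof.
case: G hGk a ha T hT Phi hPhi gamma hgamma => [m|m|m|] hG a ha T hT Phi hPhi gamma hgamma.
- exact: (Sp_springer_fiber_bij hG hT hPhi hgamma).
- exact: (SOodd_springer_fiber_bij hG hT hPhi hgamma).
- exact: (SOeven_springer_fiber_bij hG hT hPhi hgamma).
exact: (G2_springer_fiber_bij hG ha hcB hc0 hPhi hgamma).
Qed.
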